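(* Let $\phi\in\mathcal{H}^{\infty}(\mathbb{D})$ be a Cowen-Douglas function that is invertible in the Banach algebra $\mathcal{H}^{\infty}(\mathbb{D})$, with inverse $\phi^{-1}=1/\phi$, and let $T$ be the backward shift operator on $\mathcal{L}^2(\mathbb{N})$. Then for each property $\alpha\in\{$Devaney chaotic, distributionally chaotic, strong mixing, Li-Yorke chaotic, hypercyclic$\}$, $\phi(T)$ has property $\alpha$ if and only if $\phi^{-1}(T)$ has property $\alpha$.
   Context: $\mathbb{D}=\{z\in\mathbb{C}:|z|<1\}$; $\mathbb{N}$ denotes the positive integers. $\mathcal{L}^2(\mathbb{N})$ is the complex Hilbert space of square-summable sequences, and $T(x_1,x_2,\dots)=(x_2,x_3,\dots)$. $\mathcal{H}^2(\mathbb{D})$ is the Hardy space of analytic functions $g$ on $\mathbb{D}$ with $\|g\|_{\mathcal{H}^2}^2=\sup_{r<1}\int_{-\pi}^{\pi}|g(re^{i\theta})|^2\frac{d\theta}{2\pi}<\infty$, a Hilbert space. $\mathcal{H}^\infty(\mathbb{D})$ is the Banach algebra of bounded analytic functions on $\mathbb{D}$ with the sup norm. For $\phi\in\mathcal{H}^\infty(\mathbb{D})$, $M_\phi g=\phi g$ on $\mathcal{H}^2(\mathbb{D})$, with adjoint $M_\phi^*$. Write $\bar\phi(\mathbb{D})=\{\overline{\phi(z)}:z\in\mathbb{D}\}$. For $\psi(z)=\sum_{k\ge0}a_kz^k\in\mathcal{H}^\infty(\mathbb{D})$, $\psi(T)$ is the bounded operator given by the $\mathcal{H}^\infty$ functional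 calculus: $\psi(T)x=\lim_{r\to1^-}\sum_{k\ge0}a_kr^kT^kx$ for $x\in\mathcal{L}^2(\mathbb{N})$. Cowen-Douglas class: for a connected open set $\Omega\subset\mathbb{C}$, $n\in\mathbb{N}$ and a Hilbert space $\mathbb{H}$, $\mathcal{B}_n(\Omega)$ is the set of bounded linear operators $A$ on $\mathbb{H}$ such that (1) $\Omega\subset\sigma(A)$; (2) $\mathrm{ran}(A-\omega)=\mathbb{H}$ for every $\omega\in\Omega$; (3) the closed linear span of $\bigcup_{\omega\in\Omega}\ker(A-\omega)$ is $\mathbb{H}$; (4) $\dim\ker(A-\omega)=n$ for every $\omega\in\Omega$. A function $\phi\in\mathcal{H}^\infty(\mathbb{D})$ is a Cowen-Douglas function if $M_\phi^*\in\mathcal{B}_n(\bar\phi(\mathbb{D}))$ (with $\mathbb{H}=\mathcal{H}^2(\mathbb{D})$) for some $n\in\mathbb{N}$. Chaos notions for a bounded linear operator $A$ on a Hilbert space $\mathbb{H}$: - Li-Yorke chaotic: there is $x\in\mathbb{H}$ with $\limsup_{n\to\infty}\|A^nx\|>0$ and $\liminf_{n\to\infty}\|A^nx\|=0$. - Hypercyclic: there is $x\in\mathbb{H}$ whose orbit $\{A^nx:n\ge 0\}$ is dense in $\mathbb{H}$. - Devaney chaotic: $A$ is topologically transitive, its periodic points are dense, and it has sensitive dependence on initial conditions. - Strong mixing: for all nonempty open $U,V\subset\mathbb{H}$ there is $N$ with $A^n(U)\cap V\ne\emptyset$ for all $n\ge N$. - Distributionally chaotic: there is an uncountable set $S\subset\mathbb{H}$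 such that for all distinct $x,y\in S$: $\limsup_{n\to\infty}\frac1n\#\{0\le i<n:\|A^ix-A^iy\|<\tau\}=1$ for every $\tau>0$, and $\liminf_{n\to\infty}\frac1n\#\{0\le i<n:\|A^ix-A^iy\|<\varepsilon\}=0$ for some $\varepsilon>0$. *)

(* Defs.v *)
From Stdlib Require Import Reals Lra Lia List Classical ClassicalEpsilon
  FunctionalExtensionality ProofIrrelevance.
From Coquelicot Require Import Coquelicot.
Open Scope R_scope.

(** Inner product of a complex Hilbert space, recovered from its norm by the
    polarization identity; linear in the first argument. *)
Definition inner {V : NormedModule C_AbsRing} (x y : V) : C :=
  ( (norm (plus x y) ^ 2 - norm (minus x y) ^ 2) / 4,
    (norm (plus x (scal Ci y)) ^ 2 - norm (minus x (scal Ci y)) ^ 2) / 4 ).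

Definition is_adjoint {V : NormedModule C_AbsRing} (A B : V -> V) : Prop :=
  forall x y, inner (A x) y = inner x (B y).

Definition shifted {V : NormedModule C_AbsRing} (A : V -> V) (w : C) (x : V) : V :=
  minus (A x) (scal w x).

(** [is_linear] includes boundedness. *)
Definition spectrum {V : NormedModule C_AbsRing} (A : V -> V) (w : C) : Prop :=
  ~ exists B : V -> V, is_linear B /\
      (forall x, B (shifted A w x) = x) /\ (forall x, shifted A w (B x) = x).

Definition kernel {V : NormedModule C_AbsRing} (A : V -> V) (x : V) : Prop :=
  A x = zero.

Inductive lin_span {V : NormedModule C_AbsRing} (S : V -> Prop) : V -> Prop :=
| lin_span_zero : lin_span S zero
| lin_span_add (c : C) (x y : V) :
    S x -> lin_span S y -> lin_span S (plus (scal c x) y).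

Definition dense {V : NormedModule C_AbsRing} (S : V -> Prop) : Prop :=
  forall x (eps : posreal), exists y, S y /\ norm (minus y x) < eps.

(** The basis vectors are [e 1, ..., e n]. *)
Definition has_dim {V : NormedModule C_AbsRing} (S : V -> Prop) (n : nat) : Prop :=
  exists e : nat -> V,
    (forall i, (1 <= i <= n)%nat -> S (e i)) /\
    (forall c : nat -> C, sum_n_m (fun i => scal (c i) (e i)) 1 n = zero ->
       forall i, (1 <= i <= n)%nat -> c i = 0%C) /\
    (forall x, S x -> exists c : nat -> C, x = sum_n_m (fun i => scal (c i) (e i)) 1 n).

Definition connected (Om : C -> Prop) : Prop :=
  forall U V : C -> Prop, open U -> open V ->
    (forall z, Om z -> U z \/ V z) ->
    (exists z, Om z /\ U z) -> (exists z, Om z /\ V z) ->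
    exists z, Om z /\ U z /\ V z.

Definition Cowen_Douglas_class {V : NormedModule C_AbsRing}
    (n : nat) (Om : C -> Prop) (A : V -> V) : Prop :=
  open Om /\ connected Om /\ is_linear A /\
  (forall w, Om w -> spectrum A w) /\
  (forall w, Om w -> forall y, exists x, shifted A w x = y) /\
  dense (lin_span (fun x => exists w, Om w /\ kernel (shifted A w) x)) /\
  (forall w, Om w -> has_dim (kernel (shifted A w)) n).

Definition Li_Yorke_chaotic {V : NormedModule C_AbsRing} (A : V -> V) : Prop :=
  exists x, Rbar_lt 0 (LimSup_seq (fun n => norm (Nat.iter n A x))) /\
            LimInf_seq (fun n => norm (Nat.iter n A x)) = 0.

Definition hypercyclic {V : NormedModule C_AbsRing} (A : V -> V) : Prop :=
  exists x, dense (fun y => exists n, y = Nat.iter n A x).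

Definition topologically_transitive {V : NormedModule C_AbsRing} (A : V -> V) : Prop :=
  forall U W : V -> Prop, open U -> open W -> (exists x, U x) -> (exists x, W x) ->
    exists n, (0 < n)%nat /\ exists x, U x /\ W (Nat.iter n A x).

Definition periodic_point {V : NormedModule C_AbsRing} (A : V -> V) (x : V) : Prop :=
  exists n, (0 < n)%nat /\ Nat.iter n A x = x.

Definition sensitive {V : NormedModule C_AbsRing} (A : V -> V) : Prop :=
  exists delta : posreal, forall x (eps : posreal),
    exists y n, norm (minus y x) < eps /\
      delta < norm (minus (Nat.iter n A y) (Nat.iter n A x)).

Definition Devaney_chaotic {V : NormedModule C_AbsRing} (A : V -> V) : Prop :=
  topologically_transitive A /\ dense (periodic_point A) /\ sensitive A.

Definition strong_mixing {V : NormedModule C_AbsRing} (A : V -> V) : Prop :=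
  forall U W : V -> Prop, open U -> open W -> (exists x, U x) -> (exists x, W x) ->
    exists N, forall n, (N <= n)%nat -> exists x, U x /\ W (Nat.iter n A x).

Definition countable {X : Type} (S : X -> Prop) : Prop :=
  exists f : X -> nat, forall x y, S x -> S y -> f x = f y -> x = y.

(** [#{0 <= i < n : ||A^i x - A^i y|| < tau} / n] *)
Definition proximity_frequency {V : NormedModule C_AbsRing}
    (A : V -> V) (x y : V) (tau : R) (n : nat) : R :=
  INR (length (filter
    (fun i => if Rlt_dec (norm (minus (Nat.iter i A x) (Nat.iter i A y))) tau
              then true else false) (seq 0 n))) / INR n.

Definition distributionally_chaotic {V : NormedModule C_AbsRing} (A : V -> V) : Prop :=
  exists S : V -> Prop, ~ countable S /\
    forall x y, S x -> S y -> x <> y ->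
      (forall tau, 0 < tau -> LimSup_seq (proximity_frequency A x y tau) = 1) /\
      (exists eps, 0 < eps /\ LimInf_seq (proximity_frequency A x y eps) = 0).

(** The inequality [|a + b|^2 <= (1 + t)|a|^2 + (1 + 1/t)|b|^2] for all [t > 0]
    passes through sums, integrals and suprema, and gives the triangle
    inequality for [sqrt q]. *)

Lemma Cmod_plus_weighted (a b : C) (t : R) : 0 < t ->
  Cmod (a + b) ^ 2 <= (1 + t) * Cmod a ^ 2 + (1 + / t) * Cmod b ^ 2.
Proof.
  intros Ht.
  assert (H := Cmod_triangle a b).
  assert (Ha := Cmod_ge_0 a). assert (Hb := Cmod_ge_0 b).
  assert (Hab := Cmod_ge_0 (a + b)).
  apply Rle_trans with ((Cmod a + Cmod b) ^ 2).
  { apply pow_incr; lra. }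
  assert (Hi : 0 < / t) by now apply Rinv_0_lt_compat.
  assert (E : (1 + t) * Cmod a ^ 2 + (1 + / t) * Cmod b ^ 2 - (Cmod a + Cmod b) ^ 2
     = / t * (t * Cmod a - Cmod b) ^ 2) by (field; lra).
  assert (0 <= / t * (t * Cmod a - Cmod b) ^ 2).
  { apply Rmult_le_pos; [lra | apply pow2_ge_0]. }
  lra.
Qed.

Lemma weighted_triangle (X Y Z : R) : 0 <= X -> 0 <= Y -> 0 <= Z ->
  (forall t, 0 < t -> Z <= (1 + t) * X + (1 + / t) * Y) ->
  sqrt Z <= sqrt X + sqrt Y.
Proof.
  intros HX HY HZ H.
  assert (Hx := sqrt_pos X). assert (Hy := sqrt_pos Y).
  apply Rnot_lt_le; intros Hlt.
  assert (HsX := sqrt_sqrt X HX). assert (HsY := sqrt_sqrt Y HY).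
  assert (HsZ := sqrt_sqrt Z HZ).
  set (x := sqrt X) in *. set (y := sqrt Y) in *. set (z := sqrt Z) in *.
  set (e := (z - (x + y)) / 2).
  assert (He : 0 < e) by (unfold e; lra).
  (* use t = (y + e) / (x + e) *)
  assert (Ht : 0 < (y + e) / (x + e)) by (apply Rdiv_lt_0_compat; lra).
  assert (H1 := H _ Ht).
  rewrite <- HsX, <- HsY, <- HsZ in H1.
  assert (B1 : (1 + (y + e) / (x + e)) * (x * x) <= (x + e + (y + e)) * x).
  { replace ((1 + (y + e) / (x + e)) * (x * x))
      with ((x + e + (y + e)) * x * (x / (x + e))) by (field; lra).
    rewrite <- (Rmult_1_r ((x + e + (y + e)) * x)) at 2.
    apply Rmult_le_compat_l; [apply Rmult_le_pos; lra |].
    apply Rle_div_l; lra. }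
  assert (B2 : (1 + / ((y + e) / (x + e))) * (y * y) <= (x + e + (y + e)) * y).
  { replace ((1 + / ((y + e) / (x + e))) * (y * y))
      with ((x + e + (y + e)) * y * (y / (y + e))) by (field; lra).
    rewrite <- (Rmult_1_r ((x + e + (y + e)) * y)) at 2.
    apply Rmult_le_compat_l; [apply Rmult_le_pos; lra |].
    apply Rle_div_l; lra. }
  assert (z = x + y + 2 * e) by (unfold e; lra).
  nra.
Qed.

Section SqrtNorm.

Variable M : ModuleSpace C_AbsRing.
Variable q : M -> R.
Hypothesis q_pos : forall x, 0 <= q x.
Hypothesis Hq : forall t x y, 0 < t -> q (plus x y) <= (1 + t) * q x + (1 + / t) * q y.
Hypothesis q_scal : forall (l : C) x, q (scal l x) <= Cmod l ^ 2 * q x.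
Hypothesis q_def : forall x, q x = 0 -> x = zero.

Let nrm (x : M) : R := sqrt (q x).
Let nball (x : M) (e : R) (y : M) : Prop := nrm (minus y x) < e.

Lemma sqrt_norm_triangle x y : nrm (plus x y) <= nrm x + nrm y.
Proof. now apply weighted_triangle; auto. Qed.

Lemma sqrt_norm_scal (l : C) x : nrm (scal l x) <= Cmod l * nrm x.
Proof.
  unfold nrm. replace (Cmod l) with (sqrt (Cmod l ^ 2)).
  - rewrite <- sqrt_mult; auto using pow2_ge_0. now apply sqrt_le_1_alt.
  - apply sqrt_pow2, Cmod_ge_0.
Qed.

Lemma sqrt_norm_zero : nrm zero = 0.
Proof.
  apply Rle_antisym; [| apply sqrt_pos].
  rewrite <- (scal_zero_l (K := C_AbsRing) (V := M) zero).
  eapply Rle_trans; [apply (sqrt_norm_scal 0%C) |]. rewrite Cmod_0. lra.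
Qed.

Lemma sqrt_norm_opp x : nrm (opp x) <= nrm x.
Proof.
  rewrite <- scal_opp_one. eapply Rle_trans; [apply (sqrt_norm_scal (- (1))%C) |].
  rewrite Cmod_m1. lra.
Qed.

Lemma sqrt_norm_ball_center x (e : posreal) : nball x e x.
Proof.
  unfold nball. replace (minus x x) with (@zero M); [| symmetry; exact (minus_eq_zero (G := M) x)].
  rewrite sqrt_norm_zero. apply cond_pos.
Qed.

Lemma sqrt_norm_ball_sym x y e : nball x e y -> nball y e x.
Proof.
  unfold nball. intros H. eapply Rle_lt_trans; [| exact H].
  rewrite <- (opp_minus y x). apply sqrt_norm_opp.
Qed.

Lemma sqrt_norm_ball_triangle x y z e1 e2 :
  nball x e1 y -> nball y e2 z -> nball x (e1 + e2) z.
Proof.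
  unfold nball. intros H1 H2. rewrite (minus_trans y z x).
  eapply Rle_lt_trans; [apply sqrt_norm_triangle | lra].
Qed.

Definition sqrt_norm_UniformSpace_mixin : UniformSpace.mixin_of M :=
  UniformSpace.Mixin M zero nball
    sqrt_norm_ball_center sqrt_norm_ball_sym sqrt_norm_ball_triangle.

Definition sqrt_norm_NormedModuleAux : NormedModuleAux C_AbsRing :=
  NormedModuleAux.Pack C_AbsRing M
    (NormedModuleAux.Class C_AbsRing M (ModuleSpace.class _ M)
       sqrt_norm_UniformSpace_mixin) M.

Lemma sqrt_norm_compat1 (x y : sqrt_norm_NormedModuleAux) (e : R) :
  nrm (minus y x) < e -> ball x e y.
Proof. exact (fun H => H). Qed.

Lemma sqrt_norm_compat2 (x y : sqrt_norm_NormedModuleAux) (e : posreal) :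
  ball x e y -> nrm (minus y x) < 1 * e.
Proof. intros H. rewrite Rmult_1_l. exact H. Qed.

Lemma sqrt_norm_eq_zero (x : M) : nrm x = 0 -> x = zero.
Proof. intros H. apply q_def, sqrt_eq_0; auto. Qed.

Definition sqrt_norm_NormedModule_mixin :
    NormedModule.mixin_of C_AbsRing sqrt_norm_NormedModuleAux :=
  NormedModule.Mixin C_AbsRing sqrt_norm_NormedModuleAux nrm 1
    sqrt_norm_triangle sqrt_norm_scal sqrt_norm_compat1 sqrt_norm_compat2
    sqrt_norm_eq_zero.

End SqrtNorm.

(** Sequences are indexed from 0: [x 0] is the first coordinate. *)

Record l2 : Type := mk_l2 {
  l2_seq :> nat -> C;
  l2_summable : ex_series (fun k => Cmod (l2_seq k) ^ 2)
}.

Definition l2_q (x : l2) : R := Series (fun k => Cmod (x k) ^ 2).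

Lemma l2_eq (x y : l2) : (forall k, x k = y k) -> x = y.
Proof.
  destruct x as [x Hx], y as [y Hy]; simpl. intros H.
  assert (x = y) by now apply functional_extensionality. subst y.
  now rewrite (proof_irrelevance _ Hx Hy).
Qed.

Lemma ex_series_weighted (x y : l2) (t : R) :
  ex_series (fun k => (1 + t) * Cmod (x k) ^ 2 + (1 + / t) * Cmod (y k) ^ 2).
Proof.
  apply (ex_series_plus (V := R_NormedModule)).
  - apply (ex_series_scal (V := R_NormedModule)), l2_summable.
  - apply (ex_series_scal (V := R_NormedModule)), l2_summable.
Qed.

Lemma l2_plus_summable (x y : l2) : ex_series (fun k => Cmod (x k + y k) ^ 2).
Proof.
  refine (ex_series_le (V := R_CompleteNormedModule) _ _ _ (ex_series_weighted x y 1)).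
  intros k. change (norm (Cmod (x k + y k) ^ 2)) with (Rabs (Cmod (x k + y k) ^ 2)).
  rewrite Rabs_pos_eq; [| apply pow2_ge_0]. apply Cmod_plus_weighted; lra.
Qed.

Lemma l2_scal_summable (l : C) (x : l2) : ex_series (fun k => Cmod (l * x k) ^ 2).
Proof.
  apply ex_series_ext with (fun k => Cmod l ^ 2 * Cmod (x k) ^ 2).
  - intros k. rewrite Cmod_mult. symmetry. apply Rpow_mult_distr.
  - apply (ex_series_scal (V := R_NormedModule)), l2_summable.
Qed.

Lemma l2_opp_summable (x : l2) : ex_series (fun k => Cmod (- x k) ^ 2).
Proof.
  apply ex_series_ext with (fun k => Cmod (x k) ^ 2); [| apply l2_summable].
  intros k. now rewrite Cmod_opp.
Qed.

Lemma l2_zero_summable : ex_series (fun _ : nat => Cmod 0 ^ 2).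
Proof.
  apply ex_series_ext with (fun _ : nat => 0).
  - intros _. rewrite Cmod_0. change (0 = 0 ^ 2). ring.
  - exists 0. refine (filterlim_ext (fun _ => 0) _ _ (filterlim_const _)).
    intros n. rewrite sum_n_const. change (0 = INR (S n) * 0). ring.
Qed.

Lemma l2_shift_summable (x : l2) : ex_series (fun k => Cmod (x (S k)) ^ 2).
Proof. exact (proj1 (ex_series_incr_1 (V := R_NormedModule) _) (l2_summable x)). Qed.

Definition l2_plus (x y : l2) : l2 := mk_l2 _ (l2_plus_summable x y).
Definition l2_opp (x : l2) : l2 := mk_l2 _ (l2_opp_summable x).
Definition l2_zero : l2 := mk_l2 _ l2_zero_summable.
Definition l2_scal (l : C) (x : l2) : l2 := mk_l2 _ (l2_scal_summable l x).

Ltac l2_ring := intros; apply l2_eq; intros; cbn;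
  repeat (change (@mult C_AbsRing) with Cmult);
  repeat (change (@plus C_AbsRing) with Cplus); ring.

Lemma l2_plus_comm x y : l2_plus x y = l2_plus y x.
Proof. l2_ring. Qed.
Lemma l2_plus_assoc x y z : l2_plus x (l2_plus y z) = l2_plus (l2_plus x y) z.
Proof. l2_ring. Qed.
Lemma l2_plus_zero x : l2_plus x l2_zero = x.
Proof. l2_ring. Qed.
Lemma l2_plus_opp x : l2_plus x (l2_opp x) = l2_zero.
Proof. l2_ring. Qed.
Lemma l2_scal_assoc (a b : C) x : l2_scal a (l2_scal b x) = l2_scal (a * b) x.
Proof. l2_ring. Qed.
Lemma l2_scal_one x : l2_scal 1 x = x.
Proof. l2_ring. Qed.
Lemma l2_scal_distr_l (a : C) x y : l2_scal a (l2_plus x y) = l2_plus (l2_scal a x) (l2_scal a y).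
Proof. l2_ring. Qed.
Lemma l2_scal_distr_r (a b : C) x : l2_scal (a + b) x = l2_plus (l2_scal a x) (l2_scal b x).
Proof. l2_ring. Qed.

Definition l2_AbelianMonoid_mixin :=
  AbelianMonoid.Mixin l2 l2_plus l2_zero l2_plus_comm l2_plus_assoc l2_plus_zero.
Canonical l2_AbelianMonoid := AbelianMonoid.Pack l2 l2_AbelianMonoid_mixin l2.
Definition l2_AbelianGroup_mixin := AbelianGroup.Mixin l2_AbelianMonoid l2_opp l2_plus_opp.
Canonical l2_AbelianGroup :=
  AbelianGroup.Pack l2 (AbelianGroup.Class l2 _ l2_AbelianGroup_mixin) l2.
Definition l2_ModuleSpace_mixin :=
  ModuleSpace.Mixin C_Ring l2_AbelianGroup l2_scal
    l2_scal_assoc l2_scal_one l2_scal_distr_l l2_scal_distr_r.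
Canonical l2_ModuleSpace : ModuleSpace C_AbsRing :=
  ModuleSpace.Pack C_Ring l2 (ModuleSpace.Class C_Ring l2 _ l2_ModuleSpace_mixin) l2.

Lemma sum_n_ge_term (u : nat -> R) (k n : nat) :
  (forall i, 0 <= u i) -> (k <= n)%nat -> u k <= sum_n u n.
Proof.
  intros Hu Hn. induction Hn as [| n Hn IH].
  - destruct k as [| k]; [rewrite sum_O; lra |].
    rewrite sum_Sn. change (u (S k) <= sum_n u k + u (S k)).
    enough (0 <= sum_n u k) by lra.
    induction k as [| k IH]; [now rewrite sum_O |].
    rewrite sum_Sn. change (0 <= sum_n u k + u (S k)). specialize (Hu (S k)). lra.
  - rewrite sum_Sn. change (u k <= sum_n u n + u (S n)). specialize (Hu (S n)). lra.
Qed.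

Lemma Series_ge_term (u : nat -> R) (k : nat) :
  (forall i, 0 <= u i) -> ex_series u -> u k <= Series u.
Proof.
  intros Hu [s Hs]. rewrite (is_series_unique _ _ Hs).
  apply (is_lim_seq_le_loc (fun _ => u k) (sum_n u) (u k) s);
    [| apply is_lim_seq_const | exact Hs].
  exists k. intros n Hn. now apply sum_n_ge_term.
Qed.

Lemma l2_q_pos x : 0 <= l2_q x.
Proof.
  apply Rle_trans with (Cmod (x 0%nat) ^ 2); [apply pow2_ge_0 |].
  apply (Series_ge_term (fun k => Cmod (x k) ^ 2)); [| apply l2_summable].
  intros; apply pow2_ge_0.
Qed.

Lemma l2_q_plus t x y : 0 < t -> l2_q (plus x y) <= (1 + t) * l2_q x + (1 + / t) * l2_q y.
Proof.
  intros Ht. unfold l2_q. rewrite <- !Series_scal_l, <- Series_plus.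
  - apply Series_le; [| apply ex_series_weighted].
    intros n. split; [apply pow2_ge_0 | now apply Cmod_plus_weighted].
  - apply (ex_series_scal (V := R_NormedModule)), l2_summable.
  - apply (ex_series_scal (V := R_NormedModule)), l2_summable.
Qed.

Lemma l2_q_scal (l : C) (x : l2) : l2_q (scal l x) <= Cmod l ^ 2 * l2_q x.
Proof.
  unfold l2_q. rewrite <- Series_scal_l. apply Req_le, Series_ext.
  intros n. simpl. rewrite Cmod_mult. ring.
Qed.

Lemma l2_q_def x : l2_q x = 0 -> x = zero.
Proof.
  intros H. apply l2_eq. intros k. apply Cmod_eq_0.
  assert (Hk : Cmod (x k) ^ 2 <= 0).
  { rewrite <- H. apply (Series_ge_term (fun k => Cmod (x k) ^ 2)); [| apply l2_summable].
    intros; apply pow2_ge_0. }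
  assert (0 <= Cmod (x k)) by apply Cmod_ge_0. nra.
Qed.

Definition l2_UniformSpace_mixin : UniformSpace.mixin_of l2 :=
  sqrt_norm_UniformSpace_mixin l2_ModuleSpace l2_q l2_q_pos l2_q_plus l2_q_scal.
Canonical l2_UniformSpace := UniformSpace.Pack l2 l2_UniformSpace_mixin l2.
Canonical l2_NormedModuleAux : NormedModuleAux C_AbsRing :=
  NormedModuleAux.Pack C_AbsRing l2
    (NormedModuleAux.Class C_AbsRing l2 (ModuleSpace.class _ l2_ModuleSpace)
       l2_UniformSpace_mixin) l2.
Definition l2_NormedModule_mixin : NormedModule.mixin_of C_AbsRing l2_NormedModuleAux :=
  sqrt_norm_NormedModule_mixin l2_ModuleSpace l2_q
    l2_q_pos l2_q_plus l2_q_scal l2_q_def.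
Canonical l2_NormedModule : NormedModule C_AbsRing :=
  NormedModule.Pack C_AbsRing l2
    (NormedModule.Class C_AbsRing l2 (NormedModuleAux.class _ l2_NormedModuleAux)
       l2_NormedModule_mixin) l2.

Lemma l2_normE (x : l2) : norm x = sqrt (l2_q x).
Proof. reflexivity. Qed.

Definition backward_shift (x : l2) : l2 := mk_l2 _ (l2_shift_summable x).

(** Functions are total on [C]; for the predicates below only their values on
    the disk matter. *)

Definition disk (z : C) : Prop := Cmod z < 1.

Definition analytic_on_disk (g : C -> C) : Prop :=
  forall z0, disk z0 -> exists (a : nat -> C) (rho : posreal),
    forall z, Cmod (z - z0) < rho -> is_pseries a (z - z0)%C (g z).

Definition Hinf (phi : C -> C) : Prop :=
  analytic_on_disk phi /\ exists M, forall z, disk z -> Cmod (phi z) <= M.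

Definition Hinf_invertible (phi : C -> C) : Prop :=
  exists psi, Hinf psi /\ forall z, disk z -> (phi z * psi z)%C = 1%C.

(** [y] is [psi(A) x]: the limit in norm as [r -> 1-] of the convergent series
    [sum_k a_k r^k A^k x], where [a] is the Taylor sequence of [psi] at 0. *)
Definition is_Hinf_calc {V : NormedModule C_AbsRing}
    (psi : C -> C) (A : V -> V) (x y : V) : Prop :=
  exists (a : nat -> C) (s : R -> V),
    (forall z, disk z -> is_pseries a z (psi z)) /\
    (forall r, 0 < r < 1 ->
       is_series (fun k => scal (a k * RtoC (r ^ k))%C (Nat.iter k A x)) (s r)) /\
    filterlim s (at_left 1) (locally y).

Definition Hinf_calc {V : NormedModule C_AbsRing}
    (psi : C -> C) (A : V -> V) (x : V) : V :=
  epsilon (inhabits zero) (is_Hinf_calc psi A x).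

Definition circle (r t : R) : C := (r * cos t, r * sin t).

(** Integral mean of [|g|^2] over the circle of radius [r]. *)
Definition H2_mean (g : C -> C) (r : R) : R :=
  RInt (fun t => Cmod (g (circle r t)) ^ 2) (- PI) PI / (2 * PI).

(** The last field makes equality of elements coincide with equality on the
    disk. *)
Record H2 : Type := mk_H2 {
  H2_fun :> C -> C;
  H2_analytic : analytic_on_disk H2_fun;
  H2_bounded : exists M, forall r, 0 <= r < 1 -> H2_mean H2_fun r <= M;
  H2_outside : forall z, ~ disk z -> H2_fun z = 0%C
}.

Definition H2_q (g : H2) : R :=
  real (Lub_Rbar (fun v => exists r, 0 <= r < 1 /\ v = H2_mean g r)).

Lemma analytic_continuous g z : analytic_on_disk g -> disk z -> continuous g z.
Proof.
  intros Hg Hz. destruct (Hg z Hz) as (a & rho & Ha).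
  set (w := RtoC (rho / 2)).
  assert (Hrho := cond_pos rho).
  assert (Hw : Cmod w = rho / 2) by (unfold w; rewrite Cmod_R; apply Rabs_pos_eq; lra).
  assert (Hs : is_pseries a w (g (z + w)%C)).
  { assert (E : (z + w - z)%C = w) by ring.
    rewrite <- E at 1. apply Ha. rewrite E, Hw. lra. }
  destruct (filterlim_bounded _ (ex_intro _ _ Hs)) as [M HM].
  assert (Hpow : forall (u : C) k, Cmod (pow_n (K := C_AbsRing) u k) = Cmod u ^ k).
  { intros u k. induction k as [| k IH]; [exact Cmod_1 |].
    change (Cmod (u * pow_n (K := C_AbsRing) u k) = Cmod u * Cmod u ^ k).
    now rewrite Cmod_mult, IH. }
  assert (HM0 : 0 <= M) by (eapply Rle_trans; [| apply (HM 0%nat)]; apply norm_ge_0).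
  assert (Hterm : forall k, Cmod w ^ k * Cmod (a k) <= 2 * M).
  { intros k. rewrite <- Hpow, <- Cmod_mult.
    change (norm (V := C_NormedModule) (scal (pow_n (K := C_AbsRing) w k) (a k)) <= 2 * M).
    destruct k as [| k].
    - assert (H0 := HM 0%nat). rewrite sum_O in H0.
      eapply Rle_trans; [exact H0 | lra].
    - assert (H1 := HM (S k)). assert (H0 := HM k). rewrite sum_Sn in H1.
      set (S1 := sum_n _ k) in *. set (T := scal _ _) in *.
      assert (ET : forall x y : C, x = ((y + x) - y)%C) by (intros; ring).
      eapply Rle_trans;
        [apply Req_le; exact (f_equal (norm (V := C_NormedModule)) (ET T S1)) |].
      eapply Rle_trans; [apply (norm_triangle (V := C_NormedModule)) |].
      change (Copp S1) with (opp (G := C_NormedModule) S1).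
      rewrite norm_opp.
      replace (2 * M) with (M + M) by ring. apply Rplus_le_compat; assumption. }
  assert (Hbound : forall z', Cmod (z' - z) < rho / 4 ->
            Cmod (g z' - a 0%nat) <= 4 * M * (Cmod (z' - z) / (rho / 2))).
  { intros z' Hz'.
    set (u := Cmod (z' - z) / (rho / 2)).
    assert (Hu0 : 0 <= u) by (apply Rle_div_r; [lra | rewrite Rmult_0_l; apply Cmod_ge_0]).
    assert (Hu1 : u <= / 2) by (apply Rle_div_l; lra).
    assert (Hser : is_pseries a (z' - z)%C (g z')) by (apply Ha; lra).
    assert (Hpart : forall n, Cmod (sum_n (fun k => scal (pow_n (K := C_AbsRing) (z' - z)%C k) (a k)) n
                              - a 0%nat) <= 4 * M * u - 4 * M * u * u ^ n).
    { induction n as [| n IH].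
      - rewrite sum_O. rewrite (scal_one (K := C_AbsRing) (V := C_NormedModule)).
        replace (a 0%nat - a 0%nat)%C with (RtoC 0) by ring. rewrite Cmod_0. simpl. lra.
      - rewrite sum_Sn.
        set (Sn := sum_n _ n) in *.
        change (Cmod (Sn + pow_n (K := C_AbsRing) (z' - z)%C (S n) * a (S n) - a 0%nat)
                  <= 4 * M * u - 4 * M * u * u ^ (S n)).
        replace (Sn + pow_n (K := C_AbsRing) (z' - z)%C (S n) * a (S n) - a 0%nat)%C
          with ((Sn - a 0%nat) + pow_n (K := C_AbsRing) (z' - z)%C (S n) * a (S n))%C
          by ring.
        eapply Rle_trans; [apply Cmod_triangle |].
        rewrite Cmod_mult, Hpow.
        assert (Et : Cmod (z' - z) = u * Cmod w) by (unfold u; rewrite Hw; field; lra).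
        rewrite Et, Rpow_mult_distr, Rmult_assoc.
        assert (Hp : 0 <= u ^ n) by now apply pow_le.
        assert (u ^ S n * (Cmod w ^ S n * Cmod (a (S n))) <= u ^ S n * (2 * M)).
        { apply Rmult_le_compat_l; [now apply pow_le | apply Hterm]. }
        assert (Hup : 0 <= (u * u ^ n * M) * (/ 2 - u)).
        { apply Rmult_le_pos; [| lra]. apply Rmult_le_pos; [| exact HM0].
          now apply Rmult_le_pos. }
        replace (u ^ S n) with (u * u ^ n) in * by reflexivity. lra. }
    apply Rnot_lt_le. intros Hlt.
    set (e := Cmod (g z' - a 0%nat) - 4 * M * u).
    assert (He : 0 < e) by (unfold e; lra).
    assert (Hn := filterlim_norm (K := C_AbsRing) (V := C_NormedModule)
                    (minus (g z') (a 0%nat))).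
    assert (Hlim : filterlim (fun n => Cmod (sum_n (fun k => scal (pow_n (K := C_AbsRing) (z' - z)%C k) (a k)) n - a 0%nat))
              eventually (locally (Cmod (g z' - a 0%nat)))).
    { apply (filterlim_comp _ _ _ (fun n => minus (sum_n (fun k => scal (pow_n (K := C_AbsRing) (z' - z)%C k) (a k)) n) (a 0%nat))
               (norm (K := C_AbsRing) (V := C_NormedModule)) _ (locally (minus (g z') (a 0%nat))));
        [| exact Hn].
      unfold minus. eapply (filterlim_comp_2 _ (fun _ => opp (a 0%nat)));
        [exact Hser | apply filterlim_const |].
      exact (filterlim_plus (K := C_AbsRing) (V := C_NormedModule) (g z') (opp (a 0%nat))). }
    assert (Hle : Rbar_le (Cmod (g z' - a 0%nat)) (4 * M * u)).
    { apply (is_lim_seq_le _ (fun _ => 4 * M * u) (Cmod (g z' - a 0%nat)) (4 * M * u))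
        with (2 := Hlim) (3 := is_lim_seq_const _).
      intros n. eapply Rle_trans; [apply Hpart |].
      assert (0 <= u ^ n) by now apply pow_le.
      assert (0 <= (4 * M) * (u * u ^ n))
        by (apply Rmult_le_pos; [lra | now apply Rmult_le_pos]). lra. }
    simpl in Hle. lra. }
  assert (Hgz : g z = a 0%nat).
  { assert (H := Hbound z). replace (z - z)%C with (RtoC 0) in H by ring.
    rewrite Cmod_0 in H. specialize (H ltac:(lra)).
    unfold Rdiv in H. rewrite Rmult_0_l, Rmult_0_r in H.
    assert (H0 := Cmod_ge_0 (g z - a 0%nat)).
    assert (E : (g z - a 0%nat)%C = 0%C) by (apply Cmod_eq_0; lra).
    replace (g z) with ((g z - a 0%nat) + a 0%nat)%C by ring. rewrite E. ring. }
  apply filterlim_locally. intros eps. rewrite Hgz.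
  apply (locally_le_locally_norm (K := C_AbsRing) (V := C_NormedModule)).
  assert (Hd : 0 < Rmin (rho / 4) (eps * rho / (16 * (M + 1)))).
  { assert (He := cond_pos eps). apply Rmin_pos; [lra |].
    apply Rdiv_lt_0_compat; [now apply Rmult_lt_0_compat | lra]. }
  exists (mkposreal _ Hd). intros z' Hz'.
  change (Cmod (z' - z) < Rmin (rho / 4) (eps * rho / (16 * (M + 1)))) in Hz'.
  apply (norm_compat1 (K := C_AbsRing) (V := C_NormedModule)).
  change (Cmod (g z' - a 0%nat) < eps).
  assert (H1 : Cmod (z' - z) < rho / 4) by (eapply Rlt_le_trans; [exact Hz' | apply Rmin_l]).
  assert (Hr : Cmod (z' - z) < eps * rho / (16 * (M + 1)))
    by (eapply Rlt_le_trans; [exact Hz' | apply Rmin_r]).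
  eapply Rle_lt_trans; [now apply Hbound |].
  apply Rlt_div_r in Hr; [| lra].
  assert (He := cond_pos eps). assert (Hc := Cmod_ge_0 (z' - z)).
  replace (4 * M * (Cmod (z' - z) / (rho / 2)))
    with (8 * M * Cmod (z' - z) / rho) by (field; lra).
  apply Rlt_div_l; [lra |]. nra.
Qed.

Lemma Cmod_circle r t : 0 <= r -> Cmod (circle r t) = r.
Proof.
  intros Hr. unfold Cmod, circle; cbn [fst snd].
  replace ((r * cos t) ^ 2 + (r * sin t) ^ 2) with (r ^ 2 * (Rsqr (sin t) + Rsqr (cos t)))
    by (unfold Rsqr; ring).
  rewrite sin2_cos2, Rmult_1_r. now apply sqrt_pow2.
Qed.

Lemma circle_polar z : exists t, - PI <= t <= PI /\ z = circle (Cmod z) t.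
Proof.
  destruct (Req_dec (Cmod z) 0) as [H0 | H0].
  { exists 0. split; [assert (H := PI_RGT_0); lra |].
    rewrite (Cmod_eq_0 z H0), Cmod_0. unfold circle. rewrite !Rmult_0_l. reflexivity. }
  assert (Hp : 0 < Cmod z) by (assert (H := Cmod_ge_0 z); lra).
  destruct z as [x y]. set (m := Cmod (x, y)) in *.
  assert (Hm : m ^ 2 = x ^ 2 + y ^ 2) by (unfold m; exact (Cmod2_alt (x, y))).
  assert (Hx : Rabs x <= m) by (exact (re_le_Cmod (x, y))).
  assert (Hx' : -1 <= x / m <= 1).
  { apply Rabs_le_between in Hx. split; [apply Rle_div_r | apply Rle_div_l]; lra. }
  assert (Hsin : m * sin (acos (x / m)) = Rabs y).
  { rewrite sin_acos by exact Hx'.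
    rewrite <- (sqrt_pow2 m) at 1 by lra. rewrite <- sqrt_mult_alt by apply pow2_ge_0.
    rewrite <- sqrt_Rsqr_abs. f_equal. unfold Rsqr.
    replace (m ^ 2 * (1 - x / m * (x / m))) with (m ^ 2 - x ^ 2) by (field; lra). lra. }
  assert (Hcos : m * cos (acos (x / m)) = x) by (rewrite cos_acos by exact Hx'; field; lra).
  assert (Hb := acos_bound (x / m)). assert (HPI := PI_RGT_0).
  destruct (Rle_dec 0 y) as [Hy | Hy].
  - exists (acos (x / m)). split; [lra |]. unfold circle.
    now rewrite Hcos, Hsin, Rabs_pos_eq.
  - exists (- acos (x / m)). split; [lra |]. unfold circle.
    rewrite cos_neg, sin_neg, Hcos, <- Ropp_mult_distr_r, Hsin, Rabs_left by lra.
    now rewrite Ropp_involutive.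
Qed.

Lemma H2_integrand_continuous g r t : analytic_on_disk g -> 0 <= r < 1 ->
  continuous (fun t => Cmod (g (circle r t)) ^ 2) t.
Proof.
  intros Hg Hr.
  apply (continuous_comp (fun t => Cmod (g (circle r t))) (fun u => u ^ 2)).
  - apply (continuous_comp (fun t => g (circle r t)) Cmod).
    + apply (continuous_comp (circle r) g).
      * apply (continuous_comp_2 (fun t => r * cos t) (fun t => r * sin t) (fun a b => (a, b))).
        -- apply (ex_derive_continuous (V := R_NormedModule)). auto_derive. easy.
        -- apply (ex_derive_continuous (V := R_NormedModule)). auto_derive. easy.
        -- apply filterlim_locally. intros eps. exists eps. intros [a b] H. exact H.
      * apply analytic_continuous; [exact Hg |].
        unfold disk. rewrite Cmod_circle; lra.
    + exact (filterlim_norm (K := C_AbsRing) (V := C_NormedModule) _).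
  - apply (ex_derive_continuous (V := R_NormedModule)). auto_derive. easy.
Qed.

Lemma H2_integrand_integrable g r : analytic_on_disk g -> 0 <= r < 1 ->
  ex_RInt (fun t => Cmod (g (circle r t)) ^ 2) (- PI) PI.
Proof.
  intros Hg Hr. apply (ex_RInt_continuous (V := R_CompleteNormedModule)).
  intros t _. now apply H2_integrand_continuous.
Qed.

Lemma H2_mean_pos g r : analytic_on_disk g -> 0 <= r < 1 -> 0 <= H2_mean g r.
Proof.
  intros Hg Hr. assert (HPI := PI_RGT_0). unfold H2_mean.
  apply Rle_div_r; [lra |]. rewrite Rmult_0_l.
  apply RInt_ge_0; [lra | now apply H2_integrand_integrable |].
  intros t _. apply pow2_ge_0.
Qed.

Lemma H2_mean_plus f g r t : analytic_on_disk f -> analytic_on_disk g ->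
  analytic_on_disk (fun z => f z + g z)%C -> 0 <= r < 1 -> 0 < t ->
  H2_mean (fun z => f z + g z)%C r <= (1 + t) * H2_mean f r + (1 + / t) * H2_mean g r.
Proof.
  intros Hf Hg Hfg Hr Ht. assert (HPI := PI_RGT_0). unfold H2_mean.
  assert (Ef := H2_integrand_integrable f r Hf Hr).
  assert (Eg := H2_integrand_integrable g r Hg Hr).
  set (F := fun s => Cmod (f (circle r s)) ^ 2) in *.
  set (G := fun s => Cmod (g (circle r s)) ^ 2) in *.
  assert (E : RInt (fun s => (1 + t) * F s + (1 + / t) * G s) (- PI) PI
              = (1 + t) * RInt F (- PI) PI + (1 + / t) * RInt G (- PI) PI).
  { apply is_RInt_unique, (is_RInt_plus (V := R_NormedModule));
      apply (is_RInt_scal (V := R_NormedModule)), (RInt_correct (V := R_CompleteNormedModule));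
      assumption. }
  replace ((1 + t) * (RInt F (- PI) PI / (2 * PI)) + (1 + / t) * (RInt G (- PI) PI / (2 * PI)))
    with (((1 + t) * RInt F (- PI) PI + (1 + / t) * RInt G (- PI) PI) / (2 * PI))
    by (field; lra).
  rewrite <- E. apply Rmult_le_compat_r; [left; apply Rinv_0_lt_compat; lra |].
  apply RInt_le; [lra | now apply (H2_integrand_integrable (fun z => f z + g z)%C) | |].
  - apply (ex_RInt_plus (V := R_NormedModule)); now apply (ex_RInt_scal (V := R_NormedModule)).
  - intros s _. now apply Cmod_plus_weighted.
Qed.

Lemma H2_mean_scal (l : C) g r : analytic_on_disk g -> 0 <= r < 1 ->
  H2_mean (fun z => l * g z)%C r = Cmod l ^ 2 * H2_mean g r.
Proof.
  intros Hg Hr. unfold H2_mean.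
  rewrite (RInt_ext _ (fun s => Cmod l ^ 2 * Cmod (g (circle r s)) ^ 2)).
  - unfold Rdiv. rewrite <- Rmult_assoc. f_equal.
    apply (RInt_scal (V := R_CompleteNormedModule)). now apply H2_integrand_integrable.
  - intros s _. rewrite Cmod_mult. apply Rpow_mult_distr.
Qed.

Lemma RInt_pos_eq_0 (f : R -> R) (a b : R) : a < b ->
  (forall t, continuous f t) -> (forall t, 0 <= f t) -> RInt f a b = 0 ->
  forall t, a <= t <= b -> f t = 0.
Proof.
  intros Hab Hf Hpos H0 t Ht. apply Rle_antisym; [| apply Hpos].
  apply Rnot_lt_le. intros Hlt.
  destruct (proj1 (filterlim_locally f (f t)) (Hf t) (mkposreal _ Hlt)) as [d Hd].
  assert (Hd0 := cond_pos d).
  assert (Hex : forall u v, ex_RInt f u v)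
    by (intros u v; apply (ex_RInt_continuous (V := R_CompleteNormedModule)); auto).
  set (c := Rmax a (t - d / 2)). set (e := Rmin b (t + d / 2)).
  assert (Hc : a <= c /\ t - d / 2 <= c <= t)
    by (unfold c; split; [apply Rmax_l | split; [apply Rmax_r | apply Rmax_lub; lra]]).
  assert (He : e <= b /\ t <= e <= t + d / 2)
    by (unfold e; split; [apply Rmin_l | split; [apply Rmin_glb; lra | apply Rmin_r]]).
  assert (Hce : c < e).
  { unfold c, e. apply Rmax_lub_lt; apply Rmin_glb_lt; lra. }
  assert (Hin : 0 < RInt f c e).
  { apply RInt_gt_0; auto. intros x Hx.
    assert (B : ball t d x)
      by (apply (norm_compat1 (K := R_AbsRing) (V := R_NormedModule));
          change (Rabs (x - t) < d); apply Rabs_def1; lra).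
    specialize (Hd x B). change (Rabs (f x - f t) < f t) in Hd.
    apply Rabs_def2 in Hd. lra. }
  assert (E1 := RInt_Chasles f a c e (Hex _ _) (Hex _ _)).
  assert (E2 := RInt_Chasles f a e b (Hex _ _) (Hex _ _)).
  change (RInt f a c + RInt f c e = RInt f a e) in E1.
  change (RInt f a e + RInt f e b = RInt f a b) in E2.
  assert (0 <= RInt f a c) by (apply RInt_ge_0; auto; lra).
  assert (0 <= RInt f e b) by (apply RInt_ge_0; auto; lra).
  lra.
Qed.

Lemma H2_eq (f g : H2) : (forall z, f z = g z) -> f = g.
Proof.
  destruct f as [f Hf1 Hf2 Hf3], g as [g Hg1 Hg2 Hg3]; simpl. intros H.
  assert (f = g) by now apply functional_extensionality. subst g. f_equal; apply proof_irrelevance.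
Qed.

Lemma H2_mean_le_q (g : H2) r : 0 <= r < 1 -> H2_mean g r <= H2_q g.
Proof.
  intros Hr. unfold H2_q.
  destruct (Lub_Rbar_correct (fun v => exists r, 0 <= r < 1 /\ v = H2_mean g r)) as [Hub Hlub].
  assert (Hr' := Hub (H2_mean g r) (ex_intro _ r (conj Hr eq_refl))).
  destruct (H2_bounded g) as [M HM].
  assert (HM' := Hlub (Finite M)).
  destruct (Lub_Rbar _) as [s | |]; simpl in *; try easy.
  exfalso. apply HM'. intros v (r' & Hr1 & ->). now apply HM.
Qed.

Lemma H2_q_le (g : H2) (M : R) : (forall r, 0 <= r < 1 -> H2_mean g r <= M) -> H2_q g <= M.
Proof.
  intros HM. unfold H2_q.
  destruct (Lub_Rbar_correct (fun v => exists r, 0 <= r < 1 /\ v = H2_mean g r)) as [Hub Hlub].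
  assert (Hr' := Hub (H2_mean g 0) (ex_intro _ 0 (conj (conj (Rle_refl 0) Rlt_0_1) eq_refl))).
  assert (HM' := Hlub (Finite M)).
  assert (HM'' : is_ub_Rbar (fun v => exists r, 0 <= r < 1 /\ v = H2_mean g r) M)
    by (intros v (r' & Hr1 & ->); now apply HM).
  specialize (HM' HM'').
  destruct (Lub_Rbar _) as [s | |]; simpl in *; easy.
Qed.

Lemma analytic_plus f g : analytic_on_disk f -> analytic_on_disk g ->
  analytic_on_disk (fun z => f z + g z)%C.
Proof.
  intros Hf Hg z0 Hz0.
  destruct (Hf z0 Hz0) as (a & r1 & Ha). destruct (Hg z0 Hz0) as (b & r2 & Hb).
  exists (PS_plus a b), (mkposreal _ (Rmin_pos r1 r2 (cond_pos r1) (cond_pos r2))).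
  intros z Hz. simpl in Hz.
  apply (is_pseries_plus (V := C_NormedModule)).
  - apply Ha. eapply Rlt_le_trans; [exact Hz | apply Rmin_l].
  - apply Hb. eapply Rlt_le_trans; [exact Hz | apply Rmin_r].
Qed.

Lemma analytic_scal (l : C) g : analytic_on_disk g -> analytic_on_disk (fun z => l * g z)%C.
Proof.
  intros Hg z0 Hz0. destruct (Hg z0 Hz0) as (a & r & Ha).
  exists (PS_scal l a), r. intros z Hz.
  apply (is_pseries_scal (V := C_NormedModule)); [apply Cmult_comm | now apply Ha].
Qed.

Lemma analytic_zero : analytic_on_disk (fun _ => 0%C).
Proof.
  intros z0 _. exists (fun _ => 0%C), (mkposreal 1 Rlt_0_1). intros z _.
  assert (E : forall n, sum_n (fun k => scal (V := C_NormedModule) (pow_n (K := C_AbsRing) (z - z0)%C k) zero) n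
                        = zero).
  { induction n as [| n IH]; [rewrite sum_O | rewrite sum_Sn, IH, plus_zero_l];
      apply scal_zero_r. }
  refine (filterlim_ext (fun _ => zero) _ (fun n => eq_sym (E n)) (filterlim_const _)).
Qed.

Lemma H2_plus_bounded (f g : H2) :
  exists M, forall r, 0 <= r < 1 -> H2_mean (fun z => f z + g z)%C r <= M.
Proof.
  exists ((1 + 1) * H2_q f + (1 + / 1) * H2_q g). intros r Hr.
  assert (H := H2_mean_plus f g r 1 (H2_analytic f) (H2_analytic g)
    (analytic_plus _ _ (H2_analytic f) (H2_analytic g)) Hr Rlt_0_1).
  assert (Hf := H2_mean_le_q f r Hr). assert (Hg := H2_mean_le_q g r Hr). lra.
Qed.

Lemma H2_scal_bounded (l : C) (g : H2) :
  exists M, forall r, 0 <= r < 1 -> H2_mean (fun z => l * g z)%C r <= M.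
Proof.
  exists (Cmod l ^ 2 * H2_q g). intros r Hr.
  rewrite H2_mean_scal by (apply H2_analytic || exact Hr).
  apply Rmult_le_compat_l; [apply pow2_ge_0 | now apply H2_mean_le_q].
Qed.

Lemma H2_zero_bounded :
  exists M, forall r, 0 <= r < 1 -> H2_mean (fun _ => 0%C) r <= M.
Proof.
  exists 0. intros r Hr. unfold H2_mean.
  rewrite RInt_const, Cmod_0. change (scal ?a ?b) with (a * b).
  unfold Rdiv. simpl. lra.
Qed.

Lemma H2_plus_outside (f g : H2) z : ~ disk z -> (f z + g z)%C = 0%C.
Proof. intros Hz. rewrite !H2_outside by exact Hz. ring. Qed.

Lemma H2_scal_outside (l : C) (g : H2) z : ~ disk z -> (l * g z)%C = 0%C.
Proof. intros Hz. rewrite H2_outside by exact Hz. ring. Qed.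

Definition H2_plus (f g : H2) : H2 :=
  mk_H2 _ (analytic_plus _ _ (H2_analytic f) (H2_analytic g))
    (H2_plus_bounded f g) (H2_plus_outside f g).
Definition H2_scal (l : C) (g : H2) : H2 :=
  mk_H2 _ (analytic_scal l _ (H2_analytic g)) (H2_scal_bounded l g) (H2_scal_outside l g).
Definition H2_opp (g : H2) : H2 := H2_scal (- (1))%C g.
Definition H2_zero : H2 :=
  mk_H2 _ analytic_zero H2_zero_bounded (fun _ _ => eq_refl).

Ltac H2_ring := intros; apply H2_eq; intros; cbn;
  repeat (change (@mult C_AbsRing) with Cmult);
  repeat (change (@plus C_AbsRing) with Cplus); ring.

Lemma H2_plus_comm f g : H2_plus f g = H2_plus g f.
Proof. H2_ring. Qed.
Lemma H2_plus_assoc f g h : H2_plus f (H2_plus g h) = H2_plus (H2_plus f g) h.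
Proof. H2_ring. Qed.
Lemma H2_plus_zero f : H2_plus f H2_zero = f.
Proof. H2_ring. Qed.
Lemma H2_plus_opp f : H2_plus f (H2_opp f) = H2_zero.
Proof. H2_ring. Qed.
Lemma H2_scal_assoc (a b : C) f : H2_scal a (H2_scal b f) = H2_scal (a * b) f.
Proof. H2_ring. Qed.
Lemma H2_scal_one f : H2_scal 1 f = f.
Proof. H2_ring. Qed.
Lemma H2_scal_distr_l (a : C) f g : H2_scal a (H2_plus f g) = H2_plus (H2_scal a f) (H2_scal a g).
Proof. H2_ring. Qed.
Lemma H2_scal_distr_r (a b : C) f : H2_scal (a + b) f = H2_plus (H2_scal a f) (H2_scal b f).
Proof. H2_ring. Qed.

Definition H2_AbelianMonoid_mixin :=
  AbelianMonoid.Mixin H2 H2_plus H2_zero H2_plus_comm H2_plus_assoc H2_plus_zero.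
Canonical H2_AbelianMonoid := AbelianMonoid.Pack H2 H2_AbelianMonoid_mixin H2.
Definition H2_AbelianGroup_mixin := AbelianGroup.Mixin H2_AbelianMonoid H2_opp H2_plus_opp.
Canonical H2_AbelianGroup :=
  AbelianGroup.Pack H2 (AbelianGroup.Class H2 _ H2_AbelianGroup_mixin) H2.
Definition H2_ModuleSpace_mixin :=
  ModuleSpace.Mixin C_Ring H2_AbelianGroup H2_scal
    H2_scal_assoc H2_scal_one H2_scal_distr_l H2_scal_distr_r.
Canonical H2_ModuleSpace : ModuleSpace C_AbsRing :=
  ModuleSpace.Pack C_Ring H2 (ModuleSpace.Class C_Ring H2 _ H2_ModuleSpace_mixin) H2.

Lemma H2_q_pos (g : H2) : 0 <= H2_q g.
Proof.
  apply Rle_trans with (H2_mean g 0); [| apply H2_mean_le_q; lra].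
  apply H2_mean_pos; [apply H2_analytic | lra].
Qed.

Lemma H2_q_plus t (f g : H2) : 0 < t ->
  H2_q (plus f g) <= (1 + t) * H2_q f + (1 + / t) * H2_q g.
Proof.
  intros Ht. apply H2_q_le. intros r Hr.
  eapply Rle_trans.
  { apply (H2_mean_plus f g r t); auto using H2_analytic.
    apply analytic_plus; apply H2_analytic. }
  assert (Hi := Rinv_0_lt_compat t Ht).
  apply Rplus_le_compat; (apply Rmult_le_compat_l; [lra | now apply H2_mean_le_q]).
Qed.

Lemma H2_q_scal (l : C) (g : H2) : H2_q (scal l g) <= Cmod l ^ 2 * H2_q g.
Proof.
  apply H2_q_le. intros r Hr.
  change (H2_mean (fun z => l * g z)%C r <= Cmod l ^ 2 * H2_q g).
  rewrite H2_mean_scal by (apply H2_analytic || exact Hr).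
  apply Rmult_le_compat_l; [apply pow2_ge_0 | now apply H2_mean_le_q].
Qed.

Lemma H2_q_def (g : H2) : H2_q g = 0 -> g = zero.
Proof.
  intros H. apply H2_eq. intros z. change (g z = 0%C).
  destruct (classic (disk z)) as [Hz | Hz]; [| now apply H2_outside].
  assert (Hr : 0 <= Cmod z < 1) by (split; [apply Cmod_ge_0 | exact Hz]).
  destruct (circle_polar z) as (t & Ht & E).
  assert (HPI := PI_RGT_0).
  assert (H0 : H2_mean g (Cmod z) = 0).
  { apply Rle_antisym; [rewrite <- H; now apply H2_mean_le_q |].
    now apply H2_mean_pos; [apply H2_analytic |]. }
  assert (H1 : RInt (fun t => Cmod (g (circle (Cmod z) t)) ^ 2) (- PI) PI = 0).
  { unfold H2_mean in H0. apply Rmult_integral in H0. destruct H0 as [H0 | H0]; [exact H0 |].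
    assert (0 < / (2 * PI)) by (apply Rinv_0_lt_compat; lra). lra. }
  assert (H3 := RInt_pos_eq_0 _ (- PI) PI ltac:(lra)
     (fun s => H2_integrand_continuous g (Cmod z) s (H2_analytic g) Hr)
     (fun s => pow2_ge_0 _) H1 t Ht).
  cbv beta in H3. rewrite <- E in H3.
  apply Cmod_eq_0. assert (0 <= Cmod (g z)) by apply Cmod_ge_0. nra.
Qed.

Definition H2_UniformSpace_mixin : UniformSpace.mixin_of H2 :=
  sqrt_norm_UniformSpace_mixin H2_ModuleSpace H2_q H2_q_pos H2_q_plus H2_q_scal.
Canonical H2_UniformSpace := UniformSpace.Pack H2 H2_UniformSpace_mixin H2.
Canonical H2_NormedModuleAux : NormedModuleAux C_AbsRing :=
  NormedModuleAux.Pack C_AbsRing H2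
    (NormedModuleAux.Class C_AbsRing H2 (ModuleSpace.class _ H2_ModuleSpace)
       H2_UniformSpace_mixin) H2.
Definition H2_NormedModule_mixin : NormedModule.mixin_of C_AbsRing H2_NormedModuleAux :=
  sqrt_norm_NormedModule_mixin H2_ModuleSpace H2_q
    H2_q_pos H2_q_plus H2_q_scal H2_q_def.
Canonical H2_NormedModule : NormedModule C_AbsRing :=
  NormedModule.Pack C_AbsRing H2
    (NormedModule.Class C_AbsRing H2 (NormedModuleAux.class _ H2_NormedModuleAux)
       H2_NormedModule_mixin) H2.

Lemma H2_normE (x : H2) : norm x = sqrt (H2_q x).
Proof. reflexivity. Qed.

(** [M] is the multiplication operator [M_phi], determined by its values on
    the disk, and [Mstar] its adjoint. *)
Definition Cowen_Douglas_function (phi : C -> C) : Prop :=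
  exists M Mstar : H2 -> H2,
    (forall g z, disk z -> M g z = (phi z * g z)%C) /\
    is_adjoint M Mstar /\
    exists n, (0 < n)%nat /\
      Cowen_Douglas_class n (fun w => exists z, disk z /\ w = Cconj (phi z)) Mstar.

(* Main.v *)
Require Import Defs.
From Stdlib Require Import Reals Lra Lia ZArith List Cantor ClassicalEpsilon
  FunctionalExtensionality PropExtensionality.
From Coquelicot Require Import Coquelicot.
Open Scope R_scope.

(** The operator [phi(T)] has the vectors [(1, l, l^2, ...)], [l] in the disk, as
    eigenvectors, with eigenvalues [phi l]. All five properties are therefore
    decided by how the values of [phi] lie with respect to the unit circle, and
    inversion of [phi] does not change whether they meet it.

    Suppose that some value has modulus 1. The set of values is open, up to
    conjugation (this is part of the Cowen-Douglas condition), so there are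
    points where [phi] has modulus below 1, points where it has modulus above 1,
    and infinitely many points in one compact subdisk where it is a root of
    unity. Each of these three sets of points has a total family of eigenvectors
    ([eigvecs_total]): by a Blaschke product argument, infinitely many distinct
    points in a compact subdisk suffice. Vectors in the first span have orbits
    tending to 0, vectors in the second are images under the n-th power of
    vectors tending to 0, and vectors in the third are periodic. This gives
    mixing and dense periodic points directly, and, through Baire's theorem, a
    vector with dense orbit ([chaos_hypercyclic]) and a vector whose orbit is
    close to 0, and far from 0, on sets of times of upper density 1
    ([irregular_vector]). The latter yields Li-Yorke chaos, and the real line
    that it spans is a distributionally scrambled set. The three conditions on
    [phi] are stable under [phi -> 1 / phi], so both operators have all five
    properties ([fully_chaotic_of_eigvecs]).

    Otherwise the set of values, being connected, lies on one side of the circle,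
    so [phi] or [1 / phi] is bounded by 1. One of the two operators is then a
    contraction and the other, its inverse ([calc_inverse]), does not decrease
    norms; monotone orbit norms exclude all five properties
    ([not_chaotic_of_monotone]).

    The analytic input is that the functional calculus exists and satisfies
    [|phi(T)| <= sup |phi|]. A bounded analytic function has a Taylor series on
    the whole disk ([taylor_disk]), by Cauchy's formula, which is obtained by
    differentiating a circle average under the integral sign. Its coefficients
    are Fourier coefficients on each circle, and Bessel's inequality applied to
    the product of the function with a trigonometric polynomial gives the norm
    bound for the finite triangular Toeplitz matrices ([toeplitz_bound]). With
    the bound, the limit [r -> 1-] that defines [phi(T) x] exists for every [x]
    because it exists on the total family of eigenvectors, where it is explicit
    ([damped_lim_exists]). *)

(** * Fourier coefficients on a circle *)

Definition ravg (f : R -> R) : R := RInt f (- PI) PI / (2 * PI).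

(** The real and imaginary parts are averaged separately, so that only real integrals
    occur. *)
Definition Cavg (h : R -> C) : C :=
  (ravg (fun t => fst (h t)), ravg (fun t => snd (h t))).

Definition cis (t : R) : C := (cos t, sin t).

Definition mode (k : Z) (t : R) : C := cis (IZR k * t).

Lemma ex_RInt_cont (f : R -> R) a b : (forall t, continuous f t) -> ex_RInt f a b.
Proof. intros H. apply (ex_RInt_continuous (V := R_CompleteNormedModule)). auto. Qed.

Lemma ravg_ext f g : (forall t, f t = g t) -> ravg f = ravg g.
Proof. intros H. unfold ravg. f_equal. apply RInt_ext. intros; apply H. Qed.

Lemma ravg_plus f g : (forall t, continuous f t) -> (forall t, continuous g t) ->
  ravg (fun t => f t + g t) = ravg f + ravg g.
Proof.
  intros Hf Hg. unfold ravg. rewrite <- Rdiv_plus_distr. f_equal.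
  apply (RInt_plus (V := R_CompleteNormedModule)); now apply ex_RInt_cont.
Qed.

Lemma ravg_scal l f : (forall t, continuous f t) -> ravg (fun t => l * f t) = l * ravg f.
Proof.
  intros Hf. unfold ravg, Rdiv. rewrite <- Rmult_assoc. f_equal.
  apply (RInt_scal (V := R_CompleteNormedModule)); now apply ex_RInt_cont.
Qed.

Lemma ravg_const c : ravg (fun _ => c) = c.
Proof.
  unfold ravg. rewrite RInt_const. change (scal ?a ?b) with (a * b).
  assert (H := PI_RGT_0). field. lra.
Qed.

Lemma ravg_le f g : (forall t, continuous f t) -> (forall t, continuous g t) ->
  (forall t, f t <= g t) -> ravg f <= ravg g.
Proof.
  intros Hf Hg H. unfold ravg. assert (HP := PI_RGT_0).
  apply Rmult_le_compat_r; [left; apply Rinv_0_lt_compat; lra |].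
  apply RInt_le; auto using ex_RInt_cont. lra.
Qed.

Notation Cp := (pow_n (K := C_AbsRing)).

Ltac min_bounds a b :=
  let m1 := fresh "m1" in let m2 := fresh "m2" in
  assert (m1 := Rmin_l a b); assert (m2 := Rmin_r a b).

Ltac smooth := apply (ex_derive_continuous (V := R_NormedModule)); simpl; auto_derive; easy.

Definition Ccont_at {U : UniformSpace} (h : U -> C) (u : U) : Prop :=
  continuous (fun t => fst (h t)) u /\ continuous (fun t => snd (h t)) u.

Section ContinuousAt.
Context {U : UniformSpace}.
Implicit Types (f g : U -> C) (u : U).

Lemma Ccont_at_ext f g u : (forall t, f t = g t) -> Ccont_at f u -> Ccont_at g u.
Proof.
  intros E [H1 H2]. split.
  - apply continuous_ext with (2 := H1). intros; now rewrite E.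
  - apply continuous_ext with (2 := H2). intros; now rewrite E.
Qed.

Lemma Ccont_at_const (c : C) u : Ccont_at (fun _ => c) u.
Proof. split; apply continuous_const. Qed.

Lemma Ccont_at_plus f g u : Ccont_at f u -> Ccont_at g u -> Ccont_at (fun t => f t + g t)%C u.
Proof.
  intros [] []. split; now apply (continuous_plus (V := R_NormedModule)).
Qed.

Lemma Ccont_at_mult f g u : Ccont_at f u -> Ccont_at g u -> Ccont_at (fun t => f t * g t)%C u.
Proof.
  intros [] []. split; simpl.
  - apply (continuous_minus (V := R_NormedModule)); now apply (continuous_mult (K := R_AbsRing)).
  - apply (continuous_plus (V := R_NormedModule)); now apply (continuous_mult (K := R_AbsRing)).
Qed.

Lemma Ccont_at_continuous (p : U -> C) u : Ccont_at p u -> continuous p u.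
Proof.
  intros [H1 H2].
  apply (continuous_ext (fun t => (fst (p t), snd (p t)))).
  - intros s; now destruct (p s).
  - apply (continuous_comp_2 (fun t => fst (p t)) (fun t => snd (p t)) (fun a b => (a, b))); auto.
    apply filterlim_locally. intros eps. exists eps. intros [a b] H. exact H.
Qed.

Lemma Ccont_at_comp (g : C -> C) (p : U -> C) u : Ccont_at p u -> continuous g (p u) ->
  Ccont_at (fun t => g (p t)) u.
Proof.
  intros Hp Hg. assert (Hpt := Ccont_at_continuous p u Hp).
  assert (H := continuous_comp p g u Hpt Hg).
  split.
  - apply (continuous_comp (fun t => g (p t)) fst); [exact H | apply continuous_fst].
  - apply (continuous_comp (fun t => g (p t)) snd); [exact H | apply continuous_snd].
Qed.

Lemma Ccont_at_inv f u : f u <> 0%C -> Ccont_at f u -> Ccont_at (fun t => / f t)%C u.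
Proof.
  intros H0 [H1 H2].
  assert (Hn : continuous (fun t => fst (f t) ^ 2 + snd (f t) ^ 2) u).
  { apply (continuous_ext (fun t => fst (f t) * fst (f t) + snd (f t) * snd (f t)));
      [intros; simpl; ring |].
    apply (continuous_plus (V := R_NormedModule)); now apply (continuous_mult (K := R_AbsRing)). }
  assert (Hi : continuous (fun t => / (fst (f t) ^ 2 + snd (f t) ^ 2)) u).
  { apply (continuous_comp (fun t => fst (f t) ^ 2 + snd (f t) ^ 2) Rinv); [exact Hn |].
    apply continuous_Rinv.
    intros E. apply H0, Cmod_eq_0.
    assert (E' := Cmod2_alt (f u)). unfold Re, Im in E'. rewrite E in E'.
    assert (H := Cmod_ge_0 (f u)). nra. }
  split; simpl; unfold Rdiv; apply (continuous_mult (K := R_AbsRing)); auto.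
  now apply (continuous_opp (V := R_NormedModule)).
Qed.

End ContinuousAt.

Definition Ccont (h : R -> C) : Prop := forall t : R, Ccont_at h t.

Lemma Ccont_ext f g : (forall t, f t = g t) -> Ccont f -> Ccont g.
Proof. intros E H t. now apply Ccont_at_ext with f. Qed.

Lemma Ccont_const c : Ccont (fun _ => c).
Proof. intros t. apply Ccont_at_const. Qed.

Lemma Ccont_plus f g : Ccont f -> Ccont g -> Ccont (fun t => f t + g t)%C.
Proof. intros Hf Hg t. now apply Ccont_at_plus. Qed.

Lemma Ccont_mult f g : Ccont f -> Ccont g -> Ccont (fun t => f t * g t)%C.
Proof. intros Hf Hg t. now apply Ccont_at_mult. Qed.

Lemma Ccont_sum (f : nat -> R -> C) n : (forall i, Ccont (f i)) ->
  Ccont (fun t => sum_n (fun i => f i t) n).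
Proof.
  intros H. induction n as [| n IH].
  - apply Ccont_ext with (f 0%nat); [| apply H]. intros; now rewrite sum_O.
  - apply Ccont_ext with (fun t => sum_n (fun i => f i t) n + f (S n) t)%C.
    + intros; now rewrite sum_Sn.
    + now apply Ccont_plus.
Qed.

Lemma Ccont_cis k : Ccont (fun t => cis (k * t)).
Proof.
  intros t; split; smooth.
Qed.

Lemma Ccont_mode k : Ccont (mode k).
Proof. apply Ccont_cis. Qed.

Lemma Ccont_Cmod2 f : Ccont f -> forall t, continuous (fun t => Cmod (f t) ^ 2) t.
Proof.
  intros Hf t. destruct (Hf t) as [H1 H2].
  apply (continuous_ext (fun t => fst (f t) * fst (f t) + snd (f t) * snd (f t))).
  - intros s. rewrite Cmod2_alt. unfold Re, Im; simpl; ring.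
  - apply (continuous_plus (V := R_NormedModule)); now apply (continuous_mult (K := R_AbsRing)).
Qed.

Lemma Cavg_ext f g : (forall t, f t = g t) -> Cavg f = Cavg g.
Proof. intros H. unfold Cavg. f_equal; apply ravg_ext; intros; now rewrite H. Qed.

Lemma Cavg_plus f g : Ccont f -> Ccont g ->
  Cavg (fun t => f t + g t)%C = (Cavg f + Cavg g)%C.
Proof.
  intros Hf Hg. unfold Cavg, Cplus. simpl. f_equal; apply ravg_plus; intros t.
  - exact (proj1 (Hf t)).
  - exact (proj1 (Hg t)).
  - exact (proj2 (Hf t)).
  - exact (proj2 (Hg t)).
Qed.

Lemma Cavg_scal c f : Ccont f -> Cavg (fun t => c * f t)%C = (c * Cavg f)%C.
Proof.
  intros Hf. unfold Cavg, Cmult. simpl.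
  assert (H1 : forall t, continuous (fun t => fst (f t)) t) by (intros t; exact (proj1 (Hf t))).
  assert (H2 : forall t, continuous (fun t => snd (f t)) t) by (intros t; exact (proj2 (Hf t))).
  assert (Hc : forall (k : R) (u : R -> R), (forall t, continuous u t) ->
            forall t, continuous (fun t => k * u t) t)
    by (intros; now apply (continuous_scal_r (V := R_NormedModule))).
  f_equal.
  - rewrite (ravg_ext _ (fun t => fst c * fst (f t) + (- snd c) * snd (f t))) by (intros; ring).
    rewrite ravg_plus, !ravg_scal by auto. ring.
  - rewrite ravg_plus, !ravg_scal by auto. ring.
Qed.

Lemma Cavg_const c : Cavg (fun _ => c) = c.
Proof. unfold Cavg. rewrite !ravg_const. now destruct c. Qed.

Lemma Cavg_sum (f : nat -> R -> C) n : (forall i, Ccont (f i)) ->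
  Cavg (fun t => sum_n (fun i => f i t) n) = sum_n (fun i => Cavg (f i)) n.
Proof.
  intros H. induction n as [| n IH].
  - rewrite sum_O. apply Cavg_ext. intros; now rewrite sum_O.
  - rewrite sum_Sn, <- IH.
    rewrite (Cavg_ext _ (fun t => sum_n (fun i => f i t) n + f (S n) t)%C)
      by (intros; now rewrite sum_Sn).
    apply Cavg_plus; auto using Ccont_sum.
Qed.

(** Rotating the average onto the positive axis reduces the estimate to one for real
    parts. *)
Lemma Cavg_bound f B : Ccont f -> (forall t, Cmod (f t) <= B) -> Cmod (Cavg f) <= B.
Proof.
  intros Hf HB.
  assert (HB0 : 0 <= B) by (eapply Rle_trans; [apply Cmod_ge_0 | apply (HB 0)]).
  assert (E : Cmod (Cavg f) ^ 2 = fst (Cavg (fun t => Cconj (Cavg f) * f t)%C)).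
  { rewrite Cavg_scal by exact Hf. rewrite Cmod2_alt. unfold Re, Im; simpl. ring. }
  set (w := Cavg f) in *.
  assert (H : Cmod w ^ 2 <= Cmod w * B).
  { rewrite E. unfold Cavg at 1. cbn [fst].
    rewrite <- (ravg_const (Cmod w * B)). apply ravg_le.
    - intros t. exact (proj1 (Ccont_mult (fun _ => Cconj w) f (Ccont_const _) Hf t)).
    - intros; apply continuous_const.
    - intros t. eapply Rle_trans; [apply Rle_abs |].
      eapply Rle_trans; [apply (re_le_Cmod (Cconj w * f t)%C) |].
      rewrite Cmod_mult, Cmod_conj. apply Rmult_le_compat_l; [apply Cmod_ge_0 | apply HB]. }
  assert (H0 := Cmod_ge_0 w). nra.
Qed.

Lemma cis_plus a b : cis (a + b) = (cis a * cis b)%C.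
Proof. unfold cis, Cmult; simpl. rewrite cos_plus, sin_plus. f_equal; ring. Qed.

Lemma cis_0 : cis 0 = 1%C.
Proof. unfold cis. rewrite cos_0, sin_0. reflexivity. Qed.

Lemma Cmod_cis t : Cmod (cis t) = 1.
Proof.
  unfold cis, Cmod; simpl. replace (_ + _) with (Rsqr (sin t) + Rsqr (cos t)) by (unfold Rsqr; ring).
  rewrite sin2_cos2. apply sqrt_1.
Qed.

Lemma cis_circle r t : circle r t = (RtoC r * cis t)%C.
Proof. unfold circle, cis, Cmult; simpl. f_equal; ring. Qed.

Lemma mode_plus j k t : mode (j + k) t = (mode j t * mode k t)%C.
Proof. unfold mode. rewrite plus_IZR, Rmult_plus_distr_r. apply cis_plus. Qed.

Lemma mode_0 t : mode 0 t = 1%C.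
Proof. unfold mode. rewrite Rmult_0_l. apply cis_0. Qed.

Lemma Cmod_mode k t : Cmod (mode k t) = 1.
Proof. apply Cmod_cis. Qed.

Lemma Cavg_mode k : k <> 0%Z -> Cavg (mode k) = 0%C.
Proof.
  intros Hk. assert (Hk' : IZR k <> 0) by (now apply eq_IZR_contrapositive).
  assert (Es : sin (IZR k * PI) = 0) by (apply sin_eq_0_1; now exists k).
  unfold Cavg, ravg.
  assert (E1 : RInt (fun t => fst (mode k t)) (- PI) PI = 0).
  { apply is_RInt_unique.
    replace 0 with (minus (sin (IZR k * PI) / IZR k) (sin (IZR k * - PI) / IZR k)).
    - apply (is_RInt_derive (V := R_CompleteNormedModule) (fun t => sin (IZR k * t) / IZR k)).
      + intros t _. unfold mode, cis; simpl. auto_derive; [easy | field; auto].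
      + intros t _. exact (proj1 (Ccont_mode k t)).
    - replace (IZR k * - PI) with (- (IZR k * PI)) by ring. rewrite sin_neg, Es.
      unfold minus, plus, opp; simpl. field; auto. }
  assert (E2 : RInt (fun t => snd (mode k t)) (- PI) PI = 0).
  { apply is_RInt_unique.
    replace 0 with (minus (- cos (IZR k * PI) / IZR k) (- cos (IZR k * - PI) / IZR k)).
    - apply (is_RInt_derive (V := R_CompleteNormedModule) (fun t => - cos (IZR k * t) / IZR k)).
      + intros t _. unfold mode, cis; simpl. auto_derive; [easy | field; auto].
      + intros t _. exact (proj2 (Ccont_mode k t)).
    - replace (IZR k * - PI) with (- (IZR k * PI)) by ring. rewrite cos_neg.
      unfold minus, plus, opp; simpl. field; auto. }
  rewrite E1, E2. unfold Rdiv. now rewrite Rmult_0_l.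
Qed.

Definition fourier (Q : R -> C) (k : Z) : C := Cavg (fun t => Q t * mode (- k) t)%C.

Lemma Ccont_mult_mode Q k : Ccont Q -> Ccont (fun t => Q t * mode (- k) t)%C.
Proof. intros H. apply Ccont_mult; auto using Ccont_mode. Qed.

Lemma fourier_mode j k : fourier (mode j) k = if Z.eq_dec j k then 1%C else 0%C.
Proof.
  unfold fourier. rewrite (Cavg_ext _ (mode (j + - k))) by (intros; now rewrite mode_plus).
  destruct (Z.eq_dec j k) as [-> | H].
  - rewrite (Cavg_ext _ (fun _ => 1%C)); [apply Cavg_const |].
    intros. replace (k + - k)%Z with 0%Z by ring. apply mode_0.
  - apply Cavg_mode. lia.
Qed.

Lemma fourier_plus f g k : Ccont f -> Ccont g ->
  fourier (fun t => f t + g t)%C k = (fourier f k + fourier g k)%C.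
Proof.
  intros Hf Hg. unfold fourier. rewrite <- Cavg_plus by now apply Ccont_mult_mode.
  apply Cavg_ext. intros; ring.
Qed.

Lemma fourier_scal c f k : Ccont f -> fourier (fun t => c * f t)%C k = (c * fourier f k)%C.
Proof.
  intros Hf. unfold fourier. rewrite <- Cavg_scal by now apply Ccont_mult_mode.
  apply Cavg_ext. intros; ring.
Qed.

Lemma fourier_ext f g k : (forall t, f t = g t) -> fourier f k = fourier g k.
Proof. intros H. apply Cavg_ext. intros; now rewrite H. Qed.

Lemma fourier_bound f B k : Ccont f -> (forall t, Cmod (f t) <= B) -> Cmod (fourier f k) <= B.
Proof.
  intros Hf HB. apply Cavg_bound; [now apply Ccont_mult_mode |].
  intros t. rewrite Cmod_mult, Cmod_mode, Rmult_1_r. apply HB.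
Qed.

(** Expansion of the square; the cross term is a Fourier coefficient. It is the common
    step of Bessel's inequality and Parseval's identity. *)
Lemma energy_add_mode Q c (k : Z) : Ccont Q ->
  ravg (fun t => Cmod (Q t + c * mode k t)%C ^ 2)
  = ravg (fun t => Cmod (Q t) ^ 2) + Cmod c ^ 2 + 2 * fst (Cconj c * fourier Q k)%C.
Proof.
  intros HQ. unfold fourier. rewrite <- Cavg_scal by now apply Ccont_mult_mode.
  unfold Cavg; cbn [fst].
  assert (Hc : forall t, continuous (fun t => fst (Cconj c * (Q t * mode (- k) t))%C) t).
  { intros t. refine (proj1 (Ccont_mult _ _ _ _ t)); [apply Ccont_const | now apply Ccont_mult_mode]. }
  rewrite <- (ravg_const (Cmod c ^ 2)), <- ravg_scal by exact Hc.
  assert (H2 : forall t, continuous (fun t => 2 * fst (Cconj c * (Q t * mode (- k) t))%C) t)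
    by (intros; now apply (continuous_scal_r (V := R_NormedModule))).
  rewrite <- ravg_plus by (auto using Ccont_Cmod2, continuous_const).
  rewrite <- ravg_plus; [| intros; apply (continuous_plus (V := R_NormedModule));
     auto using continuous_const; now apply Ccont_Cmod2 | exact H2].
  apply ravg_ext. intros t. rewrite !Cmod2_alt. unfold mode, cis, Re, Im; simpl.
  rewrite opp_IZR. replace (- IZR k * t) with (- (IZR k * t)) by ring. rewrite cos_neg, sin_neg.
  assert (H := sin2_cos2 (IZR k * t)). unfold Rsqr in H.
  set (C1 := cos (IZR k * t)) in *. set (S1 := sin (IZR k * t)) in *.
  destruct c as [c d], (Q t) as [x y]; simpl.
  replace (c * (c * 1) + d * (d * 1)) with ((c * c + d * d) * (S1 * S1 + C1 * C1)) by (rewrite H; ring).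
  ring.
Qed.

Lemma bessel Q n : Ccont Q ->
  sum_n (fun m => Cmod (fourier Q (Z.of_nat m)) ^ 2) n <= ravg (fun t => Cmod (Q t) ^ 2).
Proof.
  intros HQ.
  (* [P n] removes the first modes from [Q]; each removal lowers the energy by one square. *)
  set (c := fun m => fourier Q (Z.of_nat m)).
  set (P := fun n t => (sum_n (fun m => - c m * mode (Z.of_nat m) t) n)%C).
  assert (HPc : forall n, Ccont (P n)).
  { intros m. apply Ccont_sum. intros i. apply Ccont_mult; auto using Ccont_const, Ccont_mode. }
  assert (Horth : forall n l, (n < l)%nat -> fourier (P n) (Z.of_nat l) = 0%C).
  { clear n. intros n l Hl. induction n as [| n IH].
    - rewrite (fourier_ext _ (fun t => - c 0%nat * mode (Z.of_nat 0) t)%C)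
        by (intros; unfold P; now rewrite sum_O).
      rewrite fourier_scal, fourier_mode by apply Ccont_mode.
      destruct (Z.eq_dec _ _); [lia | ring].
    - rewrite (fourier_ext _ (fun t => P n t + - c (S n) * mode (Z.of_nat (S n)) t)%C)
        by (intros; unfold P; now rewrite sum_Sn).
      rewrite fourier_plus, IH, fourier_scal, fourier_mode by
        (auto using Ccont_mode; try lia; apply Ccont_mult; auto using Ccont_const, Ccont_mode).
      destruct (Z.eq_dec _ _); [lia | ring]. }
  assert (Step : forall R0 m, Ccont R0 -> fourier R0 (Z.of_nat m) = c m ->
     ravg (fun t => Cmod (R0 t + - c m * mode (Z.of_nat m) t)%C ^ 2)
     = ravg (fun t => Cmod (R0 t) ^ 2) - Cmod (c m) ^ 2).
  { intros R0 m HR E. rewrite energy_add_mode, E by exact HR. rewrite Cmod_opp.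
    rewrite (Cmod2_alt (c m)). unfold Re, Im; simpl. ring. }
  assert (Main : forall n, ravg (fun t => Cmod (Q t + P n t)%C ^ 2)
     = ravg (fun t => Cmod (Q t) ^ 2) - sum_n (fun m => Cmod (c m) ^ 2) n).
  { clear n. intros n. induction n as [| n IH].
    - rewrite sum_O, <- Step by (auto). apply ravg_ext. intros. unfold P. now rewrite sum_O.
    - rewrite sum_Sn. change (plus ?a ?b) with (a + b).
      replace (ravg (fun t => Cmod (Q t) ^ 2) - (sum_n (fun m => Cmod (c m) ^ 2) n + Cmod (c (S n)) ^ 2))
        with (ravg (fun t => Cmod (Q t + P n t)%C ^ 2) - Cmod (c (S n)) ^ 2) by (rewrite IH; ring).
      rewrite <- Step.
      + apply ravg_ext. intros. unfold P. rewrite sum_Sn.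
        f_equal. f_equal. change (plus ?a ?b) with (Cplus a b). ring.
      + now apply Ccont_plus.
      + rewrite fourier_plus, Horth by (auto; lia). unfold c. ring. }
  specialize (Main n).
  assert (0 <= ravg (fun t => Cmod (Q t + P n t)%C ^ 2)).
  { rewrite <- (ravg_const 0). apply ravg_le.
    - intros; apply continuous_const.
    - apply Ccont_Cmod2. now apply Ccont_plus.
    - intros. apply pow2_ge_0. }
  fold c. unfold c in Main |- *. lra.
Qed.

Definition trig (x : nat -> C) (n : nat) (t : R) : C :=
  sum_n (fun m => x m * mode (Z.of_nat m) t)%C n.

Lemma Ccont_trig x n : Ccont (trig x n).
Proof. apply Ccont_sum. intros i. apply Ccont_mult; auto using Ccont_const, Ccont_mode. Qed.

Lemma fourier_trig x n k :
  fourier (trig x n) k = sum_n (fun m => if Z.eq_dec (Z.of_nat m) k then x m else RtoC 0) n.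
Proof.
  unfold fourier.
  rewrite (Cavg_ext _ (fun t => sum_n (fun m => (x m * mode (Z.of_nat m) t) * mode (- k) t)%C n)).
  - rewrite Cavg_sum.
    + apply sum_n_ext. intros m. change (fourier (fun t => x m * mode (Z.of_nat m) t)%C k =
        if Z.eq_dec (Z.of_nat m) k then x m else RtoC 0).
      rewrite fourier_scal, fourier_mode by apply Ccont_mode. destruct (Z.eq_dec _ _); ring.
    + intros i. apply Ccont_mult_mode. apply Ccont_mult; auto using Ccont_const, Ccont_mode.
  - intros t. unfold trig. symmetry. apply (sum_n_mult_r (K := C_Ring)).
Qed.

Lemma parseval_trig x n : ravg (fun t => Cmod (trig x n t) ^ 2) = sum_n (fun m => Cmod (x m) ^ 2) n.
Proof.
  induction n as [| n IH].
  - rewrite sum_O. rewrite (ravg_ext _ (fun _ => Cmod (x 0%nat) ^ 2)); [apply ravg_const |].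
    intros t. unfold trig. rewrite sum_O, Cmod_mult, Cmod_mode. ring.
  - rewrite sum_Sn. rewrite (ravg_ext _ (fun t => Cmod (trig x n t + x (S n) * mode (Z.of_nat (S n)) t)%C ^ 2)).
    + rewrite energy_add_mode by apply Ccont_trig. rewrite IH, fourier_trig.
      rewrite (sum_n_ext_loc _ (fun _ => @zero C_AbelianMonoid)).
      * assert (E0 : sum_n (fun _ : nat => @zero C_AbelianMonoid) n = zero)
          by (apply (sum_n_m_const_zero (G := C_AbelianMonoid))).
        rewrite E0. change (plus ?a ?b) with (a + b). simpl. ring.
      * intros m Hm. destruct (Z.eq_dec _ _); [lia | reflexivity].
    + intros t. unfold trig. now rewrite sum_Sn.
Qed.

(** * Complex differentiability of power series *)

Lemma is_series_norm_bound {K : AbsRing} {V : NormedModule K} (u : nat -> V) (l : V) (B : R) :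
  is_series u l -> (forall n, norm (sum_n u n) <= B) -> norm l <= B.
Proof.
  intros Hu HB.
  assert (H : is_lim_seq (fun n => norm (sum_n u n)) (norm l)).
  { apply (filterlim_comp _ _ _ (sum_n u) norm _ (locally l)); [exact Hu | apply filterlim_norm]. }
  exact (is_lim_seq_le _ (fun _ => B) (norm l) B HB H (is_lim_seq_const B)).
Qed.

Lemma sum_n_geom (q : R) n : q <> 1 -> sum_n (fun k => q ^ k) n = (1 - q ^ S n) / (1 - q).
Proof.
  intros H. induction n as [| n IH].
  - rewrite sum_O. simpl. field. lra.
  - rewrite sum_Sn, IH. change (plus ?a ?b) with (a + b). simpl. field. lra.
Qed.

Lemma norm_sum_n_geom {K : AbsRing} {V : NormedModule K} (u : nat -> V) (B q : R) n :
  0 <= B -> 0 <= q < 1 -> (forall k, norm (u k) <= B * q ^ k) -> norm (sum_n u n) <= B / (1 - q).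
Proof.
  intros HB Hq H.
  apply Rle_trans with (sum_n (fun k => B * q ^ k) n).
  { unfold sum_n. eapply Rle_trans; [apply norm_sum_n_m |]. apply (sum_n_m_le _ _ 0 n). exact H. }
  rewrite (sum_n_mult_l (K := R_Ring)), sum_n_geom by lra.
  change (mult ?a ?b) with (a * b). unfold Rdiv. apply Rmult_le_compat_l; [exact HB |].
  assert (0 < / (1 - q)) by (apply Rinv_0_lt_compat; lra).
  assert (0 <= q ^ S n) by (apply pow_le; lra). nra.
Qed.

Lemma ex_series_geom_bound (B q : R) : 0 <= q < 1 -> ex_series (fun k => B * q ^ k).
Proof.
  intros Hq. apply (ex_series_scal (V := R_NormedModule)).
  exists (/ (1 - q)). apply is_series_geom. apply Rabs_def1; lra.
Qed.

Lemma Cmod_pow_n (u : C) k : Cmod (Cp u k) = Cmod u ^ k.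
Proof.
  induction k as [| k IH]; [exact Cmod_1 |].
  change (Cmod (u * Cp u k) = Cmod u * Cmod u ^ k).
  now rewrite Cmod_mult, IH.
Qed.

Lemma series_terms_bounded {K : AbsRing} {V : NormedModule K} (u : nat -> V) (l : V) :
  is_series u l -> exists M, 0 <= M /\ forall k, norm (u k) <= M.
Proof.
  intros Hu. destruct (filterlim_bounded _ (ex_intro _ l Hu)) as [M HM].
  assert (HM0 : 0 <= M) by (eapply Rle_trans; [| apply (HM 0%nat)]; apply norm_ge_0).
  exists (2 * M). split; [lra |]. intros [| k].
  - assert (H0 := HM 0%nat). rewrite sum_O in H0. lra.
  - assert (H1 := HM (S k)). assert (H0 := HM k). rewrite sum_Sn in H1.
    assert (E : u (S k) = minus (plus (sum_n u k) (u (S k))) (sum_n u k)).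
    { unfold minus. rewrite (plus_comm _ (opp _)), plus_assoc.
      rewrite (plus_opp_l (sum_n u k)). symmetry. apply (plus_zero_l (u (S k))). }
    rewrite E. eapply Rle_trans; [apply norm_triangle |]. rewrite norm_opp. lra.
Qed.

(** Convergence at one point bounds the terms there, hence gives geometric decay of the
    terms at every point closer to the centre. *)
Lemma pseries_coef_bound (a : nat -> C) (w l : C) : is_pseries a w l ->
  exists M, 0 <= M /\ forall k, Cmod (a k) * Cmod w ^ k <= M.
Proof.
  intros H. destruct (series_terms_bounded _ _ H) as (M & HM0 & HM).
  exists M. split; [exact HM0 |]. intros k. rewrite Rmult_comm, <- Cmod_pow_n, <- Cmod_mult. apply HM.
Qed.

(** The derivative [k * u ^ (k - 1)], in a recursive form that follows the powers and
    avoids the predecessor. *)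
Fixpoint pow_deriv (u : C) (k : nat) : C :=
  match k with O => 0%C | S k => (u * pow_deriv u k + Cp u k)%C end.

Lemma pow_deriv_bound u s k : 0 <= s -> Cmod u <= s -> Cmod (pow_deriv u k) * s <= (2 * s) ^ k.
Proof.
  intros Hs Hu. assert (Hu0 := Cmod_ge_0 u).
  induction k as [| k IH]; cbn [pow_deriv].
  - rewrite Cmod_0. simpl. lra.
  - eapply Rle_trans.
    { apply Rmult_le_compat_r; [exact Hs | apply Cmod_triangle]. }
    rewrite Cmod_mult, Cmod_pow_n.
    assert (H1 : Cmod u ^ k <= (2 * s) ^ k) by (apply pow_incr; lra).
    assert (H2 : 0 <= Cmod (pow_deriv u k)) by apply Cmod_ge_0.
    assert (H3 : Cmod u * Cmod (pow_deriv u k) * s <= s * (2 * s) ^ k).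
    { rewrite Rmult_assoc. apply Rmult_le_compat; auto. now apply Rmult_le_pos. }
    assert (0 <= Cmod u ^ k) by (now apply pow_le). simpl. nra.
Qed.

(** With [b k] the remainder and [h = v - u], one has [b (k + 1) = v * b k + pow_deriv u
    k * h ^ 2]; the bound follows this recursion. The factor 4 leaves room for the sum
    of both terms. *)
Lemma pow_taylor2 u v s k : 0 <= s -> Cmod u <= s -> Cmod v <= s ->
  Cmod (Cp v k - Cp u k - pow_deriv u k * (v - u))%C * s ^ 2
  <= (4 * s) ^ k * Cmod (v - u) ^ 2.
Proof.
  intros Hs Hu Hv. set (h := (v - u)%C). assert (Hv0 := Cmod_ge_0 v).
  induction k as [| k IH].
  - cbn [pow_n pow_deriv]. replace (_ - _ - 0 * h)%C with (RtoC 0) by ring. rewrite Cmod_0.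
    assert (H := pow2_ge_0 (Cmod h)). simpl pow at 2. lra.
  - set (b := (Cp v k - Cp u k - pow_deriv u k * h)%C) in *.
    replace (Cp v (S k) - Cp u (S k) - pow_deriv u (S k) * h)%C
      with (v * b + pow_deriv u k * (h * h))%C.
    2: { unfold b, h. cbn [pow_deriv pow_n]. change (@mult C_AbsRing) with Cmult.
         change (@mult (AbsRing.Ring C_AbsRing)) with Cmult. ring. }
    assert (Hd := pow_deriv_bound u s k Hs Hu).
    eapply Rle_trans.
    { apply Rmult_le_compat_r; [nra | apply Cmod_triangle]. }
    rewrite !Cmod_mult.
    assert (H0 := Cmod_ge_0 h). assert (Hb := Cmod_ge_0 b).
    assert (Hk : (2 * s) ^ k <= (4 * s) ^ k) by (apply pow_incr; lra).
    assert (A1 : Cmod v * Cmod b * s ^ 2 <= s * ((4 * s) ^ k * Cmod h ^ 2)).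
    { rewrite Rmult_assoc. apply Rmult_le_compat; auto. apply Rmult_le_pos; [auto | apply pow2_ge_0]. }
    assert (A2 : Cmod (pow_deriv u k) * (Cmod h * Cmod h) * s ^ 2 <= s * ((4 * s) ^ k * Cmod h ^ 2)).
    { replace (Cmod (pow_deriv u k) * (Cmod h * Cmod h) * s ^ 2)
        with (s * ((Cmod (pow_deriv u k) * s) * Cmod h ^ 2)) by ring.
      apply Rmult_le_compat_l; [exact Hs |]. apply Rmult_le_compat_r; [apply pow2_ge_0 | lra]. }
    assert (0 <= s * ((4 * s) ^ k * Cmod h ^ 2)).
    { apply Rmult_le_pos; [lra |]. apply Rmult_le_pos; [apply pow_le; lra | apply pow2_ge_0]. }
    replace ((4 * s) ^ S k * Cmod h ^ 2) with (4 * (s * ((4 * s) ^ k * Cmod h ^ 2))) by (simpl; ring).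
    lra.
Qed.

(** The constant and the radius are the same for all base points near [z0]. This
    uniformity, obtained by summing the quadratic remainders of the monomials, is what
    makes the derivative continuous. *)
Lemma analytic_quadratic g z0 : analytic_on_disk g -> disk z0 ->
  exists (s Q : R) (d : C -> C), 0 < s /\ 0 <= Q /\
    forall z z', Cmod (z - z0) < s -> Cmod (z' - z0) < s ->
      Cmod (g z' - g z - d z * (z' - z)) <= Q * Cmod (z' - z) ^ 2.
Proof.
  intros Hg Hz0. destruct (Hg z0 Hz0) as (a & rho & Ha). assert (Hrho := cond_pos rho).
  (* A point at distance [8 s = rho / 2] bounds the coefficients; the remainders of the
     monomials grow like [(4 s) ^ k], which leaves a ratio of 1/2. *)
  set (s := rho / 16).
  assert (Hs : 0 < s) by (unfold s; lra).
  assert (Hw : exists l, is_pseries a (RtoC (8 * s)) l).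
  { exists (g (z0 + RtoC (8 * s))%C).
    assert (E : (z0 + RtoC (8 * s) - z0)%C = RtoC (8 * s)) by ring.
    rewrite <- E at 1. apply Ha. rewrite E, Cmod_R, Rabs_pos_eq; unfold s; lra. }
  destruct Hw as [l Hl]. destruct (pseries_coef_bound _ _ _ Hl) as (M & HM0 & HM).
  rewrite Cmod_R, Rabs_pos_eq in HM by lra.
  assert (Hd : forall z, Cmod (z - z0) < s -> exists d, is_series (fun k => a k * pow_deriv (z - z0) k)%C d).
  { intros z Hz.
    apply (ex_series_le (V := C_CompleteNormedModule) (fun k => a k * pow_deriv (z - z0) k)%C
      (fun k => M / s * (/ 4) ^ k)).
    - intros k. change (Cmod (a k * pow_deriv (z - z0) k) <= M / s * (/ 4) ^ k). rewrite Cmod_mult.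
      assert (H1 := pow_deriv_bound (z - z0) s k ltac:(lra) ltac:(lra)).
      assert (H8 : (8 * s) ^ k * (/ 4) ^ k = (2 * s) ^ k).
      { rewrite <- Rpow_mult_distr. f_equal. field. }
      assert (H4 : 0 < (/ 4) ^ k) by (apply pow_lt; lra).
      apply Rmult_le_reg_r with s; [exact Hs |].
      replace (M / s * (/ 4) ^ k * s) with (M * (/ 4) ^ k) by (field; lra).
      apply Rle_trans with (Cmod (a k) * (8 * s) ^ k * (/ 4) ^ k).
      + rewrite !Rmult_assoc, H8. apply Rmult_le_compat_l; [apply Cmod_ge_0 | exact H1].
      + apply Rmult_le_compat_r; [lra | apply HM].
    - apply ex_series_geom_bound. lra. }
  exists s, (M / s ^ 2 / (1 - / 2)),
    (fun z => epsilon (inhabits (@zero C_NormedModule)) (is_series (fun k => a k * pow_deriv (z - z0) k)%C)).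
  assert (Hs2 : 0 < s ^ 2) by nra.
  split; [exact Hs | split; [apply Rdiv_le_0_compat; [apply Rdiv_le_0_compat|]; lra |]].
  intros z z' Hz Hz'.
  assert (Hdz := epsilon_spec (inhabits (@zero C_NormedModule)) _ (Hd z Hz)).
  set (d := epsilon _ _) in *.
  assert (S1 : is_pseries a (z - z0)%C (g z)) by (apply Ha; unfold s in *; lra).
  assert (S2 : is_pseries a (z' - z0)%C (g z')) by (apply Ha; unfold s in *; lra).
  set (u := (z - z0)%C) in *. set (v := (z' - z0)%C) in *.
  assert (Ev : (z' - z)%C = (v - u)%C) by (unfold u, v; ring). rewrite Ev.
  set (h := (v - u)%C).
  assert (S3 : is_series (fun k => a k * (Cp v k - Cp u k - pow_deriv u k * h))%C
                 (g z' - g z - d * h)%C).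
  { apply (is_series_ext (V := C_NormedModule)
      (fun k => minus (minus (scal (Cp v k) (a k)) (scal (Cp u k) (a k)))
                (scal h (a k * pow_deriv u k)%C))).
    - intros k. set (vk := Cp v k). set (uk := Cp u k).
      change ((vk * a k - uk * a k) - h * (a k * pow_deriv u k) = a k * (vk - uk - pow_deriv u k * h))%C. ring.
    - replace (g z' - g z - d * h)%C with (minus (minus (g z') (g z)) (scal h d)).
      + apply (is_series_minus (V := C_NormedModule)); [apply (is_series_minus (V := C_NormedModule)); assumption |].
        now apply (is_series_scal (V := C_NormedModule)).
      + change (g z' - g z - h * d = g z' - g z - d * h)%C. ring. }
  apply (is_series_norm_bound (V := C_NormedModule) _ _ _ S3).
  replace (M / s ^ 2 / (1 - / 2) * Cmod h ^ 2) with (M / s ^ 2 * Cmod h ^ 2 / (1 - / 2)) by (field; lra).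
  intros n.
  apply norm_sum_n_geom; [| lra |].
  { apply Rmult_le_pos; [apply Rdiv_le_0_compat; lra | apply pow2_ge_0]. }
  intros k. change (Cmod (a k * (Cp v k - Cp u k - pow_deriv u k * h)) <= M / s ^ 2 * Cmod h ^ 2 * (/ 2) ^ k).
  rewrite Cmod_mult.
  assert (H1 := pow_taylor2 u v s k ltac:(lra) ltac:(lra) ltac:(lra)). fold h in H1.
  apply Rmult_le_reg_r with (s ^ 2); [exact Hs2 |].
  replace (M / s ^ 2 * Cmod h ^ 2 * (/ 2) ^ k * s ^ 2) with (M * ((/ 2) ^ k * Cmod h ^ 2)) by (field; lra).
  assert (H8 : (8 * s) ^ k * (/ 2) ^ k = (4 * s) ^ k).
  { rewrite <- Rpow_mult_distr. f_equal. field. }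
  assert (H4 : 0 < (/ 2) ^ k) by (apply pow_lt; lra).
  apply Rle_trans with (Cmod (a k) * (8 * s) ^ k * ((/ 2) ^ k * Cmod h ^ 2)).
  + rewrite !Rmult_assoc, <- (Rmult_assoc ((8 * s) ^ k)), H8.
    apply Rmult_le_compat_l; [apply Cmod_ge_0 | exact H1].
  + apply Rmult_le_compat_r; [| apply HM]. apply Rmult_le_pos; [lra | apply pow2_ge_0].
Qed.

Lemma Cmod_minus_eq_0 (x y : C) : Cmod (x - y) = 0 -> x = y.
Proof.
  intros H. apply Cmod_eq_0 in H.
  assert (E : x = (x - y + y)%C) by ring. rewrite E, H. apply Cplus_0_l.
Qed.

(** A quadratic error instead of little-o: power series satisfy it, and it makes the
    derivative locally Lipschitz without further work. *)
Definition has_cderiv (g : C -> C) (z d : C) : Prop :=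
  exists s Q : R, 0 < s /\ 0 <= Q /\
    forall z', Cmod (z' - z) < s -> Cmod (g z' - g z - d * (z' - z)) <= Q * Cmod (z' - z) ^ 2.

Lemma quadratic_zero (A B s : R) : 0 < s -> 0 <= B -> (forall e, 0 < e < s -> A * e <= B * e ^ 2) -> A <= 0.
Proof.
  intros Hs HB H. apply Rnot_lt_le. intros HA.
  set (e := Rmin (s / 2) (A / (2 * (B + 1)))).
  assert (He : 0 < e) by (apply Rmin_pos; [lra | apply Rdiv_lt_0_compat; lra]).
  assert (H1 : e <= s / 2) by apply Rmin_l.
  assert (H2 : e <= A / (2 * (B + 1))) by apply Rmin_r.
  assert (H3 : e * (2 * (B + 1)) <= A) by (apply Rle_div_r in H2; lra).
  specialize (H e ltac:(lra)). nra.
Qed.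

Lemma has_cderiv_unique g z d1 d2 : has_cderiv g z d1 -> has_cderiv g z d2 -> d1 = d2.
Proof.
  intros (s1 & Q1 & Hs1 & HQ1 & H1) (s2 & Q2 & Hs2 & HQ2 & H2).
  assert (H : Cmod (d1 - d2) <= 0).
  { apply (quadratic_zero _ (Q1 + Q2) (Rmin s1 s2)); [now apply Rmin_pos | lra |].
    intros e He.
    min_bounds s1 s2.
    specialize (H1 (z + RtoC e)%C). specialize (H2 (z + RtoC e)%C).
    replace (z + RtoC e - z)%C with (RtoC e) in * by ring.
    rewrite Cmod_R, Rabs_pos_eq in * by lra.
    specialize (H1 ltac:(lra)). specialize (H2 ltac:(lra)).
    rewrite <- (Rabs_pos_eq e) at 1 by lra. rewrite <- Cmod_R, <- Cmod_mult.
    set (x1 := (g (z + RtoC e) - g z - d1 * RtoC e)%C) in *.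
    set (x2 := (g (z + RtoC e) - g z - d2 * RtoC e)%C) in *.
    replace ((d1 - d2) * RtoC e)%C with (x2 + - x1)%C by (unfold x1, x2; ring).
    eapply Rle_trans; [apply Cmod_triangle |]. rewrite Cmod_opp. lra. }
  apply Cmod_minus_eq_0. assert (H0 := Cmod_ge_0 (d1 - d2)). lra.
Qed.

(** Swapping the base point and the increment in the uniform quadratic estimate compares
    the derivatives at two nearby points, which gives continuity. *)
Lemma analytic_cderiv g : analytic_on_disk g -> exists D : C -> C,
  forall z, disk z -> has_cderiv g z (D z) /\ continuous D z.
Proof.
  intros Hg. pose (D := fun z : C => epsilon (inhabits (RtoC 0)) (has_cderiv g z)).
  exists D. intros z0 Hz0.
  destruct (analytic_quadratic g z0 Hg Hz0) as (s & Q & d & Hs & HQ & H).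
  assert (Hd : forall z, Cmod (z - z0) < s -> has_cderiv g z (d z)).
  { intros z Hz. exists (s - Cmod (z - z0)), Q. split; [lra | split; [exact HQ |]].
    intros z' Hz'. apply H; [exact Hz |].
    replace (z' - z0)%C with ((z' - z) + (z - z0))%C by ring.
    eapply Rle_lt_trans; [apply Cmod_triangle | lra]. }
  assert (HD : forall z, Cmod (z - z0) < s -> D z = d z).
  { intros z Hz. apply (has_cderiv_unique g z); [| now apply Hd].
    apply (epsilon_spec (inhabits (RtoC 0)) (has_cderiv g z)). eexists; now apply Hd. }
  assert (H00 : Cmod (z0 - z0) < s) by (replace (z0 - z0)%C with (RtoC 0) by ring; rewrite Cmod_0; lra).
  split; [rewrite HD by exact H00; now apply Hd |].
  apply filterlim_locally. intros eps.
  apply (locally_le_locally_norm (K := C_AbsRing) (V := C_NormedModule)).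
  assert (He := cond_pos eps).
  assert (Hp : 0 < Rmin s (eps / (2 * Q + 1))) by (apply Rmin_pos; [lra | apply Rdiv_lt_0_compat; lra]).
  exists (mkposreal _ Hp). intros z Hz. change (Cmod (z - z0) < Rmin s (eps / (2 * Q + 1))) in Hz.
  apply (norm_compat1 (K := C_AbsRing) (V := C_NormedModule)). change (Cmod (D z - D z0) < eps).
  min_bounds s (eps / (2 * Q + 1)).
  rewrite !HD by lra.
  destruct (Req_dec (Cmod (z - z0)) 0) as [E | E].
  { assert (E' : z = z0) by now apply Cmod_minus_eq_0.
    rewrite E'. replace (d z0 - d z0)%C with (RtoC 0) by ring. rewrite Cmod_0. exact He. }
  assert (Hm : 0 < Cmod (z - z0)) by (assert (H0 := Cmod_ge_0 (z - z0)); lra).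
  assert (A1 := H z z0 ltac:(lra) H00). assert (A2 := H z0 z H00 ltac:(lra)).
  set (x1 := (g z0 - g z - d z * (z0 - z))%C) in *.
  set (x2 := (g z - g z0 - d z0 * (z - z0))%C) in *.
  assert (A3 : Cmod (d z - d z0) * Cmod (z - z0) <= 2 * Q * Cmod (z - z0) ^ 2).
  { rewrite <- Cmod_mult. replace ((d z - d z0) * (z - z0))%C with (x1 + x2)%C by (unfold x1, x2; ring).
    eapply Rle_trans; [apply Cmod_triangle |].
    rewrite <- (Cmod_opp (z0 - z)) in A1. replace (- (z0 - z))%C with (z - z0)%C in A1 by ring. lra. }
  assert (A4 : Cmod (d z - d z0) <= 2 * Q * Cmod (z - z0)) by nra.
  assert (A5 : Cmod (z - z0) * (2 * Q + 1) < eps) by (apply Rlt_div_r; lra).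
  nra.
Qed.

(** A chain rule along a plane path for the real part; a constant [c] is kept in front
    so that both parts of a complex integrand are covered ([c = 1] and [c = - Ci]). *)
Lemma is_derive_along (g : C -> C) (d c v : C) (p1 p2 : R -> R) (t : R) :
  has_cderiv g (p1 t, p2 t) d -> is_derive p1 t (fst v) -> is_derive p2 t (snd v) ->
  is_derive (fun t => fst (c * g (p1 t, p2 t))%C) t (fst (c * (d * v))%C).
Proof.
  intros (s & Q & Hs & HQ & H) H1 H2. apply is_derive_Reals in H1, H2. apply is_derive_Reals.
  set (k := (c * d)%C).
  replace (fst (c * (d * v))%C) with (fst k * fst v + - snd k * snd v) by (unfold k; simpl; ring).
  apply (derivable_pt_lim_comp_2d (fun x y => fst (c * g (x, y))%C) p1 p2 t); [| exact H1 | exact H2].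
  intros eps. assert (He := cond_pos eps).
  set (B := 2 * (Cmod c * Q)).
  assert (HB : 0 <= B) by (assert (Hc := Cmod_ge_0 c); unfold B; nra).
  assert (Hdel : 0 < Rmin (s / 2) (eps / (B + 1))) by (apply Rmin_pos; [| apply Rdiv_lt_0_compat]; lra).
  exists (mkposreal _ Hdel). intros x y Hx Hy. simpl in Hx, Hy.
  set (m := Rmax (Rabs (x - p1 t)) (Rabs (y - p2 t))).
  assert (Hm : m < Rmin (s / 2) (eps / (B + 1))) by now apply Rmax_lub_lt.
  min_bounds (s / 2) (eps / (B + 1)).
  assert (Hm0 : 0 <= m) by (eapply Rle_trans; [apply Rabs_pos | apply Rmax_l]).
  assert (Hm2 : m * (B + 1) < eps) by (apply Rlt_div_r; lra).
  set (w := ((x, y) - (p1 t, p2 t))%C).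
  assert (Hw : Cmod w ^ 2 <= 2 * m ^ 2).
  { rewrite <- (pow2_sqrt 2), <- Rpow_mult_distr by lra. apply pow_incr.
    split; [apply Cmod_ge_0 | exact (Cmod_2Rmax w)]. }
  assert (Hws : Cmod w < s).
  { assert (H0 := Cmod_ge_0 w). nra. }
  specialize (H (x, y) Hws). fold w in H.
  replace (fst (c * g (x, y))%C - fst (c * g (p1 t, p2 t))%C - (fst k * (x - p1 t) + - snd k * (y - p2 t)))
    with (fst (c * (g (x, y) - g (p1 t, p2 t) - d * w))%C) by (unfold k, w; simpl; ring).
  eapply Rle_trans; [apply (re_le_Cmod (c * _)%C) |]. rewrite Cmod_mult.
  apply Rle_trans with (Cmod c * (Q * (2 * m ^ 2))).
  - apply Rmult_le_compat_l; [apply Cmod_ge_0 |]. eapply Rle_trans; [exact H |].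
    now apply Rmult_le_compat_l.
  - replace (Cmod c * (Q * (2 * m ^ 2))) with (m * B * m) by (unfold B; ring).
    apply Rmult_le_compat_r; lra.
Qed.

(** * Cauchy's formula and Taylor series *)

(** Cauchy's kernel [r e^(it) / (r e^(it) - z)] on the circle of radius [r], as a
    function of [q = z / r]. *)
Definition ckernel (q : C) (t : R) : C := (/ (1 - q * mode (- 1) t))%C.

Lemma ckernel_den q t : Cmod q < 1 -> 1 - Cmod q <= Cmod (1 - q * mode (- 1) t).
Proof.
  intros Hq. assert (H := Cmod_triangle (1 - q * mode (- 1) t) (q * mode (- 1) t)).
  replace (1 - q * mode (- 1) t + q * mode (- 1) t)%C with (RtoC 1) in H by ring.
  rewrite Cmod_1, Cmod_mult, Cmod_mode in H. lra.
Qed.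

Lemma ckernel_den_neq_0 q t : Cmod q < 1 -> (1 - q * mode (- 1) t)%C <> 0%C.
Proof. intros Hq E. assert (H := ckernel_den q t Hq). rewrite E, Cmod_0 in H. lra. Qed.

Lemma Ccont_ckernel q : Cmod q < 1 -> Ccont (ckernel q).
Proof.
  intros Hq t. apply (Ccont_at_inv (fun t => 1 - q * mode (- 1) t)%C).
  - now apply ckernel_den_neq_0.
  - assert (H : Ccont (fun t => 1 + (- q) * mode (- 1) t)%C)
      by (apply Ccont_plus; [| apply Ccont_mult]; auto using Ccont_const, Ccont_mode).
    apply Ccont_at_ext with (2 := H t). intros; ring.
Qed.

Lemma ckernel_bound q t : Cmod q < 1 -> Cmod (ckernel q t) <= / (1 - Cmod q).
Proof.
  intros Hq. unfold ckernel. rewrite Cmod_inv by now apply ckernel_den_neq_0.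
  apply Rinv_le_contravar; [lra | now apply ckernel_den].
Qed.

(** The finite geometric series with exact remainder. *)
Lemma ckernel_geom q t n : Cmod q < 1 ->
  ckernel q t = (sum_n (fun m => Cp q m * mode (- Z.of_nat m) t) n
     + Cp q (S n) * (mode (- Z.of_nat (S n)) t * ckernel q t))%C.
Proof.
  intros Hq. assert (H0 := ckernel_den_neq_0 q t Hq).
  assert (E : ckernel q t = (1 + q * mode (- 1) t * ckernel q t)%C).
  { unfold ckernel. now field. }
  induction n as [| n IH].
  - rewrite sum_O. cbn [pow_n]. change (Z.of_nat 0) with 0%Z. change (- Z.of_nat 1)%Z with (-1)%Z.
    simpl Z.opp. rewrite mode_0. change (@one (AbsRing.Ring C_AbsRing)) with (RtoC 1).
    change (@mult C_AbsRing q (RtoC 1)) with (q * RtoC 1)%C.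
    change (@mult (AbsRing.Ring C_AbsRing) q (RtoC 1)) with (q * RtoC 1)%C. rewrite E at 1. ring.
  - rewrite sum_Sn. rewrite IH at 1.
    assert (Em : mode (- Z.of_nat (S (S n))) t = (mode (- Z.of_nat (S n)) t * mode (- 1) t)%C).
    { rewrite <- mode_plus. f_equal. lia. }
    rewrite Em.
    change (Cp q (S (S n))) with (q * Cp q (S n))%C.
    set (X := Cp q (S n)). set (Sm := sum_n _ n).
    change (plus Sm ?b) with (Sm + b)%C.
    rewrite E at 1. ring.
Qed.

Lemma Cavg_ckernel_expand (f : R -> C) q n : Ccont f -> Cmod q < 1 ->
  Cavg (fun t => f t * ckernel q t)%C =
  (sum_n (fun m => Cp q m * fourier f (Z.of_nat m)) n
    + Cp q (S n) * Cavg (fun t => f t * (mode (- Z.of_nat (S n)) t * ckernel q t)))%C.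
Proof.
  intros Hf Hq.
  assert (HK := Ccont_ckernel q Hq).
  assert (H1 : Ccont (fun t => f t * (mode (- Z.of_nat (S n)) t * ckernel q t))%C)
    by (apply Ccont_mult; [exact Hf | apply Ccont_mult; auto using Ccont_mode]).
  assert (H2 : forall m, Ccont (fun t => f t * mode (- Z.of_nat m) t)%C)
    by (intros; now apply Ccont_mult_mode).
  assert (H3 : forall m, Ccont (fun t => Cp q m * (f t * mode (- Z.of_nat m) t))%C)
    by (intros; apply Ccont_mult; auto using Ccont_const).
  rewrite (Cavg_ext _ (fun t => sum_n (fun m => Cp q m * (f t * mode (- Z.of_nat m) t)) n
    + Cp q (S n) * (f t * (mode (- Z.of_nat (S n)) t * ckernel q t)))%C).
  - rewrite Cavg_plus; [| now apply Ccont_sum | apply Ccont_mult; auto using Ccont_const].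
    rewrite Cavg_scal by exact H1. f_equal.
    rewrite Cavg_sum by exact H3. apply sum_n_ext. intros m. now apply Cavg_scal.
  - intros t. rewrite (ckernel_geom q t n Hq) at 1. rewrite Cmult_plus_distr_l. f_equal.
    + rewrite <- (sum_n_mult_l (K := C_Ring)). apply sum_n_ext. intros m.
      change (f t * (Cp q m * mode (- Z.of_nat m) t)
        = Cp q m * (f t * mode (- Z.of_nat m) t))%C. ring.
    + ring.
Qed.

(** Averaging the geometric expansion of the kernel term by term; the remainder is of
    order [|q| ^ n]. *)
Lemma Cavg_ckernel_pseries (f : R -> C) (M : R) q : Ccont f -> (forall t, Cmod (f t) <= M) -> Cmod q < 1 ->
  is_pseries (fun m => fourier f (Z.of_nat m)) q (Cavg (fun t => f t * ckernel q t)%C).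
Proof.
  intros Hf HM Hq.
  assert (HM0 : 0 <= M) by (eapply Rle_trans; [apply Cmod_ge_0 | apply (HM 0)]).
  assert (Hq0 := Cmod_ge_0 q).
  set (L := Cavg (fun t => f t * ckernel q t)%C).
  set (B := M / (1 - Cmod q)).
  assert (Hn : forall n, Cmod (sum_n (fun m => scal (Cp q m) (fourier f (Z.of_nat m))) n - L)
             <= B * Cmod q ^ S n).
  { intros n. unfold L. rewrite (Cavg_ckernel_expand f q n Hf Hq).
    set (Sm := sum_n _ n).
    replace (Sm - _)%C with (- (Cp q (S n) *
       Cavg (fun t => f t * (mode (- Z.of_nat (S n)) t * ckernel q t))))%C.
    2: { change (sum_n (fun m : nat => (Cp q m * fourier f (Z.of_nat m))%C) n) with Sm.
         ring. }
    rewrite Cmod_opp, Cmod_mult, Cmod_pow_n, Rmult_comm.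
    apply Rmult_le_compat_r; [now apply pow_le |].
    apply Cavg_bound.
    - apply Ccont_mult; [exact Hf | apply Ccont_mult; auto using Ccont_mode, Ccont_ckernel].
    - intros t. rewrite !Cmod_mult, Cmod_mode, Rmult_1_l.
      apply Rmult_le_compat; auto using Cmod_ge_0, ckernel_bound. }
  unfold is_pseries, is_series. apply filterlim_locally. intros eps.
  assert (Hlim : is_lim_seq (fun n => B * Cmod q ^ S n) 0).
  { apply (is_lim_seq_incr_1 (fun n => B * Cmod q ^ n)).
    replace (Finite 0) with (Rbar_mult B 0) by (simpl; f_equal; ring).
    apply is_lim_seq_scal_l. apply is_lim_seq_geom. rewrite Rabs_pos_eq; lra. }
  destruct (proj1 (filterlim_locally _ _) Hlim eps) as [N HN].
  exists N. intros n Hn'. specialize (HN n Hn').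
  apply (norm_compat1 (K := C_AbsRing) (V := C_NormedModule)).
  change (Cmod (sum_n (fun m => scal (Cp q m) (fourier f (Z.of_nat m))) n - L) < eps).
  eapply Rle_lt_trans; [apply Hn |].
  change (Rabs (B * Cmod q ^ S n - 0) < eps) in HN. eapply Rle_lt_trans; [| exact HN].
  rewrite Rminus_0_r. apply Rle_abs.
Qed.

Lemma Cavg_ckernel q : Cmod q < 1 -> Cavg (ckernel q) = 1%C.
Proof.
  intros Hq.
  assert (H := Cavg_ckernel_pseries (fun _ => RtoC 1) 1 q (Ccont_const _)
     (fun _ => Req_le _ _ Cmod_1) Hq).
  assert (H1 : is_pseries (fun m => fourier (fun _ => RtoC 1) (Z.of_nat m)) q (RtoC 1)).
  { apply filterlim_ext with (fun _ : nat => RtoC 1); [| apply filterlim_const].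
    intros n. induction n as [| n IH].
    - rewrite sum_O. rewrite (fourier_ext _ (mode 0)) by (intros; now rewrite mode_0).
      rewrite fourier_mode. destruct (Z.eq_dec _ _); [| lia].
      change (RtoC 1 = RtoC 1 * RtoC 1)%C. ring.
    - rewrite sum_Sn, <- IH. rewrite (fourier_ext _ (mode 0)) by (intros; now rewrite mode_0).
      rewrite fourier_mode. destruct (Z.eq_dec _ _); [lia |].
      change (RtoC 1 = RtoC 1 + Cp q (S n) * RtoC 0)%C. ring. }
  rewrite (Cavg_ext _ (fun t => 1 * ckernel q t)%C) by (intros; ring).
  exact (filterlim_locally_unique _ _ _ H H1).
Qed.

(** The circle of radius [r] is contracted onto [z] along [P s t], [0 <= s <= 1]. The
    average of [g (P s t)] against the kernel does not depend on [s]: by [kernel_cancel]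
    its derivative in [s] is the average of [D (P s t) * r e^(it)], which up to the
    factor [i s] is the integral over a period of the derivative in [t] of [g (P s t)].
    At [s = 0] the average is [g z], at [s = 1] it is Cauchy's integral. *)
Section CauchyFormula.

Variables (g D : C -> C) (z : C) (r : R).
Hypothesis Hg : analytic_on_disk g.
Hypothesis HD : forall z, disk z -> has_cderiv g z (D z) /\ continuous D z.
Hypothesis Hr : 0 < r < 1.
Hypothesis Hz : Cmod z < r.

Let P (s t : R) : C := (fst z + s * (r * cos t - fst z), snd z + s * (r * sin t - snd z)).
Let K := ckernel (z / RtoC r).

(** The interval of [s] is slightly larger than [0, 1], as differentiation under the
    integral sign needs a neighbourhood. *)
Lemma segment_in_disk s t : - ((1 - r) / 2) < s < 1 + (1 - r) / 2 -> disk (P s t).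
Proof.
  intros Hs. unfold disk.
  assert (E : P s t = (RtoC (1 - s) * z + RtoC s * circle r t)%C).
  { unfold P, circle. destruct z as [x y]; unfold Cplus, Cmult; simpl. f_equal; ring. }
  rewrite E. eapply Rle_lt_trans; [apply Cmod_triangle |].
  rewrite !Cmod_mult, !Cmod_R, Cmod_circle by lra.
  assert (H0 := Cmod_ge_0 z).
  apply Rle_lt_trans with ((Rabs (1 - s) + Rabs s) * r).
  { rewrite Rmult_plus_distr_r. apply Rplus_le_compat_r.
    apply Rmult_le_compat_l; [apply Rabs_pos | lra]. }
  assert (Rabs (1 - s) + Rabs s <= 1 + (1 - r)).
  { unfold Rabs. destruct (Rcase_abs (1 - s)), (Rcase_abs s); lra. }
  nra.
Qed.

Lemma Cmod_ratio_lt_1 : Cmod (z / RtoC r) < 1.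
Proof.
  unfold Cdiv. rewrite Cmod_mult, Cmod_inv, Cmod_R, Rabs_pos_eq by (lra || (intros E; injection E; lra)).
  apply Rlt_div_l; lra.
Qed.

(** The derivative of [P s t] in [s] cancels the denominator of the kernel, so the
    differentiated integrand has no kernel left. *)
Lemma kernel_cancel t : (K t * (RtoC r * cis t - z) = RtoC r * cis t)%C.
Proof.
  assert (H := ckernel_den_neq_0 _ t Cmod_ratio_lt_1).
  assert (Hr0 : RtoC r <> 0%C) by (intros E; injection E; lra).
  assert (E1 : (cis t * mode (- 1) t)%C = 1%C).
  { unfold mode. rewrite <- cis_plus. replace (t + -1 * t) with 0 by ring. apply cis_0. }
  unfold K, ckernel. set (w := (1 - z / RtoC r * mode (- 1) t)%C) in *.
  assert (E2 : (RtoC r * cis t - z)%C = (RtoC r * cis t * w)%C).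
  { unfold w. transitivity (RtoC r * cis t - z * (cis t * mode (- 1) t))%C; [rewrite E1; ring | field; auto]. }
  rewrite E2. field. exact H.
Qed.

Lemma Ccont_at_P (x t : R) : Ccont_at (fun st : R * R => P (fst st) (snd st)) (x, t).
Proof.
  assert (Hgen : forall (u : R -> R) (k : R), (forall y : R, continuous u y) ->
     continuous (fun st : R * R => k + fst st * (r * u (snd st) - k)) (x, t)).
  { intros u k Hu.
    apply (continuous_plus (V := R_NormedModule)); [apply continuous_const |].
    apply (continuous_mult (K := R_AbsRing)); [apply continuous_fst |].
    apply (continuous_minus (V := R_NormedModule)); [| apply continuous_const].
    apply (continuous_mult (K := R_AbsRing)); [apply continuous_const |].
    apply (continuous_comp snd u); [apply continuous_snd | apply Hu]. }
  split; apply Hgen; intros y; smooth.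
Qed.

Variable c : C.

Let f (s t : R) : R := fst (c * K t * g (P s t))%C.
Let fs (s t : R) : R := fst (c * (D (P s t) * (RtoC r * cis t)))%C.

Lemma integrand_derive s t : - ((1 - r) / 2) < s < 1 + (1 - r) / 2 ->
  is_derive (fun s => f s t) s (fs s t).
Proof.
  intros Hs.
  replace (fs s t) with (fst (c * K t * (D (P s t) * (RtoC r * cis t - z)))%C).
  - apply (is_derive_along g (D (P s t)) (c * K t) (RtoC r * cis t - z)%C
      (fun s => fst z + s * (r * cos t - fst z)) (fun s => snd z + s * (r * sin t - snd z))).
    + now apply HD, segment_in_disk.
    + simpl. auto_derive; [easy | ring].
    + simpl. auto_derive; [easy | ring].
  - unfold fs. f_equal.
    transitivity (c * (D (P s t) * (K t * (RtoC r * cis t - z))))%C; [ring |].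
    now rewrite kernel_cancel.
Qed.

Lemma Ccont_g_P s : 0 <= s <= 1 -> Ccont (fun t => g (P s t)).
Proof.
  intros Hs t. apply (Ccont_at_comp g (P s)).
  - split; smooth.
  - apply analytic_continuous; [exact Hg | apply segment_in_disk; lra].
Qed.

Lemma integrand_derivative_continuous s t : - ((1 - r) / 2) < s < 1 + (1 - r) / 2 ->
  continuous (fun st : R * R => fs (fst st) (snd st)) (s, t).
Proof.
  intros Hs. unfold fs.
  apply (proj1 (A := continuous (fun st : R * R => fst (c * (D (P (fst st) (snd st)) * (RtoC r * cis (snd st))))%C) (s, t))
    (B := continuous (fun st : R * R => snd (c * (D (P (fst st) (snd st)) * (RtoC r * cis (snd st))))%C) (s, t))).
  apply Ccont_at_mult; [apply Ccont_at_const |].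
  apply Ccont_at_mult.
  - apply (Ccont_at_comp D (fun st : R * R => P (fst st) (snd st))); [apply Ccont_at_P |].
    apply HD. now apply segment_in_disk.
  - apply Ccont_at_mult; [apply Ccont_at_const |]. unfold cis.
    split; [apply (continuous_comp snd cos) | apply (continuous_comp snd sin)];
      try apply continuous_snd;
      smooth.
Qed.

(** For [s <> 0] the integrand is a derivative in [t] of a function with period [2 *
    PI]; for [s = 0] it is a multiple of [e^(it)]. *)
Lemma integrand_derivative_RInt s : 0 <= s <= 1 -> RInt (fun t => fs s t) (- PI) PI = 0.
Proof.
  intros Hs.
  destruct (Req_dec s 0) as [-> | Hs0].
  - assert (E : Cavg (fun t => (c * D z * RtoC r) * mode 1 t)%C = 0%C).
    { rewrite Cavg_scal by apply Ccont_mode. rewrite Cavg_mode by lia. ring. }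
    assert (E1 : ravg (fun t => fs 0 t) = 0).
    { transitivity (fst (Cavg (fun t => (c * D z * RtoC r) * mode 1 t)%C)); [| now rewrite E].
      unfold Cavg; cbn [fst]. apply ravg_ext. intros t. unfold fs.
      replace (P 0 t) with z by (unfold P; destruct z; simpl; f_equal; ring).
      unfold mode. rewrite Rmult_1_l. f_equal. ring. }
    unfold ravg in E1. apply Rmult_integral in E1. destruct E1 as [E1 | E1]; [exact E1 |].
    assert (HP := PI_RGT_0). assert (0 < / (2 * PI)) by (apply Rinv_0_lt_compat; lra). lra.
  - apply is_RInt_unique.
    set (k := (c / (Ci * RtoC s))%C).
    assert (Hk : (Ci * RtoC s)%C <> 0%C).
    { intros E. injection E. intros; lra. }
    replace 0 with (minus (fst (k * g (P s PI))%C) (fst (k * g (P s (- PI)))%C)).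
    + apply (is_RInt_derive (V := R_CompleteNormedModule) (fun t => fst (k * g (P s t))%C)).
      * intros t _.
        replace (fs s t) with (fst (k * (D (P s t) * (Ci * RtoC s * (RtoC r * cis t))))%C).
        2: { unfold fs, k. f_equal. field.
             split; intros E; [injection E; intros; lra |]. apply Hk. rewrite E. ring. }
        apply (is_derive_along g (D (P s t)) k (Ci * RtoC s * (RtoC r * cis t))%C
          (fun t => fst z + s * (r * cos t - fst z)) (fun t => snd z + s * (r * sin t - snd z))).
        -- apply HD, segment_in_disk. lra.
        -- simpl. auto_derive; [easy | ring].
        -- simpl. auto_derive; [easy | ring].
      * intros t _.
        apply (continuous_comp (fun t => (s, t)) (fun st : R * R => fs (fst st) (snd st))).
        -- apply (continuous_comp_2 (fun _ : R => s) (fun t : R => t) (fun a b => (a, b)));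
             [apply continuous_const | apply continuous_id |].
           apply filterlim_locally. intros eps. exists eps. intros [a b] H. exact H.
        -- apply integrand_derivative_continuous. lra.
    + replace (P s (- PI)) with (P s PI).
      * apply (minus_eq_zero (G := R_AbelianGroup)).
      * unfold P. now rewrite cos_neg, sin_neg, sin_PI, Ropp_0.
Qed.

Lemma mean_derive s : 0 <= s <= 1 -> is_derive (fun s => RInt (fun t => f s t) (- PI) PI) s 0.
Proof.
  intros Hs.
  assert (Hloc : locally (T := R_UniformSpace) s (fun x => - ((1 - r) / 2) < x < 1 + (1 - r) / 2)).
  { assert (He : 0 < (1 - r) / 2) by lra. exists (mkposreal _ He). intros y Hy.
    change (Rabs (y - s) < (1 - r) / 2) in Hy. apply Rabs_def2 in Hy. lra. }
  assert (H := is_derive_RInt_param f (- PI) PI s).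
  rewrite <- (integrand_derivative_RInt s Hs).
  replace (RInt (fun t => fs s t) (- PI) PI) with (RInt (fun t => Derive (fun u => f u t) s) (- PI) PI).
  - apply H.
    + apply filter_imp with (2 := Hloc). intros y Hy t _. eexists. now apply integrand_derive.
    + intros t _. apply (continuity_2d_pt_ext_loc fs).
      * destruct Hloc as [d Hd]. exists d. intros u v Hu _. symmetry. apply is_derive_unique.
        apply integrand_derive. apply Hd. exact Hu.
      * apply continuity_2d_pt_filterlim. apply integrand_derivative_continuous. lra.
    + apply filter_imp with (2 := Hloc). intros y Hy. apply ex_RInt_cont. intros t.
      refine (proj1 (Ccont_at_mult (fun t => c * K t)%C (fun t => g (P y t)) t _ _)).
      * apply (Ccont_mult (fun _ => c) K); [apply Ccont_const | apply Ccont_ckernel, Cmod_ratio_lt_1].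
      * apply (Ccont_at_comp g (P y)).
        -- split; smooth.
        -- apply analytic_continuous; [exact Hg | now apply segment_in_disk].
  - apply RInt_ext. intros t _. apply is_derive_unique, integrand_derive. lra.
Qed.

Lemma mean_const : fst (c * Cavg (fun t => g (circle r t) * K t))%C = fst (c * g z)%C.
Proof.
  assert (E := eq_is_derive (V := R_NormedModule) (fun s => RInt (fun t => f s t) (- PI) PI) 0 1
     (fun s Hs => mean_derive s Hs) Rlt_0_1). cbv beta in E.
  assert (HK : Ccont K) by apply Ccont_ckernel, Cmod_ratio_lt_1.
  assert (Hav : forall s, 0 <= s <= 1 ->
     fst (c * Cavg (fun t => g (P s t) * K t))%C = RInt (fun t => f s t) (- PI) PI / (2 * PI)).
  { intros s Hs. rewrite <- Cavg_scal by (apply Ccont_mult; [now apply Ccont_g_P | exact HK]).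
    unfold Cavg; cbn [fst]. apply ravg_ext. intros t. unfold f. f_equal. ring. }
  transitivity (fst (c * Cavg (fun t => g (P 1 t) * K t))%C).
  - f_equal. f_equal. apply Cavg_ext. intros t. f_equal. f_equal. unfold P, circle. f_equal; ring.
  - rewrite Hav, <- E, <- Hav by lra. f_equal. f_equal.
    rewrite (Cavg_ext _ (fun t => g z * K t)%C).
    + rewrite Cavg_scal by exact HK. unfold K. rewrite Cavg_ckernel by apply Cmod_ratio_lt_1. ring.
    + intros t. f_equal. f_equal. unfold P. destruct z; simpl. f_equal; ring.
Qed.

End CauchyFormula.

Lemma cauchy_formula g z r : analytic_on_disk g -> 0 < r < 1 -> Cmod z < r ->
  Cavg (fun t => g (circle r t) * ckernel (z / RtoC r) t)%C = g z.
Proof.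
  intros Hg Hr Hz. destruct (analytic_cderiv g Hg) as [D HD].
  assert (H1 := mean_const g D z r Hg HD Hr Hz 1%C).
  assert (H2 := mean_const g D z r Hg HD Hr Hz (- Ci)%C).
  set (w := Cavg _) in *. destruct w as [x y], (g z) as [x' y']. simpl in H1, H2.
  f_equal; lra.
Qed.

Lemma Ccont_circle g r : analytic_on_disk g -> 0 <= r < 1 -> Ccont (fun t => g (circle r t)).
Proof.
  intros Hg Hr t. apply (Ccont_at_comp g (circle r)).
  - split; smooth.
  - apply analytic_continuous; [exact Hg |]. unfold disk. rewrite Cmod_circle; lra.
Qed.

Lemma plus_minus_cancel {G : AbelianGroup} (x y : G) : plus (minus x y) y = x.
Proof. unfold minus. now rewrite <- plus_assoc, plus_opp_l, plus_zero_r. Qed.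

Lemma is_series_tail_bound {K : AbsRing} {V : NormedModule K} (u : nat -> V) (l : V) (B q : R) n :
  is_series u l -> 0 <= B -> 0 <= q < 1 -> (forall k, norm (u k) <= B * q ^ k) ->
  norm (minus l (sum_n u n)) <= B / (1 - q) * q ^ S n.
Proof.
  intros Hu HB Hq H.
  assert (H1 : is_series (fun k => u (S n + k)%nat) (minus l (sum_n u n))).
  { apply is_series_incr_n; [lia |]. simpl pred.
    replace (plus _ (sum_n u n)) with l; [exact Hu |]. symmetry. apply (plus_minus_cancel (G := V)). }
  apply (is_series_norm_bound _ _ _ H1). intros m.
  replace (B / (1 - q) * q ^ S n) with (B * q ^ S n / (1 - q)) by (field; lra).
  apply norm_sum_n_geom; [| exact Hq |].
  - apply Rmult_le_pos; [exact HB | apply pow_le; lra].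
  - intros k. rewrite Rmult_assoc, <- pow_add. apply H.
Qed.

Lemma geom_eventually_small (B q e : R) : 0 <= q < 1 -> 0 < e -> exists N, forall n, (N <= n)%nat -> B * q ^ n < e.
Proof.
  intros Hq He.
  assert (Hlim : is_lim_seq (fun n => B * q ^ n) 0).
  { replace (Finite 0) with (Rbar_mult B 0) by (simpl; f_equal; ring).
    apply is_lim_seq_scal_l. apply is_lim_seq_geom. rewrite Rabs_pos_eq; lra. }
  destruct (proj1 (filterlim_locally _ _) Hlim (mkposreal _ He)) as [N HN].
  exists N. intros n Hn. specialize (HN n Hn).
  change (Rabs (B * q ^ n - 0) < e) in HN. eapply Rle_lt_trans; [| exact HN].
  rewrite Rminus_0_r. apply Rle_abs.
Qed.

Lemma sum_n_trunc {G : AbelianMonoid} (u : nat -> G) i n : (i <= n)%nat ->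
  (forall m, (i < m)%nat -> u m = zero) -> sum_n u n = sum_n u i.
Proof.
  intros Hi H. induction Hi as [| n Hn IH]; [reflexivity |].
  rewrite sum_Sn, IH, H by lia. apply plus_zero_r.
Qed.

Lemma sum_n_single {G : AbelianMonoid} (u : nat -> G) i n : (i <= n)%nat ->
  (forall m, m <> i -> u m = zero) -> sum_n u n = u i.
Proof.
  intros Hi H. rewrite (sum_n_trunc u i n Hi) by (intros; apply H; lia).
  destruct i as [| i]; [apply sum_O |].
  rewrite sum_Sn. rewrite (sum_n_ext_loc u (fun _ => zero)) by (intros; apply H; lia).
  unfold sum_n. rewrite sum_n_m_const_zero. apply plus_zero_l.
Qed.

Lemma sum_n_rev {G : AbelianMonoid} (u : nat -> G) n : sum_n u n = sum_n (fun i => u (n - i)%nat) n.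
Proof.
  revert u. induction n as [| n IH]; intros u; [now rewrite !sum_O |].
  assert (E : sum_n u (S n) = plus (u 0%nat) (sum_n (fun i => u (S i)) n)).
  { unfold sum_n. rewrite sum_Sn_m by lia. now rewrite (sum_n_m_S u). }
  rewrite E, IH, sum_Sn, plus_comm. f_equal; [| f_equal; lia].
  apply sum_n_ext_loc. intros m Hm. f_equal. lia.
Qed.

(** On the circle the partial sums converge uniformly, and for large [n] their [k]-th
    Fourier coefficient is the claimed value. Negative [k] are included: they make the
    matrix of multiplication triangular. *)
Lemma fourier_pseries (a : nat -> C) (f : C -> C) (rho r : R) k :
  (forall z, Cmod z < rho -> is_pseries a z (f z)) -> 0 < r < rho ->
  Ccont (fun t => f (circle r t)) ->
  fourier (fun t => f (circle r t)) k =
  if Z_lt_dec k 0 then RtoC 0 else (a (Z.to_nat k) * RtoC (r ^ Z.to_nat k))%C.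
Proof.
  intros Ha Hr Hc.
  set (v := if Z_lt_dec k 0 then RtoC 0 else (a (Z.to_nat k) * RtoC (r ^ Z.to_nat k))%C).
  (* A radius between [r] and [rho] gives uniform geometric decay on the circle. *)
  set (r1 := (r + rho) / 2).
  assert (Hr1 : r < r1 < rho) by (unfold r1; lra).
  destruct (pseries_coef_bound a (RtoC r1) (f (RtoC r1))) as (M & HM0 & HM).
  { apply Ha. rewrite Cmod_R, Rabs_pos_eq; lra. }
  rewrite Cmod_R, Rabs_pos_eq in HM by lra.
  set (q := r / r1).
  assert (Hq : 0 <= q < 1) by (unfold q; split; [apply Rdiv_le_0_compat | apply Rlt_div_l]; lra).
  set (b := fun m => (a m * RtoC (r ^ m))%C).
  assert (Htail : forall n t, Cmod (f (circle r t) - trig b n t) <= M / (1 - q) * q ^ S n).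
  { intros n t.
    assert (Hs : is_series (fun m => b m * mode (Z.of_nat m) t)%C (f (circle r t))).
    { assert (Hf := Ha (circle r t) ltac:(rewrite Cmod_circle; lra)).
      apply is_series_ext with (2 := Hf). intros m.
      change (Cp (circle r t) m * a m = b m * mode (Z.of_nat m) t)%C.
      assert (E : Cp (circle r t) m = (RtoC (r ^ m) * mode (Z.of_nat m) t)%C).
      { rewrite cis_circle. clear. induction m as [| m IH].
        - rewrite mode_0. simpl. change (@one (AbsRing.Ring C_AbsRing)) with (RtoC 1). ring.
        - change (RtoC r * cis t * Cp (RtoC r * cis t)%C m = RtoC (r * r ^ m) * mode (Z.of_nat (S m)) t)%C.
          rewrite IH, RtoC_mult. replace (Z.of_nat (S m)) with (1 + Z.of_nat m)%Z by lia.
          rewrite mode_plus. unfold mode at 2. rewrite Rmult_1_l. ring. }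
      rewrite E. unfold b. ring. }
    apply (is_series_tail_bound (V := C_NormedModule) _ _ M q n Hs HM0 Hq).
    intros m. change (Cmod (b m * mode (Z.of_nat m) t) <= M * q ^ m).
    unfold b. rewrite !Cmod_mult, Cmod_mode, Cmod_R, Rmult_1_r, Rabs_pos_eq by (apply pow_le; lra).
    replace (r ^ m) with (r1 ^ m * q ^ m).
    - rewrite <- Rmult_assoc. apply Rmult_le_compat_r; [apply pow_le; lra | apply HM].
    - rewrite <- Rpow_mult_distr. f_equal. unfold q. field. lra. }
  assert (Hv : forall n, (Z.to_nat k <= n)%nat -> fourier (trig b n) k = v).
  { intros n Hn. rewrite fourier_trig. unfold v. destruct (Z_lt_dec k 0) as [Hk | Hk].
    - rewrite (sum_n_ext_loc _ (fun _ => @zero C_AbelianMonoid)).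
      + apply (sum_n_m_const_zero (G := C_AbelianMonoid)).
      + intros m _. destruct (Z.eq_dec _ _); [lia | reflexivity].
    - rewrite (sum_n_single _ (Z.to_nat k) n Hn).
      + destruct (Z.eq_dec _ _); [reflexivity | lia].
      + intros m Hm. destruct (Z.eq_dec _ _); [lia | reflexivity]. }
  apply Cmod_minus_eq_0. apply Rle_antisym; [| apply Cmod_ge_0].
  apply Rnot_lt_le. intros Hlt.
  destruct (geom_eventually_small (M / (1 - q)) q _ Hq Hlt) as [N HN].
  set (n := (N + Z.to_nat k)%nat).
  specialize (HN (S n) ltac:(unfold n; lia)).
  rewrite <- (Hv n) in HN by (unfold n; lia).
  apply Rlt_not_le in HN. apply HN.
  replace (fourier (fun t => f (circle r t)) k - fourier (trig b n) k)%C
    with (fourier (fun t => f (circle r t) + (- (1)) * trig b n t)%C k).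
  - apply fourier_bound.
    + apply Ccont_plus; [exact Hc |]. apply Ccont_mult; [apply Ccont_const | apply Ccont_trig].
    + intros t. replace (f (circle r t) + - (1) * trig b n t)%C with (f (circle r t) - trig b n t)%C by ring.
      apply Htail.
  - rewrite fourier_plus, fourier_scal; [ring | apply Ccont_trig | exact Hc |].
    apply Ccont_mult; [apply Ccont_const | apply Ccont_trig].
Qed.

(** Both sequences are read off from the Fourier coefficients on one circle. *)
Lemma pseries_unique (a b : nat -> C) (f : C -> C) (rho : R) : analytic_on_disk f -> 0 < rho < 1 ->
  (forall z, Cmod z < rho -> is_pseries a z (f z)) -> (forall z, Cmod z < rho -> is_pseries b z (f z)) ->
  forall k, a k = b k.
Proof.
  intros Hf Hrho Ha Hb k.
  assert (Hc : Ccont (fun t => f (circle (rho / 2) t))) by (apply Ccont_circle; [exact Hf | lra]).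
  assert (E1 := fourier_pseries a f rho (rho / 2) (Z.of_nat k) Ha ltac:(lra) Hc).
  rewrite (fourier_pseries b f rho (rho / 2) (Z.of_nat k) Hb ltac:(lra) Hc) in E1.
  destruct (Z_lt_dec _ _); [lia |]. rewrite Nat2Z.id in E1.
  assert (Hp : RtoC ((rho / 2) ^ k) <> 0%C).
  { intros E. injection E. assert (0 < (rho / 2) ^ k) by (apply pow_lt; lra). lra. }
  replace (a k) with (a k * RtoC ((rho / 2) ^ k) / RtoC ((rho / 2) ^ k))%C by (now field).
  rewrite <- E1. now field.
Qed.

(** Cauchy's formula with the kernel expanded. *)
Lemma taylor_on_circle g M r : analytic_on_disk g -> (forall z, disk z -> Cmod (g z) <= M) -> 0 < r < 1 ->
  exists a, forall z, Cmod z < r -> is_pseries a z (g z).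
Proof.
  intros Hg HM Hr.
  assert (Hr0 : RtoC r <> 0%C) by (intros E; injection E; lra).
  exists (fun m => fourier (fun t => g (circle r t)) (Z.of_nat m) * Cp (/ RtoC r)%C m)%C.
  intros z Hz.
  assert (Hq : Cmod (z / RtoC r) < 1) by now apply Cmod_ratio_lt_1.
  assert (HB : forall t, Cmod (g (circle r t)) <= M).
  { intros t. apply HM. unfold disk. rewrite Cmod_circle; lra. }
  assert (H := Cavg_ckernel_pseries (fun t => g (circle r t)) M (z / RtoC r)
    (Ccont_circle g r Hg ltac:(lra)) HB Hq).
  cbv beta in H. rewrite (cauchy_formula g z r Hg Hr Hz) in H.
  apply is_series_ext with (2 := H). intros m.
  set (c := fourier _ _).
  change (Cp (z / RtoC r)%C m * c
    = Cp z m * (c * Cp (/ RtoC r)%C m))%C.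
  assert (E : Cp (z / RtoC r)%C m = (Cp z m * Cp (/ RtoC r)%C m)%C).
  { clear. induction m as [| m IH].
    - change (RtoC 1 = RtoC 1 * RtoC 1)%C. ring.
    - change (z / RtoC r * Cp (z / RtoC r)%C m
        = (z * Cp z m) * (/ RtoC r * Cp (/ RtoC r)%C m))%C.
      rewrite IH. unfold Cdiv. ring. }
  rewrite E. ring.
Qed.

(** The expansions on the disks of radius [r < 1] agree by uniqueness, so the one for [r
    = 1/2] converges to [g] everywhere. *)
Theorem taylor_disk g : Hinf g -> exists a, forall z, disk z -> is_pseries a z (g z).
Proof.
  intros [Hg [M HM]].
  destruct (taylor_on_circle g M (/ 2) Hg HM ltac:(lra)) as [a Ha].
  exists a. intros z Hz. unfold disk in Hz.
  assert (H0 := Cmod_ge_0 z). set (r := (1 + Cmod z) / 2).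
  destruct (taylor_on_circle g M r Hg HM ltac:(unfold r; lra)) as [b Hb].
  assert (E : forall k, b k = a k).
  { apply (pseries_unique b a g (/ 2) Hg ltac:(lra)); [| exact Ha].
    intros w Hw. apply Hb. unfold r; lra. }
  apply (is_pseries_ext b); [exact E |]. apply Hb. unfold r. lra.
Qed.

(** * A norm bound for triangular Toeplitz matrices *)

Definition conv (a x : nat -> C) (i : nat) : C := sum_n (fun m => a (i - m)%nat * x m)%C i.

(** The left-hand side consists of the first Fourier coefficients of the product of [f],
    restricted to the circle of radius [r], with the trigonometric polynomial whose
    coefficients are [x]. Bessel's inequality and [|f| <= M] reduce it to Parseval's
    identity for that polynomial. *)
Lemma conv_bound_r (a : nat -> C) (f : C -> C) (M r : R) (x : nat -> C) n :
  analytic_on_disk f -> (forall z, disk z -> is_pseries a z (f z)) ->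
  (forall z, disk z -> Cmod (f z) <= M) -> 0 < r < 1 ->
  sum_n (fun i => Cmod (conv (fun k => a k * RtoC (r ^ k))%C x i) ^ 2) n
  <= M ^ 2 * sum_n (fun i => Cmod (x i) ^ 2) n.
Proof.
  intros Hf Ha HM Hr.
  set (F := fun t => f (circle r t)).
  assert (HF : Ccont F) by (apply Ccont_circle; [exact Hf | lra]).
  set (Q := fun t => (F t * trig x n t)%C).
  assert (HQ : Ccont Q) by (apply Ccont_mult; [exact HF | apply Ccont_trig]).
  apply Rle_trans with (ravg (fun t => Cmod (Q t) ^ 2)).
  - eapply Rle_trans; [| apply (bessel Q n HQ)].
    apply Req_le. apply sum_n_ext_loc. intros i Hi. f_equal. f_equal.
    assert (E : fourier Q (Z.of_nat i) = sum_n (fun m => x m * fourier F (Z.of_nat i - Z.of_nat m))%C n).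
    { unfold fourier at 1.
      rewrite (Cavg_ext _ (fun t => sum_n (fun m => x m * (F t * mode (- (Z.of_nat i - Z.of_nat m)) t))%C n)).
      - rewrite Cavg_sum.
        + apply sum_n_ext. intros m. rewrite Cavg_scal by now apply Ccont_mult_mode. reflexivity.
        + intros m. apply Ccont_mult; [apply Ccont_const | now apply Ccont_mult_mode].
      - intros t. unfold Q, trig.
        rewrite <- (Cmult_comm (sum_n _ n)), <- Cmult_assoc.
        rewrite <- (sum_n_mult_r (K := C_Ring)). apply sum_n_ext. intros m.
        replace (- (Z.of_nat i - Z.of_nat m))%Z with (Z.of_nat m + - Z.of_nat i)%Z by ring.
        rewrite mode_plus.
        change (@eq C (x m * mode (Z.of_nat m) t * (F t * mode (- Z.of_nat i) t))%C
          (x m * (F t * (mode (Z.of_nat m) t * mode (- Z.of_nat i) t)))%C). ring. }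
    rewrite E. rewrite (sum_n_trunc _ i n Hi).
    + unfold conv. apply sum_n_ext_loc. intros m Hm. unfold F.
      rewrite (fourier_pseries a f 1 r) by (assumption || lra).
      destruct (Z_lt_dec _ _); [lia |].
      replace (Z.to_nat (Z.of_nat i - Z.of_nat m)) with (i - m)%nat by lia.
      apply Cmult_comm.
    + intros m Hm. unfold F. rewrite (fourier_pseries a f 1 r) by (assumption || lra).
      destruct (Z_lt_dec _ _); [| lia]. apply Cmult_0_r.
  - rewrite <- parseval_trig, <- ravg_scal by (apply Ccont_Cmod2, Ccont_trig).
    apply ravg_le.
    + now apply Ccont_Cmod2.
    + intros t. apply (continuous_scal_r (V := R_NormedModule)). apply Ccont_Cmod2, Ccont_trig.
    + intros t. unfold Q. rewrite Cmod_mult, Rpow_mult_distr.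
      apply Rmult_le_compat_r; [apply pow2_ge_0 |]. apply pow_incr. split; [apply Cmod_ge_0 |].
      apply HM. unfold disk. rewrite Cmod_circle; lra.
Qed.

(** Reversing the order of the indices turns the transposed matrix into the convolution. *)
Lemma toeplitz_bound (a : nat -> C) (f : C -> C) (M r : R) (x : nat -> C) n :
  analytic_on_disk f -> (forall z, disk z -> is_pseries a z (f z)) ->
  (forall z, disk z -> Cmod (f z) <= M) -> 0 < r < 1 ->
  sum_n (fun j => Cmod (sum_n (fun k => a k * RtoC (r ^ k) * x (j + k)%nat)%C (n - j)) ^ 2) n
  <= M ^ 2 * sum_n (fun j => Cmod (x j) ^ 2) n.
Proof.
  intros Hf Ha HM Hr.
  assert (H := conv_bound_r a f M r (fun m => x (n - m)%nat) n Hf Ha HM Hr).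
  rewrite (sum_n_rev (fun j => Cmod (x j) ^ 2)).
  rewrite sum_n_rev. eapply Rle_trans; [| exact H].
  apply Req_le. apply sum_n_ext_loc. intros i Hi. f_equal. f_equal.
  unfold conv. replace (n - (n - i))%nat with i by lia.
  rewrite sum_n_rev. apply sum_n_ext_loc. intros m Hm. f_equal. f_equal. lia.
Qed.

(** * The space of square-summable sequences *)

Lemma l2_norm_sq (x : l2) : norm x ^ 2 = l2_q x.
Proof. rewrite l2_normE. apply pow2_sqrt, l2_q_pos. Qed.

Lemma sum_n_nonneg_mono (u : nat -> R) : (forall k, 0 <= u k) -> forall n, sum_n u n <= sum_n u (S n).
Proof. intros H n. rewrite sum_Sn. change (sum_n u n <= sum_n u n + u (S n)). specialize (H (S n)). lra. Qed.

Lemma sum_n_le_sum_n (u : nat -> R) n m : (forall k, 0 <= u k) -> (n <= m)%nat -> sum_n u n <= sum_n u m.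
Proof.
  intros H Hn. induction Hn as [| m Hn IH]; [apply Rle_refl |].
  eapply Rle_trans; [exact IH | now apply sum_n_nonneg_mono].
Qed.

Lemma sum_n_le_loc (u v : nat -> R) n : (forall k, (k <= n)%nat -> u k <= v k) -> sum_n u n <= sum_n v n.
Proof.
  intros H. induction n as [| n IH].
  - rewrite !sum_O. apply H. lia.
  - rewrite !sum_Sn. apply Rplus_le_compat; [apply IH; intros; apply H; lia | apply H; lia].
Qed.

Lemma nonneg_series_bounded (u : nat -> R) B : (forall k, 0 <= u k) -> (forall n, sum_n u n <= B) ->
  ex_series u /\ Series u <= B.
Proof.
  intros H0 HB.
  destruct (ex_finite_lim_seq_incr (sum_n u) B (sum_n_nonneg_mono u H0) HB) as [l Hl].
  assert (Hs : is_series u l) by exact Hl.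
  split; [now exists l |]. rewrite (is_series_unique _ _ Hs).
  exact (is_lim_seq_le _ _ _ _ HB Hl (is_lim_seq_const B)).
Qed.

Lemma nonneg_series_partial (u : nat -> R) n : (forall k, 0 <= u k) -> ex_series u -> sum_n u n <= Series u.
Proof.
  intros H0 [l Hl]. rewrite (is_series_unique _ _ Hl).
  apply (is_lim_seq_incr_compare (sum_n u) l Hl (sum_n_nonneg_mono u H0)).
Qed.

Lemma l2_partial_le (x : l2) n : sum_n (fun k => Cmod (x k) ^ 2) n <= norm x ^ 2.
Proof.
  rewrite l2_norm_sq. apply nonneg_series_partial; [intros; apply pow2_ge_0 | apply l2_summable].
Qed.

Lemma l2_norm_le (x : l2) B : 0 <= B -> (forall n, sum_n (fun k => Cmod (x k) ^ 2) n <= B ^ 2) -> norm x <= B.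
Proof.
  intros HB H. rewrite l2_normE, <- (sqrt_pow2 B HB). apply sqrt_le_1_alt.
  apply nonneg_series_bounded; [intros; apply pow2_ge_0 | exact H].
Qed.

Lemma l2_coord_le (x : l2) k : Cmod (x k) <= norm x.
Proof.
  apply Rsqr_incr_0; [| apply Cmod_ge_0 | apply norm_ge_0]. rewrite !Rsqr_pow2.
  eapply Rle_trans; [| apply (l2_partial_le x k)].
  apply (sum_n_ge_term (fun k => Cmod (x k) ^ 2)); [intros; apply pow2_ge_0 | lia].
Qed.

(** Raw operations with their own notations keep one syntactic form for each operation,
    whatever algebraic structure it is viewed in. *)
Definition l2_minus (x y : l2) : l2 := l2_plus x (l2_opp y).

Declare Scope l2_scope.
Delimit Scope l2_scope with L.
Notation "x + y" := (l2_plus x y) : l2_scope.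
Notation "x - y" := (l2_minus x y) : l2_scope.
Notation "c *: x" := (l2_scal c x) (at level 40, left associativity) : l2_scope.

Ltac l2_ext := apply l2_eq; intros; cbn;
  repeat (change (@mult C_AbsRing) with Cmult);
  repeat (change (@plus C_AbsRing) with Cplus).

Lemma l2_norm_scal (c : C) (x : l2) : norm (c *: x)%L = Cmod c * norm x.
Proof.
  rewrite !l2_normE.
  assert (E : l2_q (c *: x)%L = Cmod c ^ 2 * l2_q x).
  { unfold l2_q. rewrite <- Series_scal_l. apply Series_ext. intros k. simpl. rewrite Cmod_mult. ring. }
  rewrite E, sqrt_mult by (apply pow2_ge_0 || apply l2_q_pos). now rewrite sqrt_pow2 by apply Cmod_ge_0.
Qed.

Lemma l2_minus_coord (x y : l2) k : (x - y)%L k = (x k - y k)%C.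
Proof. reflexivity. Qed.

Lemma l2_sum_coord (u : nat -> l2) n k : sum_n u n k = sum_n (fun i => u i k) n.
Proof.
  induction n as [| n IH]; [now rewrite !sum_O |]. rewrite !sum_Sn, <- IH. reflexivity.
Qed.

Lemma l2_ball (x : l2) e (y : l2) : ball x e y <-> norm (y - x)%L < e.
Proof. reflexivity. Qed.

Lemma l2_triangle (x y : l2) : norm (x + y)%L <= norm x + norm y.
Proof. exact (norm_triangle (V := l2_NormedModule) x y). Qed.

Lemma l2_norm_zero : norm l2_zero = 0.
Proof.
  replace l2_zero with (RtoC 0 *: l2_zero)%L by (l2_ext; ring). rewrite l2_norm_scal, Cmod_0. ring.
Qed.

Lemma l2_norm_minus_ge (x y : l2) : norm x - norm y <= norm (x - y)%L.
Proof.
  assert (H := l2_triangle (x - y)%L y).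
  replace (x - y + y)%L with x in H by (l2_ext; ring). lra.
Qed.

Lemma l2_dist_triangle (x y z : l2) : norm (x - z)%L <= norm (x - y)%L + norm (y - z)%L.
Proof.
  replace (x - z)%L with (x - y + (y - z))%L by (l2_ext; ring).
  apply l2_triangle.
Qed.

Lemma l2_dist_sym (x y : l2) : norm (x - y)%L = norm (y - x)%L.
Proof.
  replace (x - y)%L with (RtoC (-1) *: (y - x))%L by (l2_ext; ring).
  rewrite l2_norm_scal, Cmod_R, Rabs_left by lra. ring.
Qed.

Section Completeness.

Variable F : (l2 -> Prop) -> Prop.
Hypothesis HF : ProperFilter F.
Hypothesis HC : cauchy F.

Let y (k : nat) : C := lim (T := C_CompleteNormedModule) (filtermap (fun x : l2 => x k) F).

Lemma l2_lim_coord k (e : posreal) : F (fun x => Cmod (x k - y k) < e).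
Proof.
  assert (He := cond_pos e).
  assert (H := complete_cauchy (T := C_CompleteNormedModule) (filtermap (fun x : l2 => x k) F)
     (filtermap_proper_filter _ _ _ _ HF)).
  assert (Hc : cauchy (T := C_CompleteNormedModule) (filtermap (fun x : l2 => x k) F)).
  { intros e'. destruct (HC e') as [x Hx]. exists (x k). unfold filtermap.
    apply filter_imp with (2 := Hx). intros z Hz.
    apply (norm_compat1 (K := C_AbsRing) (V := C_NormedModule)).
    eapply Rle_lt_trans; [| exact Hz]. apply (l2_coord_le (z - x)%L k). }
  set (nf := @norm_factor C_AbsRing C_NormedModule).
  assert (Hnf : 0 < nf) by apply norm_factor_gt_0.
  assert (Hen : 0 < e / nf) by (apply Rdiv_lt_0_compat; lra).
  specialize (H Hc (mkposreal _ Hen)). unfold filtermap in H.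
  apply filter_imp with (2 := H). intros x Hx.
  apply (norm_compat2 (K := C_AbsRing) (V := C_NormedModule)) in Hx. fold nf in Hx. simpl in Hx.
  replace (nf * (e / nf)) with (e : R) in Hx by (field; lra). exact Hx.
Qed.

(** A limit is taken coordinatewise. On finitely many coordinates it is within [d] of
    some element of the filter that is close to [x0]; the choice of [d] makes the total
    of [n + 1] errors small, uniformly in [n]. *)
Lemma l2_lim_close (e : posreal) : exists x0 : l2, F (ball x0 (e / 4)) /\
  forall n, sum_n (fun k => Cmod (y k - x0 k) ^ 2) n <= (e / 2) ^ 2.
Proof.
  assert (He := cond_pos e). assert (He4 : 0 < e / 4) by lra.
  destruct (HC (mkposreal _ He4)) as [x0 Hx0]. simpl in Hx0.
  exists x0. split; [exact Hx0 |]. intros n.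
  assert (HN : 0 < INR n + 1) by (assert (H := pos_INR n); lra).
  assert (Hd : 0 < e / (4 * (INR n + 1))) by (apply Rdiv_lt_0_compat; lra).
  set (d := e / (4 * (INR n + 1))) in *.
  assert (Hall : F (fun x => forall k, (k <= n)%nat -> Cmod (x k - y k) < d)).
  { clear HN. clearbody d. induction n as [| n IH].
    - apply filter_imp with (2 := l2_lim_coord 0 (mkposreal _ Hd)). intros x Hx k Hk.
      replace k with 0%nat by lia. exact Hx.
    - apply filter_imp with (2 := filter_and _ _ IH (l2_lim_coord (S n) (mkposreal _ Hd))).
      intros x [H1 H2] k Hk. destruct (Nat.eq_dec k (S n)) as [-> | Hk']; [exact H2 | apply H1; lia]. }
  destruct (filter_ex _ (filter_and _ _ Hall Hx0)) as (x & Hx1 & Hx2).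
  assert (Hx3 : norm (x - x0)%L < e / 4) by exact Hx2.
  apply Rle_trans with (sum_n (fun k => 2 * Cmod ((x - x0)%L k) ^ 2 + 2 * d ^ 2) n).
  - apply sum_n_le_loc. intros k Hk. replace (y k - x0 k)%C with ((x - x0)%L k + (y k - x k))%C.
    2: { rewrite l2_minus_coord. ring. }
    eapply Rle_trans; [apply (Cmod_plus_weighted _ _ 1 Rlt_0_1) |].
    assert (Hk' := Hx1 k ltac:(lia)). rewrite <- Cmod_opp in Hk'.
    replace (- (x k - y k))%C with (y k - x k)%C in Hk' by ring.
    assert (H0 := Cmod_ge_0 (y k - x k)). assert (Cmod (y k - x k) ^ 2 <= d ^ 2) by (apply pow_incr; lra). lra.
  - rewrite (sum_n_plus (G := R_AbelianMonoid)), sum_n_const.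
    rewrite (sum_n_mult_l (K := R_Ring)).
    change (2 * sum_n (fun k => Cmod ((x - x0)%L k) ^ 2) n + INR (S n) * (2 * d ^ 2) <= (e / 2) ^ 2).
    assert (H1 := l2_partial_le (x - x0)%L n).
    assert (H2 : norm (x - x0)%L ^ 2 <= (e / 4) ^ 2) by (apply pow_incr; split; [apply norm_ge_0 | lra]).
    rewrite S_INR.
    assert (H3 : (INR n + 1) * (2 * d ^ 2) <= e ^ 2 / 8).
    { replace ((INR n + 1) * (2 * d ^ 2)) with (e ^ 2 / 8 * / (INR n + 1)) by (unfold d; field; lra).
      rewrite <- (Rmult_1_r (e ^ 2 / 8)) at 2. apply Rmult_le_compat_l; [nra |].
      rewrite <- Rinv_1. apply Rinv_le_contravar; assert (H := pos_INR n); lra. }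
    lra.
Qed.

Lemma l2_complete_aux : exists z : l2, forall eps : posreal, F (ball z eps).
Proof.
  destruct (l2_lim_close (mkposreal 1 Rlt_0_1)) as (x1 & _ & H1).
  set (v := fun k => (y k - x1 k)%C).
  assert (Hv : ex_series (fun k => Cmod (v k) ^ 2))
    by (apply (nonneg_series_bounded _ _ (fun k => pow2_ge_0 _) H1)).
  set (z := (mk_l2 v Hv + x1)%L).
  assert (Hz : forall k, z k = y k).
  { intros k. change (y k - x1 k + x1 k = y k)%C. ring. }
  exists z. intros eps. assert (He := cond_pos eps).
  destruct (l2_lim_close eps) as (x0 & Hx0 & H0).
  apply filter_imp with (2 := Hx0). intros x Hx.
  assert (Hx' : norm (x - x0)%L < eps / 4) by exact Hx. apply l2_ball.
  eapply Rle_lt_trans; [apply (l2_dist_triangle x x0 z) |].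
  assert (Hn : norm (z - x0)%L <= eps / 2).
  { apply l2_norm_le; [lra |]. intros n. rewrite (sum_n_ext _ (fun k => Cmod (y k - x0 k) ^ 2)); [apply H0 |].
    intros k. now rewrite l2_minus_coord, Hz. }
  rewrite l2_dist_sym in Hn.
  lra.
Qed.

End Completeness.

(** Chosen rather than computed, so that filters with the same sets have equal limits. *)
Definition l2_lim (F : (l2 -> Prop) -> Prop) : l2 :=
  epsilon (inhabits l2_zero) (fun z => forall eps : posreal, F (ball z eps)).

Lemma l2_lim_spec F : ProperFilter F -> cauchy F -> forall eps : posreal, F (ball (l2_lim F) eps).
Proof. intros H1 H2. exact (epsilon_spec (inhabits l2_zero) _ (l2_complete_aux F H1 H2)). Qed.

Lemma l2_close_lim (F1 F2 : (l2 -> Prop) -> Prop) :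
  filter_le F1 F2 -> filter_le F2 F1 -> close (l2_lim F1) (l2_lim F2).
Proof.
  intros H1 H2. assert (E : F1 = F2).
  { apply functional_extensionality. intros P. apply propositional_extensionality.
    split; [apply H2 | apply H1]. }
  rewrite E. apply close_refl.
Qed.

Definition l2_CompleteSpace_mixin : CompleteSpace.mixin_of l2_UniformSpace :=
  CompleteSpace.Mixin l2_UniformSpace l2_lim l2_lim_spec l2_close_lim.
Canonical l2_CompleteSpace : CompleteSpace :=
  CompleteSpace.Pack l2 (CompleteSpace.Class l2 _ l2_CompleteSpace_mixin) l2.
Canonical l2_CompleteNormedModule : CompleteNormedModule C_AbsRing :=
  CompleteNormedModule.Pack C_AbsRing l2
    (CompleteNormedModule.Class C_AbsRing l2 (NormedModule.class _ l2_NormedModule) l2_CompleteSpace_mixin) l2.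

(** * Totality of eigenvectors of the backward shift *)

Lemma geo_summable (l : C) : Cmod l < 1 -> ex_series (fun k => Cmod (Cp l k) ^ 2).
Proof.
  intros Hl. assert (H0 := Cmod_ge_0 l).
  apply ex_series_ext with (fun k => 1 * (Cmod l ^ 2) ^ k).
  - intros k. rewrite Cmod_pow_n, <- !pow_mult, Rmult_1_l. f_equal. lia.
  - apply ex_series_geom_bound. split; [apply pow2_ge_0 | nra].
Qed.

(** The eigenvector of the backward shift for [l]; it is made total by the value 0
    outside the disk. *)
Definition eigvec (l : C) : l2 :=
  match Rlt_dec (Cmod l) 1 with
  | left H => mk_l2 (fun k => Cp l k) (geo_summable l H)
  | right _ => l2_zero
  end.

Definition eigvecs (P : C -> Prop) (y : l2) : Prop := exists l, P l /\ disk l /\ y = eigvec l.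

Lemma eigvec_coord l k : disk l -> eigvec l k = Cp l k.
Proof. intros Hl. unfold eigvec. destruct (Rlt_dec _ _); [reflexivity | easy]. Qed.

Lemma delta_energy (n m : nat) : sum_n (fun k => Cmod (if Nat.eqb k n then 1 else 0) ^ 2) m <= 1.
Proof.
  destruct (le_lt_dec n m) as [H | H].
  - rewrite (sum_n_single _ n m H).
    + rewrite Nat.eqb_refl, Cmod_1. lra.
    + intros k Hk. apply Nat.eqb_neq in Hk. rewrite Hk, Cmod_0. simpl. apply Rmult_0_l.
  - rewrite (sum_n_ext_loc _ (fun _ => 0)).
    + rewrite sum_n_const. lra.
    + intros k Hk. assert (Hk' : k <> n) by lia. apply Nat.eqb_neq in Hk'.
      rewrite Hk', Cmod_0. simpl. apply Rmult_0_l.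
Qed.

Lemma basis_summable (n : nat) : ex_series (fun k => Cmod (if Nat.eqb k n then 1 else 0) ^ 2).
Proof. apply (nonneg_series_bounded _ 1); [intros; apply pow2_ge_0 | apply delta_energy]. Qed.

Definition basis (n : nat) : l2 := mk_l2 _ (basis_summable n).

Lemma basis_norm n : norm (basis n) = 1.
Proof.
  apply Rle_antisym.
  - apply l2_norm_le; [lra |]. intros m. rewrite pow1. apply delta_energy.
  - assert (H := l2_coord_le (basis n) n). simpl in H. rewrite Nat.eqb_refl, Cmod_1 in H. exact H.
Qed.

Lemma fshift_summable (x : l2) :
  ex_series (fun k => Cmod (match k with O => 0%C | S k => x k end) ^ 2).
Proof. apply (ex_series_incr_1 (V := R_NormedModule)). exact (l2_summable x). Qed.

(** The forward shift, that is, multiplication by the variable on coefficient sequences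
    of analytic functions. *)
Definition fshift (x : l2) : l2 := mk_l2 _ (fshift_summable x).


Lemma span_eq (S : l2 -> Prop) (x y : l2) : lin_span S x -> x = y -> lin_span S y.
Proof. now intros H <-. Qed.

Lemma span_plus (S : l2 -> Prop) (x y : l2) : lin_span S x -> lin_span S y -> lin_span S (x + y)%L.
Proof.
  intros Hx Hy. induction Hx as [| c u v Hu _ IH].
  - apply (span_eq S y _ Hy). l2_ext; ring.
  - apply (span_eq S _ _ (lin_span_add S c u _ Hu IH)). l2_ext; ring.
Qed.

Lemma span_scal (S : l2 -> Prop) (c : C) (x : l2) : lin_span S x -> lin_span S (c *: x)%L.
Proof.
  intros Hx. induction Hx as [| d u v Hu _ IH].
  - apply (span_eq S _ _ (lin_span_zero S)). l2_ext; ring.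
  - apply (span_eq S _ _ (lin_span_add S (c * d)%C u _ Hu IH)). l2_ext; ring.
Qed.

Lemma span_in (S : l2 -> Prop) (x : l2) : S x -> lin_span S x.
Proof.
  intros Hx. apply (span_eq S _ _ (lin_span_add S (RtoC 1) x _ Hx (lin_span_zero S))). l2_ext; ring.
Qed.

Lemma span_mono (S S' : l2 -> Prop) (x : l2) : (forall y, S y -> S' y) -> lin_span S x -> lin_span S' x.
Proof. intros H Hx. induction Hx; constructor; auto. Qed.

Definition in_closure (S : l2 -> Prop) (x : l2) : Prop :=
  forall e, 0 < e -> exists y : l2, lin_span S y /\ norm (y - x)%L < e.

Lemma closure_of_span (S : l2 -> Prop) (x : l2) : lin_span S x -> in_closure S x.
Proof.
  intros Hx e He. exists x. split; [exact Hx |].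
  replace (x - x)%L with (RtoC 0 *: x)%L by (l2_ext; ring).
  rewrite l2_norm_scal, Cmod_0. lra.
Qed.

Lemma closure_mono (S S' : l2 -> Prop) x : (forall y, S y -> S' y) -> in_closure S x -> in_closure S' x.
Proof.
  intros H Hx e He. destruct (Hx e He) as (y & Hy & Hd). exists y. split; [| exact Hd].
  now apply span_mono with (2 := Hy).
Qed.

Lemma closure_approx (S : l2 -> Prop) (x : l2) :
  (forall e, 0 < e -> exists y : l2, in_closure S y /\ norm (y - x)%L < e) -> in_closure S x.
Proof.
  intros H e He. destruct (H (e / 2) ltac:(lra)) as (y & Hy & Hyx).
  destruct (Hy (e / 2) ltac:(lra)) as (z & Hz & Hzy).
  exists z. split; [exact Hz |]. assert (Ht := l2_dist_triangle z y x). lra.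
Qed.

Lemma closure_scal (S : l2 -> Prop) (c : C) (x : l2) : in_closure S x -> in_closure S (c *: x)%L.
Proof.
  intros Hx e He. assert (Hc := Cmod_ge_0 c).
  destruct (Hx (e / (Cmod c + 1))) as (y & Hy & Hyx); [apply Rdiv_lt_0_compat; lra |].
  exists (c *: y)%L. split; [now apply span_scal |].
  replace (c *: y - c *: x)%L with (c *: (y - x))%L by (l2_ext; ring).
  rewrite l2_norm_scal. apply Rlt_div_r in Hyx; [| lra].
  assert (H0 : 0 <= norm (y - x)%L) by apply norm_ge_0. nra.
Qed.

Lemma closure_plus (S : l2 -> Prop) (x y : l2) : in_closure S x -> in_closure S y -> in_closure S (x + y)%L.
Proof.
  intros Hx Hy e He.
  destruct (Hx (e / 2) ltac:(lra)) as (x' & Hx' & Dx). destruct (Hy (e / 2) ltac:(lra)) as (y' & Hy' & Dy).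
  exists (x' + y')%L. split; [now apply span_plus |].
  replace (x' + y' - (x + y))%L with (x' - x + (y' - y))%L by (l2_ext; ring).
  assert (Ht := l2_triangle (x' - x)%L (y' - y)%L). lra.
Qed.

Lemma closure_span (S S' : l2 -> Prop) (x : l2) :
  (forall y : l2, S y -> in_closure S' y) -> lin_span S x -> in_closure S' x.
Proof.
  intros H Hx. induction Hx as [| c u v Hu _ IH].
  - apply closure_of_span. constructor.
  - apply closure_plus; [| exact IH]. apply closure_scal. now apply H.
Qed.

(** In terms of coefficient sequences, [w] is [u / (1 - l z)] for [u = w - l * fshift
    w], and the left-hand side is the norm of the Blaschke factor [(z - conj l) / (1 - l
    z)] times [u]. The squares differ termwise by a telescoping sum. *)
Lemma blaschke_norm (l : C) (w : l2) : Cmod l <= 1 ->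
  norm (fshift w - Cconj l *: w)%L <= norm (w - l *: fshift w)%L.
Proof.
  intros Hl. apply l2_norm_le; [apply norm_ge_0 |]. intros n.
  eapply Rle_trans; [| apply (l2_partial_le _ n)].
  assert (Key : forall a b : C, Cmod (a - Cconj l * b) ^ 2
     = Cmod (b - l * a) ^ 2 + (1 - Cmod l ^ 2) * (Cmod a ^ 2 - Cmod b ^ 2)).
  { intros a b. rewrite !Cmod2_alt. unfold Re, Im; destruct a, b, l; simpl. ring. }
  assert (H0 : 0 <= 1 - Cmod l ^ 2) by (assert (H := Cmod_ge_0 l); nra).
  assert (Hs : sum_n (fun k => Cmod ((fshift w - Cconj l *: w)%L k) ^ 2) n
     = sum_n (fun k => Cmod ((w - l *: fshift w)%L k) ^ 2) n - (1 - Cmod l ^ 2) * Cmod (w n) ^ 2).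
  { induction n as [| n IH].
    - rewrite !sum_O.
      change (Cmod (0 - Cconj l * w 0%nat) ^ 2 = Cmod (w 0%nat - l * 0) ^ 2 - (1 - Cmod l ^ 2) * Cmod (w 0%nat) ^ 2).
      rewrite Key, Cmod_0. ring.
    - rewrite !sum_Sn, IH.
      change (sum_n (fun k => Cmod ((w - l *: fshift w)%L k) ^ 2) n - (1 - Cmod l ^ 2) * Cmod (w n) ^ 2
        + Cmod (w n - Cconj l * w (S n)) ^ 2
        = sum_n (fun k => Cmod ((w - l *: fshift w)%L k) ^ 2) n + Cmod (w (S n) - l * w n) ^ 2
          - (1 - Cmod l ^ 2) * Cmod (w (S n)) ^ 2).
      rewrite Key. ring. }
  rewrite Hs. assert (0 <= (1 - Cmod l ^ 2) * Cmod (w n) ^ 2) by (apply Rmult_le_pos; [exact H0 | apply pow2_ge_0]).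
  lra.
Qed.

(** Let [b_i = (z - conj (lam i)) / (1 - lam i z)] and let [B] be the product of [b_0,
    ..., b_(m-1)]. Multiplication by [B] is a contraction, and by partial fractions it
    sends the basis vector [n] to [c] times itself, plus a combination of earlier basis
    vectors and of the eigenvectors for the [lam i], where [c] is the value of [B] at
    infinity. Since [|c| = prod (1 / |lam i|) >= rho ^ (- m)], the basis vector is
    within [rho ^ m] of that span, and induction on [n] puts it in the closed span of
    the eigenvectors. *)
Section BlaschkeDensity.

Variables (lam : nat -> C) (rho : R).
Hypothesis lam_inj : forall i j, lam i = lam j -> i = j.
Hypothesis lam_nz : forall i, lam i <> 0%C.
Hypothesis lam_le : forall i, Cmod (lam i) <= rho.
Hypothesis rho_lt : rho < 1.

Lemma lam_disk i : disk (lam i).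
Proof. unfold disk. specialize (lam_le i). lra. Qed.

Let Gen (n m : nat) (x : l2) : Prop :=
  (exists j, (j < n)%nat /\ x = basis j) \/ (exists i, (i < m)%nat /\ x = eigvec (lam i)).

Lemma span_Gen n m n' m' (v : l2) : (n <= n')%nat -> (m <= m')%nat ->
  lin_span (Gen n m) v -> lin_span (Gen n' m') v.
Proof.
  intros Hn Hm. apply span_mono.
  intros y [(j & Hj & ->) | (i & Hi & ->)]; [left; exists j | right; exists i]; split; (lia || reflexivity).
Qed.

(** The solution [w_j] of [w - lam m * fshift w = basis j] starts from the eigenvector
    itself, and [w_(j+1) = fshift w_j = (w_j - basis j) / lam m]; hence only basis
    vectors of index below [j] occur. *)
Lemma basis_resolvent m j : exists w, lin_span (Gen j (S m)) w /\
  basis j = (w - lam m *: fshift w)%L.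
Proof.
  assert (Hd := lam_disk m).
  induction j as [| j (w & Hw & E)].
  - exists (eigvec (lam m)). split; [apply span_in; right; exists m; split; [lia | reflexivity] |].
    apply l2_eq. intros [| k]; rewrite l2_minus_coord; simpl.
    + rewrite eigvec_coord by exact Hd. change (RtoC 1 = RtoC 1 - lam m * 0)%C. ring.
    + rewrite !eigvec_coord by exact Hd. change (RtoC 0 = lam m * Cp (lam m) k - lam m * Cp (lam m) k)%C. ring.
  - exists (fshift w). split.
    + replace (fshift w) with ((/ lam m)%C *: w + (- / lam m)%C *: basis j)%L.
      * apply span_plus; apply span_scal.
        -- apply span_Gen with (3 := Hw); lia.
        -- apply span_in. left. exists j. split; [lia | reflexivity].
      * rewrite E. apply l2_eq. intros k. assert (H := lam_nz m).
        change (/ lam m * w k + - / lam m * (w k - lam m * fshift w k) = fshift w k)%C. now field.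
    + apply l2_eq. intros [| k].
      * change (RtoC 0 = RtoC 0 - lam m * RtoC 0)%C. ring.
      * change (basis j k = w k - lam m * fshift w k)%C. rewrite E. reflexivity.
Qed.

(** The partial fraction decomposition of [1 / ((1 - lam m z) (1 - lam i z))], which
    needs [lam i <> lam m]. *)
Lemma eigvec_resolvent m i : (i < m)%nat -> forall n, exists w, lin_span (Gen n (S m)) w /\
  eigvec (lam i) = (w - lam m *: fshift w)%L.
Proof.
  intros Hi n.
  assert (Hne : (lam i - lam m)%C <> 0%C).
  { intros E. assert (lam i = lam m) by (apply Cmod_minus_eq_0; rewrite E; apply Cmod_0).
    assert (i = m) by now apply lam_inj. lia. }
  exists ((lam i / (lam i - lam m))%C *: eigvec (lam i) + (- lam m / (lam i - lam m))%C *: eigvec (lam m))%L.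
  split.
  - apply span_plus; apply span_scal, span_in; right; [exists i | exists m]; split; (lia || reflexivity).
  - apply l2_eq. intros [| k].
    + change (eigvec (lam i) 0%nat = lam i / (lam i - lam m) * eigvec (lam i) 0%nat
        + - lam m / (lam i - lam m) * eigvec (lam m) 0%nat
        - lam m * RtoC 0)%C.
      rewrite !eigvec_coord by apply lam_disk. change (Cp ?x 0) with (RtoC 1). now field.
    + change (eigvec (lam i) (S k) = lam i / (lam i - lam m) * eigvec (lam i) (S k)
        + - lam m / (lam i - lam m) * eigvec (lam m) (S k)
        - lam m * (lam i / (lam i - lam m) * eigvec (lam i) k + - lam m / (lam i - lam m) * eigvec (lam m) k))%C.
      rewrite !eigvec_coord by apply lam_disk.
      change (Cp (lam i) (S k)) with (lam i * Cp (lam i) k)%C. change (Cp (lam m) (S k)) with (lam m * Cp (lam m) k)%C.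
      now field.
Qed.

Lemma span_resolvent n m v : lin_span (Gen (S n) m) v -> exists w, lin_span (Gen n (S m)) w /\
  v = (w - lam m *: fshift w)%L.
Proof.
  intros Hv. induction Hv as [| c x y Hx _ (w2 & Hw2 & E2)].
  - exists l2_zero. split; [constructor |]. apply l2_eq. intros [| k];
    change (RtoC 0 = RtoC 0 - lam m * RtoC 0)%C; ring.
  - assert (H1 : exists w, lin_span (Gen n (S m)) w /\ x = (w - lam m *: fshift w)%L).
    { destruct Hx as [(j & Hj & ->) | (i & Hi & ->)]; [| now apply eigvec_resolvent].
      destruct (basis_resolvent m j) as (w & Hw & E). exists w. split; [| exact E].
      apply span_Gen with (3 := Hw); lia. }
    destruct H1 as (w1 & Hw1 & E1).
    exists (c *: w1 + w2)%L. split; [apply span_plus; [now apply span_scal | exact Hw2] |].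
    rewrite E1, E2. apply l2_eq. intros [| k].
    + change (c * (w1 0%nat - lam m * RtoC 0) + (w2 0%nat - lam m * RtoC 0) = c * w1 0%nat + w2 0%nat - lam m * RtoC 0)%C. ring.
    + change (c * (w1 (S k) - lam m * w1 k) + (w2 (S k) - lam m * w2 k) = c * w1 (S k) + w2 (S k) - lam m * (c * w1 k + w2 k))%C. ring.
Qed.

Lemma blaschke_growth n m : exists (c : C) (s : l2), lin_span (Gen n m) s /\
  norm (c *: basis n + s)%L <= 1 /\ 1 <= Cmod c * rho ^ m.
Proof.
  induction m as [| m (c & s & Hs & Hu & Hc)].
  - exists 1%C, l2_zero. split; [constructor | split].
    + replace (RtoC 1 *: basis n + l2_zero)%L with (basis n) by (l2_ext; ring).
      rewrite basis_norm. lra.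
    + rewrite Cmod_1. simpl. lra.
  - set (u := (c *: basis n + s)%L) in *. set (l := lam m).
    assert (Hl0 : l <> 0%C) by apply lam_nz.
    destruct (span_resolvent n m u) as (w & Hw & E).
    { apply span_plus.
      - apply span_scal, span_in. left. exists n. split; [lia | reflexivity].
      - apply span_Gen with (3 := Hs); lia. }
    exists (- c / l)%C, ((/ l - Cconj l)%C *: w + (- / l)%C *: s)%L.
    split; [| split].
    + apply span_plus; apply span_scal; [exact Hw |].
      apply span_Gen with (3 := Hs); lia.
    + eapply Rle_trans; [| exact Hu]. rewrite E.
      eapply Rle_trans; [| apply blaschke_norm; apply Rlt_le, lam_disk]. fold l. apply Req_le. f_equal.
      apply l2_eq. intros k.
      assert (Ek : u k = (w k - l * fshift w k)%C) by (rewrite E; reflexivity).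
      change (c * basis n k + s k = w k - l * fshift w k)%C in Ek.
      change (- c / l * basis n k + ((/ l - Cconj l) * w k + - / l * s k) = fshift w k - Cconj l * w k)%C.
      replace (- c / l * basis n k + ((/ l - Cconj l) * w k + - / l * s k))%C
        with (- / l * (c * basis n k + s k) + (/ l - Cconj l) * w k)%C by (now field).
      rewrite Ek. now field.
    + unfold Cdiv. rewrite Cmod_mult, Cmod_opp, Cmod_inv by exact Hl0.
      assert (Hp : 0 < Cmod l) by now apply Cmod_gt_0.
      assert (Hle : Cmod l <= rho) by apply lam_le.
      assert (Hcp : 0 <= Cmod c * rho ^ m) by lra.
      simpl. replace (Cmod c * / Cmod l * (rho * rho ^ m)) with ((Cmod c * rho ^ m) * (rho * / Cmod l)) by ring.
      assert (1 <= rho * / Cmod l) by (apply Rle_div_r; lra). nra.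
Qed.

Let S0 (x : l2) : Prop := exists i, x = eigvec (lam i).

Lemma basis_in_closure n : in_closure S0 (basis n).
Proof.
  induction n as [n IH] using lt_wf_ind.
  apply closure_approx. intros e He.
  assert (Hrho : 0 <= rho) by (eapply Rle_trans; [apply Cmod_ge_0 | apply (lam_le 0%nat)]).
  destruct (geom_eventually_small 1 rho e (conj Hrho rho_lt) He) as [m Hm].
  specialize (Hm m (le_n m)).
  destruct (blaschke_growth n m) as (c & s & Hs & Hu & Hc).
  assert (Hc0 : 0 < Cmod c).
  { assert (H1 := Cmod_ge_0 c). destruct (Req_dec (Cmod c) 0) as [E | E]; [rewrite E in Hc; lra | lra]. }
  assert (Hc1 : c <> 0%C) by now apply Cmod_gt_0.
  exists ((- / c)%C *: s)%L. split.
  - apply closure_scal. apply closure_span with (2 := Hs). intros y [(j & Hj & ->) | (i & _ & ->)].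
    + now apply IH.
    + apply closure_of_span, span_in. now exists i.
  - replace ((- / c)%C *: s - basis n)%L with ((- / c)%C *: (c *: basis n + s))%L.
    { rewrite l2_norm_scal, Cmod_opp, Cmod_inv by exact Hc1.
      apply Rle_lt_trans with (rho ^ m); [| lra].
      set (u := norm _) in *. assert (Hu0 : 0 <= u) by apply norm_ge_0.
      rewrite Rmult_comm. apply Rle_div_l; [exact Hc0 |]. rewrite Rmult_comm. lra. }
    apply l2_eq. intros k. change (- / c * (c * basis n k + s k) = - / c * s k - basis n k)%C. now field.
Qed.

End BlaschkeDensity.

Fixpoint trunc (x : l2) (n : nat) : l2 :=
  match n with O => l2_zero | S n => (trunc x n + x n *: basis n)%L end.

Lemma trunc_coord x n k : trunc x n k = if lt_dec k n then x k else RtoC 0.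
Proof.
  induction n as [| n IH].
  { destruct (lt_dec k 0); [lia | reflexivity]. }
  cbn [trunc]. change (trunc x n k + x n * (if Nat.eqb k n then 1 else 0) = if lt_dec k (S n) then x k else 0)%C.
  rewrite IH. destruct (Nat.eqb_spec k n) as [E | H], (lt_dec k n), (lt_dec k (S n));
    try lia; try ring. rewrite E; ring.
Qed.

Lemma trunc_approx (x : l2) e : 0 < e -> exists n, norm (trunc x n - x)%L < e.
Proof.
  intros He.
  assert (Hs := Series_correct _ (l2_summable x)). fold (l2_q x) in Hs.
  assert (He2 : 0 < (e / 2) ^ 2) by nra.
  destruct (proj1 (filterlim_locally _ _) Hs (mkposreal _ He2)) as [N HN].
  exists (S N). apply Rle_lt_trans with (e / 2); [| lra].
  apply l2_norm_le; [lra |]. intros n.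
  assert (HN1 := HN N (le_n N)).
  change (Rabs (sum_n (fun k => Cmod (x k) ^ 2) N - l2_q x) < (e / 2) ^ 2) in HN1.
  assert (HN2 := l2_partial_le x (n + N)). rewrite l2_norm_sq in HN2.
  apply Rabs_def2 in HN1.
  assert (Hsum : sum_n (fun k => Cmod ((trunc x (S N) - x)%L k) ^ 2) n
     <= sum_n (fun k => Cmod (x k) ^ 2) (n + N) - sum_n (fun k => Cmod (x k) ^ 2) N).
  { assert (Hz : forall k, (k <= N)%nat -> Cmod ((trunc x (S N) - x)%L k) ^ 2 = 0).
    { intros k Hk. rewrite l2_minus_coord, trunc_coord. destruct (lt_dec _ _); [| lia].
      replace (x k - x k)%C with (RtoC 0) by ring. rewrite Cmod_0. ring. }
    assert (Ht : forall k, (N < k)%nat -> Cmod ((trunc x (S N) - x)%L k) ^ 2 = Cmod (x k) ^ 2).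
    { intros k Hk. rewrite l2_minus_coord, trunc_coord. destruct (lt_dec _ _); [lia |].
      replace (0 - x k)%C with (- x k)%C by ring. now rewrite Cmod_opp. }
    assert (Hgen : forall m, sum_n (fun k => Cmod ((trunc x (S N) - x)%L k) ^ 2) (m + N)
      = sum_n (fun k => Cmod (x k) ^ 2) (m + N) - sum_n (fun k => Cmod (x k) ^ 2) N).
    { intros m. induction m as [| m IH].
      - simpl. rewrite (sum_n_ext_loc _ (fun _ => 0)) by exact Hz. rewrite sum_n_const. ring.
      - cbn [Nat.add]. rewrite !sum_Sn, IH, Ht by lia.
        set (p := sum_n _ (m + N)). set (q := sum_n _ N). set (c := Cmod _ ^ 2).
        change (@eq R (p - q + c) (p + c - q)). ring. }
    rewrite <- Hgen. apply sum_n_le_sum_n; [intros; apply pow2_ge_0 | lia]. }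
  lra.
Qed.

Lemma basis_in_closure_total S : (forall n, in_closure S (basis n)) -> forall x, in_closure S x.
Proof.
  intros H x. apply closure_approx. intros e He. destruct (trunc_approx x e He) as [n Hn].
  exists (trunc x n). split; [| exact Hn]. clear Hn. induction n as [| n IH]; cbn [trunc].
  - apply closure_of_span. constructor.
  - apply closure_plus; [exact IH | now apply closure_scal].
Qed.

(** At most one of the points is 0; the sequence starts after it, since the argument
    divides by [lam i]. *)
Theorem eigvecs_total (P : C -> Prop) (lam : nat -> C) (rho : R) :
  (forall i j, lam i = lam j -> i = j) -> (forall i, Cmod (lam i) <= rho) -> rho < 1 ->
  (forall i, P (lam i)) -> forall x, in_closure (eigvecs P) x.
Proof.
  intros Hinj Hle Hrho HP.
  assert (HN : exists N, forall i, lam (N + i)%nat <> 0%C).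
  { destruct (excluded_middle_informative (exists i, lam i = 0%C)) as [[i Hi] | H].
    - exists (S i). intros j E. rewrite <- Hi in E. apply Hinj in E. lia.
    - exists 0%nat. intros i E. apply H. now exists i. }
  destruct HN as [N HN]. apply basis_in_closure_total. intros n.
  assert (Hb := basis_in_closure (fun i => lam (N + i)%nat) rho).
  intros e He. destruct (Hb) with (n := n) (e := e) as (y & Hy & Hd); auto.
  - intros i j E. apply Hinj in E. lia.
  - exists y. split; [| exact Hd]. apply span_mono with (2 := Hy). intros z [i ->].
    exists (lam (N + i)%nat). repeat split; auto. unfold disk. specialize (Hle (N + i)%nat). lra.
Qed.

(** * The functional calculus of the backward shift *)

Notation shiftn k := (Nat.iter k backward_shift).

Lemma iter_shift_coord (x : l2) k j : shiftn k x j = x (j + k)%nat.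
Proof.
  revert j. induction k as [| k IH]; intros j; [simpl; f_equal; lia |].
  change (shiftn k x (S j) = x (j + S k)%nat). rewrite IH. f_equal. lia.
Qed.

Lemma iter_shift_norm (x : l2) k : norm (shiftn k x) <= norm x.
Proof.
  induction k as [| k IH]; [apply Rle_refl |].
  eapply Rle_trans; [| exact IH]. set (y := shiftn k x).
  change (norm (backward_shift y) <= norm y).
  apply l2_norm_le; [apply norm_ge_0 |]. intros n.
  eapply Rle_trans; [| apply (l2_partial_le y (S n))].
  assert (E : sum_n (fun k => Cmod (y k) ^ 2) (S n)
    = Cmod (y 0%nat) ^ 2 + sum_n (fun k => Cmod (backward_shift y k) ^ 2) n).
  { unfold sum_n. rewrite sum_Sn_m by lia. rewrite <- (sum_n_m_S (fun k => Cmod (y k) ^ 2)). reflexivity. }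
  rewrite E. assert (H := pow2_ge_0 (Cmod (y 0%nat))). lra.
Qed.

Lemma iter_shift_eigvec (l : C) k : disk l -> shiftn k (eigvec l) = (Cp l k *: eigvec l)%L.
Proof.
  intros Hl. apply l2_eq. intros j. rewrite iter_shift_coord.
  change (eigvec l (j + k)%nat = Cp l k * eigvec l j)%C. rewrite !eigvec_coord by exact Hl.
  induction k as [| k IH].
  - rewrite Nat.add_0_r. symmetry. exact (Cmult_1_l (Cp l j)).
  - rewrite Nat.add_succ_r.
    change (@eq C (l * Cp l (j + k)) (l * Cp l k * Cp l j))%C. rewrite IH. apply Cmult_assoc.
Qed.

Lemma iter_shift_plus (x y : l2) k : shiftn k (x + y)%L
  = (shiftn k x + shiftn k y)%L.
Proof. apply l2_eq. intros j. change (shiftn k (x + y)%L j = shiftn k x j + shiftn k y j)%C.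
  now rewrite !iter_shift_coord. Qed.

Lemma iter_shift_scal (c : C) (x : l2) k : shiftn k (c *: x)%L
  = (c *: shiftn k x)%L.
Proof. apply l2_eq. intros j. change (shiftn k (c *: x)%L j = c * shiftn k x j)%C.
  now rewrite !iter_shift_coord. Qed.

Lemma filterlim_l2_coord {T : Type} {F : (T -> Prop) -> Prop} {FF : Filter F} (f : T -> l2) (y : l2) j :
  filterlim f F (locally y) -> filterlim (fun t => Cmod (f t j)) F (locally (Cmod (y j))).
Proof.
  intros H. apply filterlim_locally. intros eps.
  assert (H1 := proj1 (filterlim_locally (F := F) f y) H eps).
  apply filter_imp with (2 := H1). intros t Ht.
  assert (Ht' : norm (f t - y)%L < eps) by exact Ht.
  change (Rabs (Cmod (f t j) - Cmod (y j)) < eps).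
  assert (Hc := l2_coord_le (f t - y)%L j). rewrite l2_minus_coord in Hc.
  apply Rle_lt_trans with (Cmod (f t j - y j)); [| lra].
  assert (A1 := Cmod_triangle (f t j - y j) (y j)). assert (A2 := Cmod_triangle (- (f t j - y j)) (f t j)).
  rewrite Cmod_opp in A2.
  replace (f t j - y j + y j)%C with (f t j) in A1 by ring.
  replace (- (f t j - y j) + f t j)%C with (y j) in A2 by ring.
  apply Rabs_le. lra.
Qed.

Lemma filterlim_scal_vec {T : Type} {F : (T -> Prop) -> Prop} {FF : Filter F} (g : T -> C) (c : C) (v : l2) :
  filterlim g F (locally c) -> filterlim (fun t => (g t *: v)%L) F (locally (c *: v)%L).
Proof.
  intros H. apply filterlim_locally. intros eps. assert (He := cond_pos eps).
  set (nf := @norm_factor C_AbsRing C_NormedModule).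
  assert (Hnf : 0 < nf) by apply norm_factor_gt_0.
  assert (Hv : 0 <= norm v) by apply norm_ge_0.
  assert (Hd : 0 < eps / (norm v + 1) / nf) by (repeat apply Rdiv_lt_0_compat; lra).
  assert (H1 := proj1 (filterlim_locally (F := F) g c) H (mkposreal _ Hd)).
  apply filter_imp with (2 := H1). intros t Ht.
  apply (norm_compat2 (K := C_AbsRing) (V := C_NormedModule)) in Ht. fold nf in Ht. simpl in Ht.
  replace (nf * (eps / (norm v + 1) / nf)) with (eps / (norm v + 1)) in Ht by (field; lra).
  assert (Ht' : Cmod (g t - c) < eps / (norm v + 1)) by exact Ht.
  apply l2_ball. replace (g t *: v - c *: v)%L with ((g t - c)%C *: v)%L by (l2_ext; ring).
  rewrite l2_norm_scal. apply Rlt_div_r in Ht'; [| lra]. assert (H0 := Cmod_ge_0 (g t - c)). nra.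
Qed.

Section Calculus.

Variables (f : C -> C) (a : nat -> C) (M : R).
Hypothesis Hf : analytic_on_disk f.
Hypothesis HM : forall z, disk z -> Cmod (f z) <= M.
Hypothesis Ha : forall z, disk z -> is_pseries a z (f z).

Lemma sup_bound_nonneg : 0 <= M.
Proof.
  eapply Rle_trans; [apply Cmod_ge_0 | apply (HM (RtoC 0))]. unfold disk. rewrite Cmod_0. lra.
Qed.

Let term (r : R) (x : l2) (k : nat) : l2 := ((a k * RtoC (r ^ k))%C *: shiftn k x)%L.

(** The operator [f(r T)], through its power series. *)
Definition damped (r : R) (x : l2) : l2 :=
  epsilon (inhabits l2_zero) (fun y => is_series (V := l2_NormedModule) (term r x) y).

Lemma damped_spec r x : 0 < r < 1 -> is_series (V := l2_NormedModule) (term r x) (damped r x).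
Proof.
  intros Hr. apply (epsilon_spec (inhabits l2_zero) (fun y => is_series (V := l2_NormedModule) (term r x) y)).
  set (r1 := (1 + r) / 2). assert (Hr1 : r < r1 < 1) by (unfold r1; lra).
  destruct (pseries_coef_bound a (RtoC r1) (f (RtoC r1))) as (B & HB0 & HB).
  { apply Ha. unfold disk. rewrite Cmod_R, Rabs_pos_eq; lra. }
  rewrite Cmod_R, Rabs_pos_eq in HB by lra.
  assert (Hq : 0 <= r / r1 < 1) by (split; [apply Rdiv_le_0_compat | apply Rlt_div_l]; lra).
  apply (ex_series_le (V := l2_CompleteNormedModule) (term r x) (fun k => B * norm x * (r / r1) ^ k)).
  - intros k. change (norm (term r x k) <= B * norm x * (r / r1) ^ k). unfold term.
    rewrite l2_norm_scal, Cmod_mult, Cmod_R, Rabs_pos_eq by (apply pow_le; lra).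
    assert (E : r ^ k = r1 ^ k * (r / r1) ^ k).
    { rewrite <- Rpow_mult_distr. f_equal. field. lra. }
    rewrite E.
    assert (H0 := HB k). assert (Hn := iter_shift_norm x k).
    assert (Hn0 : 0 <= norm (shiftn k x)) by apply norm_ge_0.
    assert (Hp : 0 <= (r / r1) ^ k) by (apply pow_le; lra).
    assert (Hc0 : 0 <= Cmod (a k) * r1 ^ k) by (apply Rmult_le_pos; [apply Cmod_ge_0 | apply pow_le; lra]).
    replace (Cmod (a k) * (r1 ^ k * (r / r1) ^ k) * norm (shiftn k x))
      with ((Cmod (a k) * r1 ^ k) * norm (shiftn k x) * (r / r1) ^ k) by ring.
    apply Rmult_le_compat_r; [exact Hp |]. now apply Rmult_le_compat.
  - now apply ex_series_geom_bound.
Qed.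

Lemma damped_unique r x y : 0 < r < 1 -> is_series (V := l2_NormedModule) (term r x) y -> y = damped r x.
Proof.
  intros Hr H. exact (filterlim_locally_unique (V := l2_NormedModule) _ _ _ H (damped_spec r x Hr)).
Qed.

(** The estimate for finite Toeplitz matrices passes to the limit: on the first
    coordinates the truncated matrix of size [N] converges to [f(r T) x] as [N] grows. *)
Lemma damped_norm r x : 0 < r < 1 -> norm (damped r x) <= M * norm x.
Proof.
  intros Hr. set (y := damped r x).
  assert (HM0 := sup_bound_nonneg). assert (Hx0 : 0 <= norm x) by apply norm_ge_0.
  apply l2_norm_le; [now apply Rmult_le_pos |]. intros n.
  set (v := fun N j => sum_n (fun k => a k * RtoC (r ^ k) * x (j + k)%nat)%C (N - j)).
  assert (Hlim : forall m, is_lim_seq (fun N => sum_n (fun j => Cmod (v N j) ^ 2) m) (sum_n (fun j => Cmod (y j) ^ 2) m)).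
  { assert (Hj : forall j, is_lim_seq (fun N => Cmod (v N j) ^ 2) (Cmod (y j) ^ 2)).
    { intros j.
      assert (H1 : is_lim_seq (fun N => Cmod (v N j)) (Cmod (y j))).
      { apply (is_lim_seq_incr_n _ j).
        apply (is_lim_seq_ext (fun N => Cmod (sum_n (term r x) N j))).
        - intros N. unfold v. replace (N + j - j)%nat with N by lia. f_equal.
          rewrite l2_sum_coord. apply sum_n_ext. intros k.
          change (a k * RtoC (r ^ k) * shiftn k x j = a k * RtoC (r ^ k) * x (j + k)%nat)%C.
          now rewrite iter_shift_coord.
        - apply (filterlim_l2_coord (sum_n (term r x)) y j). exact (damped_spec r x Hr). }
      simpl. apply is_lim_seq_mult'; [exact H1 |].
      apply is_lim_seq_mult'; [exact H1 | apply is_lim_seq_const]. }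
    intros m. induction m as [| m IH].
    - rewrite sum_O. apply (is_lim_seq_ext (fun N => Cmod (v N 0%nat) ^ 2)); [intros; now rewrite sum_O | apply Hj].
    - rewrite sum_Sn.
      apply (is_lim_seq_ext (fun N => sum_n (fun j => Cmod (v N j) ^ 2) m + Cmod (v N (S m)) ^ 2));
        [intros; now rewrite sum_Sn |].
      apply is_lim_seq_plus'; [exact IH | apply Hj]. }
  apply (is_lim_seq_le_loc (fun N => sum_n (fun j => Cmod (v N j) ^ 2) n) (fun _ => (M * norm x) ^ 2)
    (sum_n (fun j => Cmod (y j) ^ 2) n) ((M * norm x) ^ 2)); [| apply Hlim | apply is_lim_seq_const].
  exists n. intros N HN.
  apply Rle_trans with (sum_n (fun j => Cmod (v N j) ^ 2) N).
  - apply sum_n_le_sum_n; [intros; apply pow2_ge_0 | exact HN].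
  - eapply Rle_trans; [apply (toeplitz_bound a f M r x N Hf Ha HM Hr) |].
    rewrite Rpow_mult_distr. apply Rmult_le_compat_l; [apply pow2_ge_0 | apply l2_partial_le].
Qed.

Lemma damped_plus r (x y : l2) : 0 < r < 1 -> damped r (x + y)%L = (damped r x + damped r y)%L.
Proof.
  intros Hr. symmetry. apply damped_unique; [exact Hr |].
  assert (H := is_series_plus (V := l2_NormedModule) _ _ _ _ (damped_spec r x Hr) (damped_spec r y Hr)).
  refine (is_series_ext (V := l2_NormedModule) _ _ _ _ H). intros k. unfold term. rewrite iter_shift_plus.
  change (((a k * RtoC (r ^ k))%C *: shiftn k x + (a k * RtoC (r ^ k))%C *: shiftn k y)%L =
   ((a k * RtoC (r ^ k))%C *: (shiftn k x + shiftn k y))%L).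
  symmetry. apply l2_scal_distr_l.
Qed.

Lemma damped_scal r (c : C) (x : l2) : 0 < r < 1 -> damped r (c *: x)%L = (c *: damped r x)%L.
Proof.
  intros Hr. symmetry. apply damped_unique; [exact Hr |].
  assert (H := is_series_scal (V := l2_NormedModule) c _ _ (damped_spec r x Hr)).
  refine (is_series_ext (V := l2_NormedModule) _ _ _ _ H). intros k. unfold term. rewrite iter_shift_scal.
  change ((c *: ((a k * RtoC (r ^ k))%C *: shiftn k x))%L =
    ((a k * RtoC (r ^ k))%C *: (c *: shiftn k x))%L).
  rewrite !l2_scal_assoc. f_equal. apply Cmult_comm.
Qed.

Lemma sum_n_scal_l2 (c : nat -> C) (v : l2) n : sum_n (fun k => (c k *: v)%L) n = (sum_n c n *: v)%L.
Proof.
  induction n as [| n IH]; [now rewrite !sum_O |]. rewrite !sum_Sn, IH.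
  change ((sum_n c n *: v + c (S n) *: v)%L = ((sum_n c n + c (S n))%C *: v)%L).
  symmetry. apply l2_scal_distr_r.
Qed.

Lemma disk_scal r l : 0 < r < 1 -> disk l -> disk (RtoC r * l)%C.
Proof.
  unfold disk. intros Hr Hl. rewrite Cmod_mult, Cmod_R, Rabs_pos_eq by lra.
  assert (H := Cmod_ge_0 l). nra.
Qed.

Lemma damped_eigvec r l : 0 < r < 1 -> disk l -> damped r (eigvec l) = (f (RtoC r * l)%C *: eigvec l)%L.
Proof.
  intros Hr Hl. symmetry. apply damped_unique; [exact Hr |].
  assert (H := Ha _ (disk_scal r l Hr Hl)).
  assert (H1 : filterlim (fun n => (sum_n (fun k => scal (Cp (RtoC r * l)%C k) (a k)) n *: eigvec l)%L) eventually
     (locally (f (RtoC r * l)%C *: eigvec l)%L)).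
  { apply filterlim_scal_vec. exact H. }
  refine (filterlim_ext _ _ _ H1). intros n.
  rewrite <- sum_n_scal_l2. apply sum_n_ext. intros k. unfold term.
  rewrite iter_shift_eigvec, l2_scal_assoc by exact Hl. f_equal.
  assert (E : Cp (RtoC r * l)%C k = (RtoC (r ^ k) * Cp l k)%C).
  { clear. induction k as [| k IH]; [symmetry; apply Cmult_1_l |].
    change (@eq C (RtoC r * l * Cp (RtoC r * l) k) (RtoC (r * r ^ k) * (l * Cp l k)))%C.
    rewrite IH, RtoC_mult. ring. }
  rewrite E. change (@eq C (RtoC (r ^ k) * Cp l k * a k) (a k * RtoC (r ^ k) * Cp l k))%C. ring.
Qed.

Lemma at_left_1_unit : at_left 1 (fun r => 0 < r < 1).
Proof.
  exists (mkposreal 1 Rlt_0_1). intros r Hb Hr. change (Rabs (r - 1) < 1) in Hb.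
  apply Rabs_def2 in Hb. lra.
Qed.

(** On an eigenvector the limit is that of [f (r l)], by continuity of [f] inside the
    disk. *)
Lemma damped_eigvec_lim l : disk l ->
  filterlim (fun r => damped r (eigvec l)) (at_left 1) (locally (f l *: eigvec l)%L).
Proof.
  intros Hl.
  apply (filterlim_ext_loc (F := at_left 1) (fun r => (f (RtoC r * l)%C *: eigvec l)%L)).
  { apply filter_imp with (2 := at_left_1_unit). intros r Hr. symmetry. now apply damped_eigvec. }
  apply filterlim_scal_vec.
  apply (filterlim_comp _ _ _ (fun r => (RtoC r * l)%C) f _ (locally l)).
  2: { exact (analytic_continuous f l Hf Hl). }
  assert (Hc : Ccont (fun r => RtoC r * l)%C).
  { apply (Ccont_mult RtoC); [| apply Ccont_const].
    intros t; split; smooth. }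
  assert (Hc1 := Ccont_at_continuous _ 1 (Hc 1)). unfold continuous in Hc1.
  replace (RtoC 1 * l)%C with l in Hc1 by ring.
  intros P HP. specialize (Hc1 P HP). unfold filtermap in *.
  unfold at_left, within. apply filter_imp with (2 := Hc1). auto.
Qed.

(** The operators [f(r T)] are uniformly bounded and converge on the span of the
    eigenvectors, which is dense; hence they form a Cauchy family at every vector. *)
Lemma damped_lim_exists x : exists y, filterlim (fun r => damped r x) (at_left 1) (locally (y : l2)).
Proof.
  assert (HM0 := sup_bound_nonneg).
  assert (Hspan : forall w : l2, lin_span (eigvecs (fun _ => True)) w ->
     exists y : l2, filterlim (fun r => damped r w) (at_left 1) (locally y)).
  { intros w Hw. induction Hw as [| c u v (l & _ & Hl & ->) _ (y & Hy)].
    - exists l2_zero. apply (filterlim_ext_loc (F := at_left 1) (fun _ => l2_zero)); [| apply filterlim_const].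
      apply filter_imp with (2 := at_left_1_unit). intros r Hr.
      assert (E : damped r (RtoC 0 *: l2_zero)%L = (RtoC 0 *: damped r l2_zero)%L) by now apply damped_scal.
      replace (RtoC 0 *: l2_zero)%L with l2_zero in E by (l2_ext; ring).
      change (l2_zero = damped r l2_zero). rewrite E. l2_ext; ring.
    - exists (c *: (f l *: eigvec l) + y)%L.
      apply (filterlim_ext_loc (F := at_left 1) (fun r => (c *: damped r (eigvec l) + damped r v)%L)).
      { apply filter_imp with (2 := at_left_1_unit). intros r Hr.
        change ((c *: damped r (eigvec l) + damped r v)%L = damped r (c *: eigvec l + v)%L).
        now rewrite damped_plus, damped_scal. }
      refine (filterlim_comp_2 _ _ l2_plus _ Hy _).
      2: { exact (filterlim_plus (V := l2_NormedModule) (c *: (f l *: eigvec l))%L y). }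
      apply (filterlim_comp _ _ _ (fun r => damped r (eigvec l)) (l2_scal c) _ (locally (f l *: eigvec l)%L)).
      + now apply damped_eigvec_lim.
      + exact (filterlim_scal_r (K := C_AbsRing) (V := l2_NormedModule) c _). }
  apply (proj1 (filterlim_locally_cauchy (U := l2_CompleteSpace) (F := at_left 1) (fun r => damped r x))).
  intros eps. assert (He := cond_pos eps).
  assert (Hdens : in_closure (eigvecs (fun _ => True)) x).
  { apply (eigvecs_total (fun _ => True) (fun i => RtoC (/ (INR i + 2))) (/ 2)).
    - intros i j E. injection E. intros E'. apply Rinv_eq_reg in E'. apply INR_eq. lra.
    - intros i. assert (H := pos_INR i). rewrite Cmod_R, Rabs_pos_eq.
      + apply Rinv_le_contravar; lra.
      + left. apply Rinv_0_lt_compat. lra.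
    - lra.
    - easy. }
  destruct (Hdens (eps / (4 * (M + 1)))) as (w & Hw & Hwx); [apply Rdiv_lt_0_compat; lra |].
  destruct (Hspan w Hw) as [w' Hw'].
  assert (He4 : 0 < eps / 4) by lra.
  assert (H4 := proj1 (filterlim_locally _ _) Hw' (mkposreal _ He4)).
  exists (fun r => 0 < r < 1 /\ norm (damped r w - w')%L < eps / 4).
  split.
  { apply filter_imp with (2 := filter_and _ _ at_left_1_unit H4). intros r [H1 H2]. split; [exact H1 | exact H2]. }
  assert (Hone : forall r, 0 < r < 1 -> norm (damped r w - damped r x)%L <= eps / 4).
  { intros r Hr.
    assert (E : (damped r w - damped r x)%L = damped r (w + RtoC (-1) *: x)%L).
    { rewrite damped_plus, damped_scal by exact Hr. l2_ext; ring. }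
    rewrite E. eapply Rle_trans; [now apply damped_norm |].
    replace (w + RtoC (-1) *: x)%L with (w - x)%L by (l2_ext; ring).
    apply Rlt_div_r in Hwx; [| lra]. assert (H0 : 0 <= norm (w - x)%L) by apply norm_ge_0. nra. }
  intros u v [Hu Hu'] [Hv Hv']. apply l2_ball.
  assert (D1 := l2_dist_triangle (damped v x) (damped v w) (damped u x)).
  assert (D2 := l2_dist_triangle (damped v w) w' (damped u x)).
  assert (D3 := l2_dist_triangle w' (damped u w) (damped u x)).
  assert (S1 := l2_dist_sym (damped v x) (damped v w)).
  assert (S2 := l2_dist_sym w' (damped u w)).
  assert (O1 := Hone u Hu). assert (O2 := Hone v Hv). lra.
Qed.

End Calculus.

(** All that the dynamics uses of the operator [f(T)]. *)
Record eigen_operator (f : C -> C) (A : l2 -> l2) : Prop := {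
  op_plus : forall x y, A (x + y)%L = (A x + A y)%L;
  op_scal : forall c x, A (c *: x)%L = (c *: A x)%L;
  op_bounded : exists M, 1 <= M /\ forall x, norm (A x) <= M * norm x;
  op_eigvec : forall l, disk l -> A (eigvec l) = (f l *: eigvec l)%L
}.

(** The Taylor coefficients are unique, so the data chosen in the definition of the
    functional calculus agree with [damped]. *)
Lemma calc_lim f a M : analytic_on_disk f -> (forall z, disk z -> Cmod (f z) <= M) ->
  (forall z, disk z -> is_pseries a z (f z)) ->
  forall x, filterlim (fun r => damped a r x) (at_left 1) (locally (Hinf_calc f backward_shift x)).
Proof.
  intros Hf HM Ha x.
  destruct (damped_lim_exists f a M Hf HM Ha x) as [y Hy].
  assert (Hex : exists y, is_Hinf_calc (V := l2_NormedModule) f backward_shift x y).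
  { exists y, a, (fun r => damped a r x). split; [exact Ha | split; [| exact Hy]].
    intros r Hr. exact (damped_spec f a Ha r x Hr). }
  assert (H := epsilon_spec (inhabits (@zero l2_NormedModule)) _ Hex).
  change (epsilon (inhabits (@zero l2_NormedModule)) (is_Hinf_calc (V := l2_NormedModule) f backward_shift x))
    with (Hinf_calc (V := l2_NormedModule) f backward_shift x) in H.
  destruct H as (b & s & Hb & Hs & Hlim).
  assert (Eab : forall k, b k = a k).
  { apply (pseries_unique b a f (/ 2) Hf ltac:(lra)); intros z Hz; [apply Hb | apply Ha]; unfold disk; lra. }
  refine (filterlim_ext_loc (F := at_left 1) s _ _ Hlim).
  apply filter_imp with (2 := at_left_1_unit). intros r Hr.
  apply (damped_unique f a Ha); [exact Hr |].
  refine (is_series_ext (V := l2_NormedModule) _ _ _ _ (Hs r Hr)). intros k. now rewrite Eab.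
Qed.

Lemma calc_eigen_operator f M : analytic_on_disk f -> (forall z, disk z -> Cmod (f z) <= M) ->
  eigen_operator f (Hinf_calc f backward_shift) /\
  forall x : l2, norm (Hinf_calc f backward_shift x) <= M * norm x.
Proof.
  intros Hf HM.
  destruct (taylor_disk f (conj Hf (ex_intro _ M HM))) as [a Ha].
  assert (HM0 := sup_bound_nonneg f M HM).
  assert (L := calc_lim f a M Hf HM Ha).
  assert (Hb : forall x : l2, norm (Hinf_calc f backward_shift x) <= M * norm x).
  { intros x.
    assert (H1 : filterlim (fun r => norm (damped a r x)) (at_left 1) (locally (norm (Hinf_calc f backward_shift x)))).
    { apply (filterlim_comp _ _ _ (fun r => damped a r x) norm _ _ _ (L x)).
      exact (filterlim_norm (V := l2_NormedModule) _). }
    refine (filterlim_le (F := at_left 1) _ (fun _ => M * norm x) (norm (Hinf_calc f backward_shift x)) (M * norm x) _ H1 _).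
    - apply filter_imp with (2 := at_left_1_unit). intros r Hr. exact (damped_norm f a M Hf HM Ha r x Hr).
    - apply (filterlim_const (M * norm x)). }
  split; [| exact Hb].
  split.
  - intros x y.
    apply (filterlim_locally_unique (V := l2_NormedModule) (F := at_left 1) (fun r => damped a r (x + y)%L)); [apply L |].
    apply (filterlim_ext_loc (F := at_left 1) (fun r => (damped a r x + damped a r y)%L)).
    { apply filter_imp with (2 := at_left_1_unit). intros r Hr. symmetry. now apply (damped_plus f a Ha). }
    refine (filterlim_comp_2 _ _ l2_plus (L x) (L y) _).
    exact (filterlim_plus (V := l2_NormedModule) _ _).
  - intros c x.
    apply (filterlim_locally_unique (V := l2_NormedModule) (F := at_left 1) (fun r => damped a r (c *: x)%L)); [apply L |].
    apply (filterlim_ext_loc (F := at_left 1) (fun r => (c *: damped a r x)%L)).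
    { apply filter_imp with (2 := at_left_1_unit). intros r Hr. symmetry. now apply (damped_scal f a Ha). }
    apply (filterlim_comp _ _ _ (fun r => damped a r x) (l2_scal c) _ _ _ (L x)).
    exact (filterlim_scal_r (K := C_AbsRing) (V := l2_NormedModule) c _).
  - exists (M + 1). split; [lra |]. intros x. assert (Hx := Hb x).
    assert (H0 : 0 <= norm x) by apply norm_ge_0. lra.
  - intros l Hl.
    exact (filterlim_locally_unique (V := l2_NormedModule) (F := at_left 1) _ _ _ (L (eigvec l))
      (damped_eigvec_lim f a Hf Ha l Hl)).
Qed.


(** * Baire category *)

Section Distance.
Context {K : AbsRing} {V : NormedModule K}.
Implicit Types x y z : V.

Lemma vdist_self x : norm (minus x x) = 0.
Proof. rewrite <- (norm_zero (V := V)). f_equal. apply (minus_eq_zero (G := V)). Qed.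

Lemma vdist_triangle x y z : norm (minus x z) <= norm (minus x y) + norm (minus y z).
Proof.
  eapply Rle_trans; [apply Req_le, f_equal, (minus_trans (G := V) y x z) | apply (norm_triangle (V := V))].
Qed.

Lemma vdist_sym x y : norm (minus x y) = norm (minus y x).
Proof.
  transitivity (norm (opp (minus y x))); [f_equal; symmetry; apply (opp_minus (G := V)) | apply (norm_opp (V := V))].
Qed.

End Distance.

(** Completeness is a hypothesis on a normed space, so that all distances are taken in
    one structure. *)
Definition seq_complete {K : AbsRing} (V : NormedModule K) : Prop :=
  forall u : nat -> V,
    (forall eps : posreal, exists N, forall n m, (N <= n)%nat -> (N <= m)%nat -> ball (u n) eps (u m)) ->
    exists z, filterlim u eventually (locally z).

Lemma complete_seq_complete {K : AbsRing} (V : CompleteNormedModule K) :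
  seq_complete (CompleteNormedModule.NormedModule K V).
Proof.
  intros u Hu. apply (proj1 (filterlim_locally_cauchy (U := CompleteNormedModule.CompleteSpace K V) (F := eventually) u)).
  intros eps. destruct (Hu eps) as [N HN]. exists (fun n => (N <= n)%nat). split; [now exists N | exact HN].
Qed.

(** Nested closed balls. The hypothesis only concerns balls inside the initial one, so
    that the theorem can also be applied within an interval of the real line. *)
Section Baire.

Context {K : AbsRing} {V : NormedModule K}.
Hypothesis V_complete : seq_complete V.
Variables (G : nat -> V -> Prop) (x0 : V) (e0 : R).
Hypothesis He0 : 0 < e0.
Hypothesis HG : forall n (x : V) e, 0 < e -> (forall z : V, norm (minus z x) <= e -> norm (minus z x0) <= e0) ->
  exists (y : V) d, 0 < d /\ forall z : V, norm (minus z y) <= d -> norm (minus z x) <= e /\ G n z.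

Let inside (p : V * R) : Prop :=
  0 < snd p /\ forall z : V, norm (minus z (fst p)) <= snd p -> norm (minus z x0) <= e0.

Let next_ok (n : nat) (p p' : V * R) : Prop :=
  inside p' /\ snd p' <= snd p / 2 /\
  forall z : V, norm (minus z (fst p')) <= snd p' -> norm (minus z (fst p)) <= snd p /\ G n z.

Lemma baire_step n p : inside p -> exists p', next_ok n p p'.
Proof.
  intros [Hp1 Hp2]. destruct (HG n (fst p) (snd p) Hp1 Hp2) as (y & d & Hd & H).
  min_bounds d (snd p / 2).
  assert (H' : forall z : V, norm (minus z y) <= Rmin d (snd p / 2) -> norm (minus z (fst p)) <= snd p /\ G n z).
  { intros z Hz. apply H. eapply Rle_trans; [exact Hz | exact m1]. }
  exists (y, Rmin d (snd p / 2)). split; [split; simpl | split; [exact m2 | exact H']].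
  - apply Rmin_pos; lra.
  - intros z Hz. apply Hp2, H', Hz.
Qed.

Let step (n : nat) (p : V * R) : V * R := epsilon (inhabits p) (next_ok n p).

Fixpoint baire_seq (n : nat) : V * R :=
  match n with O => (x0, e0) | S n => step n (baire_seq n) end.

Lemma baire_seq_ok n : inside (baire_seq n) /\ next_ok n (baire_seq n) (baire_seq (S n)).
Proof.
  assert (H : forall m, inside (baire_seq m) -> next_ok m (baire_seq m) (baire_seq (S m))).
  { intros m Hm. exact (epsilon_spec (inhabits (baire_seq m)) _ (baire_step m _ Hm)). }
  assert (Hin : inside (baire_seq n)).
  { induction n as [| n IH]; [split; simpl; auto | apply (H n IH)]. }
  auto.
Qed.

Lemma baire_nested n m (z : V) : (n <= m)%nat -> norm (minus z (fst (baire_seq m))) <= snd (baire_seq m) ->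
  norm (minus z (fst (baire_seq n))) <= snd (baire_seq n).
Proof.
  intros Hn. induction Hn as [| m Hn IH]; [auto |]. intros Hz. apply IH.
  now apply (proj2 (baire_seq_ok m)).
Qed.

Lemma baire_radius n : 0 < snd (baire_seq n) <= e0 * (/ 2) ^ n.
Proof.
  split; [apply (proj1 (baire_seq_ok n)) |].
  induction n as [| n IH]; [simpl; lra |].
  assert (H := proj1 (proj2 (proj2 (baire_seq_ok n)))). cbn [pow]. lra.
Qed.

Lemma baire_center n m : (n <= m)%nat -> norm (minus (fst (baire_seq m)) (fst (baire_seq n))) <= snd (baire_seq n).
Proof.
  intros Hn. apply baire_nested with m; [exact Hn |].
  rewrite vdist_self. left. apply baire_radius.
Qed.

Lemma baire : exists z : V, norm (minus z x0) <= e0 /\ forall n, G n z.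
Proof.
  assert (Hex : exists z, filterlim (fun n => fst (baire_seq n)) eventually (locally z)).
  { apply V_complete. intros eps. assert (He := cond_pos eps).
    destruct (geom_eventually_small e0 (/ 2) (eps / 2) ltac:(lra) ltac:(lra)) as [N HN].
    exists N. intros u v Hu Hv. apply norm_compat1.
    assert (H1 := baire_center N u Hu). assert (H2 := baire_center N v Hv).
    assert (H3 := baire_radius N). specialize (HN N (le_n N)).
    assert (H4 := vdist_triangle (fst (baire_seq v)) (fst (baire_seq N)) (fst (baire_seq u))).
    rewrite (vdist_sym (fst (baire_seq N))) in H4. lra. }
  destruct Hex as [z Hz].
  assert (Hin : forall n, norm (minus z (fst (baire_seq n))) <= snd (baire_seq n)).
  { intros n. apply Rnot_lt_le. intros Hlt.
    set (del := norm (minus z (fst (baire_seq n))) - snd (baire_seq n)).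
    assert (Hdel : 0 < del) by (unfold del; lra).
    destruct (proj1 (filterlim_locally_ball_norm (F := eventually) (fun n => fst (baire_seq n)) z) Hz (mkposreal _ Hdel)) as [N HN].
    set (m := max n N). specialize (HN m ltac:(unfold m; lia)).
    change (norm (minus (fst (baire_seq m)) z) < del) in HN.
    assert (H1 := baire_center n m ltac:(unfold m; lia)).
    assert (H2 := vdist_triangle z (fst (baire_seq m)) (fst (baire_seq n))).
    rewrite (vdist_sym z (fst (baire_seq m))) in H2. unfold del in HN. lra. }
  exists z. split; [apply (Hin 0%nat) |].
  intros n. apply (proj2 (baire_seq_ok n)). apply Hin.
Qed.

End Baire.

(** By Baire: the complements of the fibres of an injection are open and dense. *)
Lemma no_injection_R_nat (g : R -> nat) : (forall x y, g x = g y -> x = y) -> False.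
Proof.
  intros Hg.
  destruct (baire (V := R_NormedModule) (complete_seq_complete R_CompleteNormedModule) (fun n z => g z <> n) 0 1 Rlt_0_1) as (z & _ & Hz).
  - intros n x e He _.
    assert (H : exists y, x - e / 2 <= y <= x + e / 2 /\ g y <> n).
    { destruct (Nat.eq_dec (g x) n) as [E | E]; [| exists x; split; [lra | exact E]].
      exists (x + e / 2). split; [lra |]. intros E'. rewrite <- E in E'. apply Hg in E'. lra. }
    destruct H as (y & Hy & Hyn).
    assert (H1 : exists d, 0 < d <= e / 2 /\ forall z, Rabs (z - y) <= d -> g z <> n).
    { destruct (classic (exists w, g w = n)) as [[w Hw] | Hno].
      - assert (Hwy : 0 < Rabs (w - y)).
        { apply Rabs_pos_lt. intros E. apply Hyn. replace y with w by lra. exact Hw. }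
        exists (Rmin (e / 2) (Rabs (w - y) / 2)). split; [split; [apply Rmin_pos; lra | apply Rmin_l] |].
        intros z Hz E. rewrite <- Hw in E. apply Hg in E. subst z.
        assert (m2 := Rmin_r (e / 2) (Rabs (w - y) / 2)). lra.
      - exists (e / 2). split; [lra |]. intros z _ E. apply Hno. now exists z. }
    destruct H1 as (d & Hd & H1). exists y, d. split; [lra |].
    intros z Hz. change (Rabs (z - y) <= d) in Hz. split; [| now apply H1].
    change (Rabs (z - x) <= e). apply Rabs_le_between in Hz. apply Rabs_le. lra.
  - exact (Hz (g z) eq_refl).
Qed.


(** * A countable dense family of sequences *)

(** An enumeration of the rationals through the Cantor pairing: [(a - b) / (c + 1)] for
    natural numbers [a], [b], [c]. *)
Definition qreal (n : nat) : R :=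
  let (a, m) := of_nat n in let (b, c) := of_nat m in (INR a - INR b) / (INR c + 1).

Lemma qreal_dense x e : 0 < e -> exists n, Rabs (qreal n - x) < e.
Proof.
  intros He. destruct (archimed_cor1 e He) as (c & Hc1 & Hc2).
  assert (Hc : 0 < INR c) by (now apply lt_0_INR).
  set (k := up (x * (INR c + 1))). destruct (archimed (x * (INR c + 1))) as [H1 H2]. fold k in H1, H2.
  exists (to_nat (Z.to_nat k, to_nat (Z.to_nat (- k), c))). unfold qreal. rewrite !cancel_of_to.
  assert (Ek : INR (Z.to_nat k) - INR (Z.to_nat (- k)) = IZR k).
  { rewrite !INR_IZR_INZ. rewrite <- minus_IZR. f_equal. lia. }
  rewrite Ek.
  replace (IZR k / (INR c + 1) - x) with ((IZR k - x * (INR c + 1)) / (INR c + 1)) by (field; lra).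
  unfold Rdiv. rewrite Rabs_mult, (Rabs_pos_eq (/ _)) by (left; apply Rinv_0_lt_compat; lra).
  apply Rlt_div_l; [lra |].
  assert (Rabs (IZR k - x * (INR c + 1)) <= 1) by (apply Rabs_le; lra).
  assert (1 < e * INR c) by (apply Rmult_lt_reg_r with (/ INR c); [now apply Rinv_0_lt_compat |];
     rewrite Rmult_assoc, Rinv_r by lra; lra).
  nra.
Qed.

Definition qcomplex (n : nat) : C := let (a, b) := of_nat n in (qreal a, qreal b).

Lemma qcomplex_dense (z : C) e : 0 < e -> exists n, Cmod (qcomplex n - z) < e.
Proof.
  intros He.
  destruct (qreal_dense (fst z) (e / 2) ltac:(lra)) as [a Ha].
  destruct (qreal_dense (snd z) (e / 2) ltac:(lra)) as [b Hb].
  exists (to_nat (a, b)). unfold qcomplex. rewrite cancel_of_to.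
  eapply Rle_lt_trans; [apply Cmod_2Rmax |]. simpl.
  assert (S2 : sqrt 2 <= 2).
  { rewrite <- (sqrt_pow2 2) at 2 by lra. apply sqrt_le_1_alt. lra. }
  assert (S0 := sqrt_pos 2).
  set (m := Rmax _ _).
  assert (Hm : m < e / 2) by (apply Rmax_lub_lt; [exact Ha | exact Hb]).
  assert (Hm0 : 0 <= m) by (eapply Rle_trans; [apply Rabs_pos | apply Rmax_l]).
  nra.
Qed.

(** Each unpairing of [m] yields the code of one coordinate and the code of the others. *)
Fixpoint qvec (n m : nat) : l2 :=
  match n with
  | O => l2_zero
  | S n => let (k, m) := of_nat m in (qvec n m + qcomplex k *: basis n)%L
  end.

Lemma qvec_dense_trunc (x : l2) n : forall e, 0 < e -> exists m, norm (qvec n m - trunc x n)%L < e.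
Proof.
  induction n as [| n IH]; intros e He.
  - exists 0%nat. cbn [qvec trunc]. replace (l2_zero - l2_zero)%L with l2_zero by (l2_ext; ring).
    rewrite l2_norm_zero. exact He.
  - destruct (IH (e / 2) ltac:(lra)) as [m Hm].
    destruct (qcomplex_dense (x n) (e / 2) ltac:(lra)) as [k Hk].
    exists (to_nat (k, m)). cbn [qvec trunc]. rewrite cancel_of_to.
    replace (qvec n m + qcomplex k *: basis n - (trunc x n + x n *: basis n))%L
      with (qvec n m - trunc x n + (qcomplex k - x n)%C *: basis n)%L by (l2_ext; ring).
    eapply Rle_lt_trans; [apply l2_triangle |]. rewrite l2_norm_scal.
    rewrite basis_norm. lra.
Qed.

Definition l2_enum (k : nat) : l2 := let (n, m) := of_nat k in qvec n m.

Lemma l2_enum_dense (x : l2) e : 0 < e -> exists k, norm (l2_enum k - x)%L < e.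
Proof.
  intros He. destruct (trunc_approx x (e / 2) ltac:(lra)) as [n Hn].
  destruct (qvec_dense_trunc x n (e / 2) ltac:(lra)) as [m Hm].
  exists (to_nat (n, m)). unfold l2_enum. rewrite cancel_of_to.
  assert (H := l2_dist_triangle (qvec n m) (trunc x n) x). lra.
Qed.

(** * Dynamics of operators with many eigenvectors *)

Lemma l2_minus_alt (x y : l2) : (x - y)%L = (x + RtoC (-1) *: y)%L.
Proof. l2_ext; ring. Qed.

Lemma eigvec_norm_pos l : disk l -> 0 < norm (eigvec l).
Proof.
  intros Hl. assert (H := l2_coord_le (eigvec l) 0). rewrite eigvec_coord in H by exact Hl.
  change (Cp l 0) with (RtoC 1) in H. rewrite Cmod_1 in H. lra.
Qed.

(** Times from [p] to [(j + 1) * p] make up the fraction [j / (j + 1)] of the times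
    below [(j + 1) * p]; over all [j] this expresses upper density 1. *)
Definition often_small (A : l2 -> l2) (j : nat) (x : l2) : Prop :=
  exists p, (0 < p)%nat /\ forall i, (p <= i < S j * p)%nat -> norm (Nat.iter i A x) < / (INR j + 1).

Definition often_large (A : l2 -> l2) (j : nat) (x : l2) : Prop :=
  exists p, (0 < p)%nat /\ forall i, (p <= i < S j * p)%nat -> 1 < norm (Nat.iter i A x).

Definition irregular (A : l2 -> l2) (x : l2) : Prop := forall j, often_small A j x /\ often_large A j x.

Section Dynamics.

Variables (f : C -> C) (A : l2 -> l2).
Hypothesis HA : eigen_operator f A.

Lemma iter_plus n (x y : l2) : Nat.iter n A (x + y)%L = (Nat.iter n A x + Nat.iter n A y)%L.
Proof. induction n as [| n IH]; [reflexivity |]. simpl. now rewrite IH, (op_plus f A HA). Qed.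

Lemma iter_scal n c (x : l2) : Nat.iter n A (c *: x)%L = (c *: Nat.iter n A x)%L.
Proof. induction n as [| n IH]; [reflexivity |]. simpl. now rewrite IH, (op_scal f A HA). Qed.

Lemma iter_minus n (x y : l2) : Nat.iter n A (x - y)%L = (Nat.iter n A x - Nat.iter n A y)%L.
Proof. rewrite !l2_minus_alt. now rewrite iter_plus, iter_scal. Qed.

Lemma iter_zero n : Nat.iter n A l2_zero = l2_zero.
Proof.
  replace l2_zero with (RtoC 0 *: l2_zero)%L at 1 by (l2_ext; ring).
  rewrite iter_scal. l2_ext; ring.
Qed.

Lemma iter_eigvec n l : disk l -> Nat.iter n A (eigvec l) = (Cp (f l) n *: eigvec l)%L.
Proof.
  intros Hl. induction n as [| n IH].
  - symmetry. apply l2_scal_one.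
  - simpl Nat.iter. rewrite IH, (op_scal f A HA), (op_eigvec f A HA) by exact Hl.
    rewrite l2_scal_assoc. f_equal. apply Cmult_comm.
Qed.

Lemma iter_eigvec_norm n l : disk l -> norm (Nat.iter n A (eigvec l)) = Cmod (f l) ^ n * norm (eigvec l).
Proof. intros Hl. rewrite iter_eigvec, l2_norm_scal, Cmod_pow_n by exact Hl. reflexivity. Qed.

Lemma iter_close n e : 0 < e -> exists d, 0 < d /\ forall z y : l2, norm (z - y)%L <= d ->
  forall i, (i <= n)%nat -> norm (Nat.iter i A z - Nat.iter i A y)%L < e.
Proof.
  intros He. destruct (op_bounded f A HA) as (M & HM1 & HM).
  assert (Hn : 1 <= M ^ n) by now apply pow_R1_Rle.
  exists (e / (2 * M ^ n)). split; [apply Rdiv_lt_0_compat; lra |].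
  intros z y Hzy i Hi. rewrite <- iter_minus.
  apply Rle_div_r in Hzy; [| lra].
  assert (Hb : forall j, norm (Nat.iter j A (z - y)%L) <= M ^ j * norm (z - y)%L).
  { induction j as [| j IH]; [simpl; lra |]. simpl. eapply Rle_trans; [apply HM |].
    rewrite Rmult_assoc. apply Rmult_le_compat_l; [lra | exact IH]. }
  assert (Hmi : M ^ i <= M ^ n) by now apply Rle_pow.
  assert (H0 : 0 <= norm (z - y)%L) by apply norm_ge_0.
  specialize (Hb i). nra.
Qed.

Lemma orbit_decay (x : l2) : lin_span (eigvecs (fun l => Cmod (f l) < 1)) x ->
  forall e, 0 < e -> exists N, forall n, (N <= n)%nat -> norm (Nat.iter n A x) < e.
Proof.
  intros Hx. induction Hx as [| c u v (l & Hfl & Hl & ->) _ IH]; intros e He.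
  - exists 0%nat. intros n _. change (norm (Nat.iter n A l2_zero) < e).
    rewrite iter_zero, l2_norm_zero. exact He.
  - destruct (IH (e / 2) ltac:(lra)) as [N1 HN1].
    destruct (geom_eventually_small (Cmod c * norm (eigvec l)) (Cmod (f l)) (e / 2)
       (conj (Cmod_ge_0 _) Hfl) ltac:(lra)) as [N2 HN2].
    exists (max N1 N2). intros n Hn. specialize (HN1 n ltac:(lia)). specialize (HN2 n ltac:(lia)).
    change (norm (Nat.iter n A (c *: eigvec l + v)%L) < e).
    rewrite iter_plus, iter_scal. eapply Rle_lt_trans; [apply l2_triangle |].
    rewrite l2_norm_scal, iter_eigvec_norm by exact Hl. lra.
Qed.

(** Dividing each eigenvector by the [n]-th power of its eigenvalue gives preimages
    under the [n]-th iterate that tend to 0. *)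
Lemma vanishing_preimages (y : l2) : lin_span (eigvecs (fun l => 1 < Cmod (f l))) y ->
  exists u : nat -> l2, (forall n, Nat.iter n A (u n) = y) /\
    forall e, 0 < e -> exists N, forall n, (N <= n)%nat -> norm (u n) < e.
Proof.
  intros Hy. induction Hy as [| c w v (l & Hfl & Hl & ->) _ (u & Hu1 & Hu2)].
  - exists (fun _ => l2_zero). split; [apply iter_zero |]. intros e He. exists 0%nat. intros n _.
    rewrite l2_norm_zero. exact He.
  - assert (Hnz : forall n, Cp (f l) n <> RtoC 0).
    { intros n E. assert (E' := Cmod_pow_n (f l) n). rewrite E, Cmod_0 in E'.
      assert (0 < Cmod (f l) ^ n) by (apply pow_lt; lra). lra. }
    exists (fun n => ((c / Cp (f l) n)%C *: eigvec l + u n)%L). split.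
    + intros n. rewrite iter_plus, iter_scal, iter_eigvec, l2_scal_assoc, Hu1 by exact Hl.
      change (((c / Cp (f l) n * Cp (f l) n)%C *: eigvec l + v)%L = (c *: eigvec l + v)%L).
      f_equal. f_equal. specialize (Hnz n). change (@eq C (c / Cp (f l) n * Cp (f l) n)%C c). now field.
    + intros e He. destruct (Hu2 (e / 2) ltac:(lra)) as [N1 HN1].
      assert (Hq : 0 <= / Cmod (f l) < 1).
      { split; [left; apply Rinv_0_lt_compat; lra |]. rewrite <- Rinv_1. apply Rinv_lt_contravar; lra. }
      destruct (geom_eventually_small (Cmod c * norm (eigvec l)) (/ Cmod (f l)) (e / 2) Hq ltac:(lra)) as [N2 HN2].
      exists (max N1 N2). intros n Hn. specialize (HN1 n ltac:(lia)). specialize (HN2 n ltac:(lia)).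
      eapply Rle_lt_trans; [apply l2_triangle |].
      rewrite l2_norm_scal. unfold Cdiv. rewrite Cmod_mult, Cmod_inv, Cmod_pow_n by apply Hnz.
      rewrite pow_inv in HN2. lra.
Qed.

Lemma periodic_span (x : l2) : lin_span (eigvecs (fun l => exists m, (0 < m)%nat /\ Cp (f l) m = RtoC 1)) x ->
  periodic_point A x.
Proof.
  intros Hx. induction Hx as [| c w v (l & (m & Hm & Em) & Hl & ->) _ (n & Hn & En)].
  - exists 1%nat. split; [lia | apply (iter_zero 1)].
  - exists (m * n)%nat. split; [lia |].
    assert (Hmul : forall k j (y : l2), Nat.iter j A y = y -> Nat.iter (k * j) A y = y).
    { intros k j y Hy. induction k as [| k IH]; [reflexivity |].
      cbn [Nat.mul]. rewrite Nat.iter_add. now rewrite IH. }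
    change (Nat.iter (m * n) A (c *: eigvec l + v)%L = (c *: eigvec l + v)%L).
    rewrite iter_plus, iter_scal. f_equal.
    + f_equal. rewrite Nat.mul_comm. apply Hmul. rewrite iter_eigvec, Em by exact Hl. apply l2_scal_one.
    + now apply Hmul.
Qed.

(** The criterion of Godefroy and Shapiro and its consequences. *)
Section Chaos.

Hypothesis H_small : forall x, in_closure (eigvecs (fun l => Cmod (f l) < 1)) x.
Hypothesis H_large : forall x, in_closure (eigvecs (fun l => 1 < Cmod (f l))) x.

(** Take [z = x' + u n] with [x'] near [x] of vanishing orbit, and [u n] vanishing
    preimages of a vector near [y]. *)
Lemma mixing_balls (x y : l2) e : 0 < e -> exists N, forall n, (N <= n)%nat ->
  exists z, norm (z - x)%L < e /\ norm (Nat.iter n A z - y)%L < e.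
Proof.
  intros He.
  destruct (H_small x (e / 2) ltac:(lra)) as (x' & Hx' & Dx).
  destruct (H_large y (e / 2) ltac:(lra)) as (y' & Hy' & Dy).
  destruct (vanishing_preimages y' Hy') as (u & Hu1 & Hu2).
  destruct (orbit_decay x' Hx' (e / 2) ltac:(lra)) as [N1 HN1].
  destruct (Hu2 (e / 2) ltac:(lra)) as [N2 HN2].
  exists (max N1 N2). intros n Hn. specialize (HN1 n ltac:(lia)). specialize (HN2 n ltac:(lia)).
  exists (x' + u n)%L. split.
  - replace (x' + u n - x)%L with (x' - x + u n)%L by (l2_ext; ring).
    assert (H := l2_triangle (x' - x)%L (u n)). lra.
  - rewrite iter_plus, Hu1.
    replace (Nat.iter n A x' + y' - y)%L with (Nat.iter n A x' + (y' - y))%L by (l2_ext; ring).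
    assert (H := l2_triangle (Nat.iter n A x') (y' - y)%L). lra.
Qed.

Lemma chaos_mixing : strong_mixing A.
Proof.
  intros U W HU HW [x Hx] [y Hy].
  destruct (HU x Hx) as [e1 He1]. destruct (HW y Hy) as [e2 He2].
  destruct (mixing_balls x y (Rmin e1 e2)) as [N HN]; [apply Rmin_pos; apply cond_pos |].
  exists N. intros n Hn. destruct (HN n Hn) as (z & Hz1 & Hz2). exists z. split.
  - apply He1. apply l2_ball. eapply Rlt_le_trans; [exact Hz1 | apply Rmin_l].
  - apply He2. apply l2_ball. eapply Rlt_le_trans; [exact Hz2 | apply Rmin_r].
Qed.

Lemma mixing_transitive : strong_mixing A -> topologically_transitive A.
Proof.
  intros H U W HU HW Ux Wx. destruct (H U W HU HW Ux Wx) as [N HN].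
  exists (S N). split; [lia |]. apply HN. lia.
Qed.

Lemma baire_generic_vector (G : nat -> l2 -> Prop) :
  (forall n (x : l2) e, 0 < e -> exists (y : l2) d, 0 < d /\ norm (y - x)%L < e /\
     forall z, norm (z - y)%L <= d -> G n z) ->
  exists z, forall n, G n z.
Proof.
  intros HG.
  destruct (baire (V := l2_NormedModule) (complete_seq_complete l2_CompleteNormedModule) G l2_zero 1 Rlt_0_1) as (z & _ & Hz);
    [| now exists z].
  intros n x e He _.
  destruct (HG n x (e / 2) ltac:(lra)) as (y & d & Hd & Hyx & Hy).
  min_bounds d (e / 2).
  exists y, (Rmin d (e / 2)). split; [apply Rmin_pos; lra |].
  intros z Hz. assert (Hz' : norm (z - y)%L <= Rmin d (e / 2)) by exact Hz. split; [| apply Hy; lra].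
  change (norm (z - x)%L <= e). assert (H := l2_dist_triangle z y x). lra.
Qed.

(** A vector is hypercyclic if its orbit meets each of countably many balls; each of
    these conditions is open, and dense by [mixing_balls]. The code [k] stands for a
    centre and a radius. *)
Lemma chaos_hypercyclic : hypercyclic A.
Proof.
  destruct (baire_generic_vector (fun k x => exists n, norm (Nat.iter n A x - l2_enum (fst (of_nat k)))%L < / (INR (snd (of_nat k)) + 1)))
    as [x Hx].
  - intros k x e He. destruct (of_nat k) as [a b]; simpl.
    assert (Hb : 0 < / (INR b + 1)) by (apply Rinv_0_lt_compat; assert (H := pos_INR b); lra).
    set (t := / (INR b + 1)) in *.
    destruct (mixing_balls x (l2_enum a) (Rmin e (t / 2))) as [N HN]; [apply Rmin_pos; lra |].
    min_bounds e (t / 2).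
    destruct (HN N (le_n N)) as (y & Hy1 & Hy2).
    destruct (iter_close N (t / 2) ltac:(lra)) as (d & Hd & Hclose).
    exists y, d. split; [exact Hd | split; [lra |]].
    intros z Hz. exists N. specialize (Hclose z y Hz N (le_n N)).
    assert (H := l2_dist_triangle (Nat.iter N A z) (Nat.iter N A y) (l2_enum a)). lra.
  - exists x. intros y eps. assert (He := cond_pos eps).
    destruct (l2_enum_dense y (eps / 2) ltac:(lra)) as [a Ha].
    destruct (archimed_cor1 (eps / 2) ltac:(lra)) as (b & Hb & Hb0).
    destruct (Hx (to_nat (a, b))) as [n Hn]. rewrite cancel_of_to in Hn. simpl in Hn.
    exists (Nat.iter n A x). split; [now exists n |].
    change (norm (Nat.iter n A x - y)%L < eps).
    assert (H := l2_dist_triangle (Nat.iter n A x) (l2_enum a) y).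
    assert (/ (INR b + 1) <= / INR b).
    { assert (0 < INR b) by now apply lt_0_INR. apply Rinv_le_contravar; lra. }
    lra.
Qed.

Hypothesis H_expand : exists l, disk l /\ 1 < Cmod (f l).

(** A small multiple of an eigenvector with eigenvalue of modulus above 1 is added to a
    vector of vanishing orbit. *)
Lemma growing_orbit_nearby (y : l2) : lin_span (eigvecs (fun l => Cmod (f l) < 1)) y -> forall e, 0 < e ->
  exists w, norm (w - y)%L < e /\ forall B, exists N, forall n, (N <= n)%nat -> B < norm (Nat.iter n A w).
Proof.
  intros Hy e He. destruct H_expand as (l & Hl & Hfl).
  assert (Hk := eigvec_norm_pos l Hl).
  set (c := e / (2 * norm (eigvec l))).
  assert (Hc : 0 < c) by (apply Rdiv_lt_0_compat; lra).
  exists (y + RtoC c *: eigvec l)%L. split.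
  - replace (y + RtoC c *: eigvec l - y)%L with (RtoC c *: eigvec l)%L by (l2_ext; ring).
    rewrite l2_norm_scal, Cmod_R, Rabs_pos_eq by lra.
    replace (c * norm (eigvec l)) with (e / 2) by (unfold c; field; lra). lra.
  - intros B.
    destruct (orbit_decay y Hy 1 Rlt_0_1) as [N1 HN1].
    destruct (Pow_x_infinity (Cmod (f l)) ltac:(rewrite Rabs_pos_eq; lra) ((Rabs B + 1) / (c * norm (eigvec l)))) as [N2 HN2].
    exists (max N1 N2). intros n Hn. specialize (HN1 n ltac:(lia)). specialize (HN2 n ltac:(lia)).
    rewrite Rabs_pos_eq in HN2 by (apply pow_le; lra). apply Rge_le in HN2.
    assert (Hck : 0 < c * norm (eigvec l)) by now apply Rmult_lt_0_compat.
    apply Rle_div_l in HN2; [| exact Hck].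
    set (Y := Nat.iter n A y) in *.
    assert (E : Nat.iter n A (y + RtoC c *: eigvec l)%L = (Y + RtoC c *: Nat.iter n A (eigvec l))%L)
      by now rewrite iter_plus, iter_scal.
    rewrite E. set (Z := (RtoC c *: Nat.iter n A (eigvec l))%L).
    assert (HZ : norm Z = c * (Cmod (f l) ^ n * norm (eigvec l))).
    { unfold Z. rewrite l2_norm_scal, iter_eigvec_norm, Cmod_R, Rabs_pos_eq by (assumption || lra). reflexivity. }
    assert (H := l2_triangle (Y + Z)%L (RtoC (-1) *: Y)%L).
    replace (Y + Z + RtoC (-1) *: Y)%L with Z in H by (l2_ext; ring).
    rewrite l2_norm_scal, Cmod_R, Rabs_left in H by lra.
    assert (HB := Rle_abs B). lra.
Qed.

Lemma chaos_sensitive : sensitive A.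
Proof.
  exists (mkposreal 1 Rlt_0_1). intros x eps.
  destruct (growing_orbit_nearby l2_zero (lin_span_zero _) eps (cond_pos eps)) as (w & Hw & Hgrow).
  destruct (Hgrow 1) as [N HN]. specialize (HN N (le_n N)).
  exists (x + w)%L, N. split.
  - change (norm (x + w - x)%L < eps).
    replace (x + w - x)%L with (w - l2_zero)%L by (l2_ext; ring). exact Hw.
  - change (1 < norm (Nat.iter N A (x + w)%L - Nat.iter N A x)%L).
    rewrite <- iter_minus. replace (x + w - x)%L with w by (l2_ext; ring). exact HN.
Qed.

Lemma chaos_Devaney : (forall x, in_closure (eigvecs (fun l => exists m, (0 < m)%nat /\ Cp (f l) m = RtoC 1)) x) ->
  Devaney_chaotic A.
Proof.
  intros Hper. split; [apply mixing_transitive, chaos_mixing | split; [| apply chaos_sensitive]].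
  intros x eps. destruct (Hper x eps (cond_pos eps)) as (y & Hy & Hyx).
  exists y. split; [now apply periodic_span | exact Hyx].
Qed.

(** For each [j] both conditions are open, as they involve finitely many iterates.
    Vectors of vanishing orbit, which are dense, satisfy the first one; adding a growing
    eigenvector gives the second. *)
Lemma irregular_vector : exists x : l2, irregular A x.
Proof.
  destruct (baire_generic_vector (fun n => (if Nat.even n then often_small A else often_large A) (Nat.div2 n)))
    as [x Hx].
  - intros n x e He. destruct (H_small x (e / 2) ltac:(lra)) as (y & Hy & Dy).
    set (j := Nat.div2 n). destruct (Nat.even n).
    + assert (Ht : 0 < / (INR j + 1)) by (apply Rinv_0_lt_compat; assert (H := pos_INR j); lra).
      set (t := / (INR j + 1)) in *.
      destruct (orbit_decay y Hy (t / 2) ltac:(lra)) as [N HN].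
      destruct (iter_close (S j * S N) (t / 2) ltac:(lra)) as (d & Hd & Hclose).
      exists y, d. split; [exact Hd | split; [lra |]].
      intros z Hz. exists (S N). split; [lia |]. fold t. intros i Hi.
      specialize (Hclose z y Hz i ltac:(lia)). specialize (HN i ltac:(lia)).
      assert (H := l2_triangle (Nat.iter i A z - Nat.iter i A y)%L (Nat.iter i A y)).
      replace (Nat.iter i A z - Nat.iter i A y + Nat.iter i A y)%L with (Nat.iter i A z) in H by (l2_ext; ring).
      lra.
    + destruct (growing_orbit_nearby y Hy (e / 2) ltac:(lra)) as (w & Hw & Hgrow).
      destruct (Hgrow 2) as [N HN].
      destruct (iter_close (S j * S N) 1 Rlt_0_1) as (d & Hd & Hclose).
      exists w, d. split; [exact Hd | split].
      { assert (H := l2_dist_triangle w y x). lra. }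
      intros z Hz. exists (S N). split; [lia |]. intros i Hi.
      specialize (Hclose z w Hz i ltac:(lia)). specialize (HN i ltac:(lia)).
      rewrite l2_dist_sym in Hclose.
      assert (H := l2_triangle (Nat.iter i A w - Nat.iter i A z)%L (Nat.iter i A z)).
      replace (Nat.iter i A w - Nat.iter i A z + Nat.iter i A z)%L with (Nat.iter i A w) in H by (l2_ext; ring).
      lra.
  - exists x. intros j. split.
    + specialize (Hx (2 * j)%nat). rewrite Nat.even_even, Nat.div2_double in Hx. exact Hx.
    + specialize (Hx (2 * j + 1)%nat). rewrite Nat.even_odd in Hx.
      replace (Nat.div2 (2 * j + 1)) with j in Hx; [exact Hx |].
      rewrite Nat.add_1_r. symmetry. apply Nat.div2_succ_double.
Qed.

Lemma chaos_Li_Yorke : Li_Yorke_chaotic A.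
Proof.
  destruct irregular_vector as [x Hx]. exists x.
  set (u := fun n => norm (Nat.iter n A x)).
  assert (Hbig : forall N, exists n, (N <= n)%nat /\ 1 < u n).
  { intros N. destruct (Hx (S N)) as [_ (p & Hp & H)]. exists (S N * p)%nat. split; [nia |]. apply H. nia. }
  assert (Hsmall : forall N e, 0 < e -> exists n, (N <= n)%nat /\ u n < e).
  { intros N e He. destruct (archimed_cor1 e He) as (b & Hb & Hb0).
    destruct (Hx (S N + b)%nat) as [(p & Hp & H) _]. exists (S N * p)%nat. split; [nia |].
    eapply Rlt_trans; [apply H; nia |]. eapply Rle_lt_trans; [| exact Hb].
    assert (0 < INR b) by now apply lt_0_INR.
    apply Rinv_le_contravar; [assumption |]. rewrite plus_INR. assert (H1 := pos_INR (S N)). lra. }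
  split.
  - change (Rbar_lt 0 (LimSup_seq u)).
    assert (HL : is_LimSup_seq u (LimSup_seq u)) by exact (proj2_sig (ex_LimSup_seq u)).
    destruct (LimSup_seq u) as [s | |]; simpl in *.
    + destruct (HL (mkposreal (/ 2) ltac:(lra))) as [_ [N HN]]. simpl in HN.
      destruct (Hbig N) as (n & Hn & Hn1). specialize (HN n Hn). lra.
    + exact I.
    + destruct (HL 1) as [N HN]. destruct (Hbig N) as (n & Hn & Hn1). specialize (HN n Hn). lra.
  - apply is_LimInf_seq_unique. intros eps. split.
    + intros N. destruct (Hsmall N eps (cond_pos eps)) as (n & Hn & Hn1). exists n. split; [exact Hn |].
      change (u n < 0 + eps). lra.
    + exists 0%nat. intros n _. change (0 - eps < u n). assert (He := cond_pos eps).
      assert (0 <= u n) by apply norm_ge_0. lra.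
Qed.

End Chaos.

End Dynamics.


(** * Distributional chaos *)

Lemma filter_none {X : Type} (P : X -> bool) (l : list X) : (forall x, In x l -> P x = false) -> filter P l = nil.
Proof.
  induction l as [| x l IH]; intros H; [reflexivity |]. simpl.
  rewrite (H x) by (now left). apply IH. intros y Hy. apply H. now right.
Qed.

Lemma filter_full {X : Type} (P : X -> bool) (l : list X) : (forall x, In x l -> P x = true) -> filter P l = l.
Proof.
  induction l as [| x l IH]; intros H; [reflexivity |]. simpl.
  rewrite (H x) by (now left). f_equal. apply IH. intros y Hy. apply H. now right.
Qed.

Lemma count_split (P : nat -> bool) p n : (p <= n)%nat ->
  length (filter P (seq 0 n)) = (length (filter P (seq 0 p)) + length (filter P (seq p (n - p))))%nat.
Proof.
  intros H. replace n with (p + (n - p))%nat at 1 by lia.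
  now rewrite seq_app, filter_app, length_app.
Qed.

Section Frequency.

Variables (A : l2 -> l2) (x y : l2) (tau : R).

Notation freq := (proximity_frequency A x y tau).
Notation gap i := (norm (Nat.iter i A x - Nat.iter i A y)%L).

Let near (i : nat) : bool := if Rlt_dec (gap i) tau then true else false.

Lemma freq_eq n : freq n = INR (length (filter near (seq 0 n))) / INR n.
Proof. reflexivity. Qed.

Lemma freq_nonneg n : 0 <= freq n.
Proof.
  rewrite freq_eq. destruct n as [| n]; [simpl; unfold Rdiv; rewrite Rinv_0; lra |].
  apply Rdiv_le_0_compat; [apply pos_INR | apply lt_0_INR; lia].
Qed.

Lemma freq_le_1 n : freq n <= 1.
Proof.
  rewrite freq_eq. destruct n as [| n]; [simpl; unfold Rdiv; rewrite Rinv_0; lra |].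
  assert (Hn : 0 < INR (S n)) by (apply lt_0_INR; lia).
  apply Rle_div_l; [exact Hn |]. rewrite Rmult_1_l. apply le_INR.
  eapply Nat.le_trans; [apply filter_length_le |]. now rewrite length_seq.
Qed.

Lemma freq_lower p n : (p <= n)%nat -> (0 < n)%nat -> (forall i, (p <= i < n)%nat -> gap i < tau) ->
  1 - INR p / INR n <= freq n.
Proof.
  intros Hp Hn H. rewrite freq_eq, (count_split near p n Hp).
  rewrite (filter_full near (seq p (n - p))), length_seq.
  - assert (Hn' : 0 < INR n) by (now apply lt_0_INR).
    replace (1 - INR p / INR n) with ((INR n - INR p) / INR n) by (field; lra).
    apply Rmult_le_compat_r; [left; now apply Rinv_0_lt_compat |].
    rewrite <- minus_INR by exact Hp. apply le_INR. lia.
  - intros i Hi. apply in_seq in Hi. unfold near. destruct (Rlt_dec _ _) as [| Hno]; [reflexivity |].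
    exfalso. apply Hno, H. lia.
Qed.

Lemma freq_upper p n : (p <= n)%nat -> (0 < n)%nat -> (forall i, (p <= i < n)%nat -> tau <= gap i) ->
  freq n <= INR p / INR n.
Proof.
  intros Hp Hn H. rewrite freq_eq, (count_split near p n Hp).
  rewrite (filter_none near (seq p (n - p))).
  - assert (Hn' : 0 < INR n) by (now apply lt_0_INR).
    apply Rmult_le_compat_r; [left; now apply Rinv_0_lt_compat |]. apply le_INR. simpl.
    rewrite Nat.add_0_r. eapply Nat.le_trans; [apply filter_length_le |]. now rewrite length_seq.
  - intros i Hi. apply in_seq in Hi. unfold near. destruct (Rlt_dec _ _) as [Hlt |]; [| reflexivity].
    exfalso. specialize (H i ltac:(lia)). lra.
Qed.

Lemma freq_limsup_1 : (forall N e, 0 < e -> exists n, (N <= n)%nat /\ 1 - e < freq n) -> LimSup_seq freq = 1.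
Proof.
  intros H. apply is_LimSup_seq_unique. intros eps. assert (He := cond_pos eps). split.
  - intros N. exact (H N eps He).
  - exists 0%nat. intros n _. assert (H1 := freq_le_1 n). lra.
Qed.

Lemma freq_liminf_0 : (forall N e, 0 < e -> exists n, (N <= n)%nat /\ freq n < e) -> LimInf_seq freq = 0.
Proof.
  intros H. apply is_LimInf_seq_unique. intros eps. assert (He := cond_pos eps). split.
  - intros N. destruct (H N eps He) as (n & Hn & Hf). exists n. split; [exact Hn |]. lra.
  - exists 0%nat. intros n _. assert (H1 := freq_nonneg n). lra.
Qed.

Lemma limsup_1_freq : LimSup_seq freq = 1 -> forall N, exists n, (N <= n)%nat /\ / 2 < freq n.
Proof.
  intros E N.
  assert (HL : is_LimSup_seq freq 1) by (rewrite <- E; exact (proj2_sig (ex_LimSup_seq freq))).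
  destruct (HL (mkposreal (/ 2) ltac:(lra))) as [H _]. destruct (H N) as (n & Hn & Hf). simpl in Hf.
  exists n. split; [exact Hn | lra].
Qed.

Lemma liminf_0_freq : LimInf_seq freq = 0 -> forall N, exists n, (N <= n)%nat /\ freq n < / 2.
Proof.
  intros E N.
  assert (HL : is_LimInf_seq freq 0) by (rewrite <- E; exact (proj2_sig (ex_LimInf_seq freq))).
  destruct (HL (mkposreal (/ 2) ltac:(lra))) as [H _]. destruct (H N) as (n & Hn & Hf). simpl in Hf.
  exists n. split; [exact Hn | lra].
Qed.

End Frequency.

(** The differences of two points of the line are multiples of [x], so they inherit both
    kinds of times from [x]. The line is uncountable because it is a copy of the reals. *)
Lemma chaos_distributional (f : C -> C) (A : l2 -> l2) (x : l2) : eigen_operator f A ->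
  irregular A x -> distributionally_chaotic A.
Proof.
  intros HA Hx.
  assert (Hnz : 0 < norm x).
  { destruct (Rle_lt_dec (norm x) 0) as [Hle | Hlt]; [| exact Hlt]. exfalso.
    assert (Ex : x = l2_zero).
    { apply (norm_eq_zero (V := l2_NormedModule)). apply Rle_antisym; [exact Hle | apply norm_ge_0]. }
    destruct (Hx 1%nat) as [_ (p & Hp & H)]. specialize (H p ltac:(lia)).
    rewrite Ex, (iter_zero f A HA) in H.
    rewrite l2_norm_zero in H. lra. }
  exists (fun y => exists r : R, y = (RtoC r *: x)%L). split.
  - intros [g Hg]. apply (no_injection_R_nat (fun r => g (RtoC r *: x)%L)).
    intros r s E. apply Hg in E; [| now exists r | now exists s].
    assert (E0 : norm (RtoC (r - s) *: x)%L = 0).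
    { replace (RtoC (r - s) *: x)%L with (RtoC r *: x - RtoC s *: x)%L.
      - rewrite E. apply (vdist_self (V := l2_NormedModule)).
      - rewrite RtoC_minus. l2_ext; ring. }
    rewrite l2_norm_scal, Cmod_R in E0. apply Rmult_integral in E0.
    destruct E0 as [E0 | E0]; [| lra]. apply Rabs_eq_0 in E0. lra.
  - intros y z [r ->] [s ->] Hne.
    set (c := Rabs (r - s)).
    assert (Hc : 0 < c).
    { apply Rabs_pos_lt. intros E. apply Hne. replace r with s by lra. reflexivity. }
    assert (Hgap : forall i, norm (Nat.iter i A (RtoC r *: x)%L - Nat.iter i A (RtoC s *: x)%L)%L
       = c * norm (Nat.iter i A x)).
    { intros i. rewrite !(iter_scal f A HA).
      replace (RtoC r *: Nat.iter i A x - RtoC s *: Nat.iter i A x)%L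
        with (RtoC (r - s) *: Nat.iter i A x)%L by (rewrite RtoC_minus; l2_ext; ring).
      now rewrite l2_norm_scal, Cmod_R. }
    assert (Hfrac : forall j p, (0 < p)%nat -> INR p / INR (S j * p) = / (INR j + 1)).
    { intros j p Hp. rewrite mult_INR, S_INR. assert (Hp0 : 0 < INR p) by now apply lt_0_INR.
      assert (Hj := pos_INR j). field. lra. }
    assert (Hdec : forall (b j : nat) (e : R), / INR b < e -> (0 < b)%nat -> (b <= j)%nat -> / (INR j + 1) < e).
    { intros b j e Hb Hb0 Hj. eapply Rle_lt_trans; [| exact Hb].
      assert (0 < INR b) by now apply lt_0_INR. apply le_INR in Hj. apply Rinv_le_contravar; lra. }
    split.
    + intros tau Htau. apply freq_limsup_1. intros N e He.
      destruct (archimed_cor1 e He) as (b1 & Hb1 & Hb1').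
      destruct (archimed_cor1 (tau / c)) as (b2 & Hb2 & Hb2'); [now apply Rdiv_lt_0_compat |].
      set (j := (N + b1 + b2)%nat).
      destruct (Hx j) as [(p & Hp & H) _].
      exists (S j * p)%nat. split; [unfold j; nia |].
      eapply Rlt_le_trans; [| apply (freq_lower A _ _ tau p (S j * p)); [nia | nia |]].
      * rewrite Hfrac by exact Hp. assert (H1 := Hdec b1 j e Hb1 Hb1' ltac:(unfold j; lia)). lra.
      * intros i Hi. rewrite Hgap. specialize (H i Hi).
        assert (H2 := Hdec b2 j _ Hb2 Hb2' ltac:(unfold j; lia)).
        assert (H3 : norm (Nat.iter i A x) < tau / c) by lra.
        apply Rlt_div_r in H3; lra.
    + exists c. split; [exact Hc |]. apply freq_liminf_0. intros N e He.
      destruct (archimed_cor1 e He) as (b1 & Hb1 & Hb1').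
      set (j := (N + b1)%nat). destruct (Hx j) as [_ (p & Hp & H)].
      exists (S j * p)%nat. split; [unfold j; nia |].
      eapply Rle_lt_trans; [apply (freq_upper A _ _ c p (S j * p)); [nia | nia |] |].
      * intros i Hi. rewrite Hgap. specialize (H i Hi). nra.
      * rewrite Hfrac by exact Hp. exact (Hdec b1 j e Hb1 Hb1' ltac:(unfold j; lia)).
Qed.


(** * Operators with monotone orbit norms *)

(** If the norms of all orbits are monotone, they converge in the extended sense, and
    small and large norms cannot alternate. *)
Section Monotone.

Variables (f : C -> C) (A : l2 -> l2).
Hypothesis HA : eigen_operator f A.
Hypothesis Hmono : (forall x, norm (A x) <= norm x) \/ (forall x, norm x <= norm (A x)).

Lemma orbit_monotone (x : l2) :
  (forall m n, (m <= n)%nat -> norm (Nat.iter n A x) <= norm (Nat.iter m A x)) \/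
  (forall m n, (m <= n)%nat -> norm (Nat.iter m A x) <= norm (Nat.iter n A x)).
Proof.
  destruct Hmono as [H | H]; [left | right]; intros m n Hmn;
    (induction Hmn as [| n Hmn IH]; [apply Rle_refl |]); simpl.
  - eapply Rle_trans; [apply H | exact IH].
  - eapply Rle_trans; [exact IH | apply H].
Qed.

Lemma monotone_not_Li_Yorke : ~ Li_Yorke_chaotic A.
Proof.
  intros (x & H1 & H2).
  set (u := fun n => norm (Nat.iter n A x)) in *.
  assert (Hex : ex_lim_seq u).
  { destruct (orbit_monotone x) as [H | H].
    - apply ex_lim_seq_decr. intros n. apply (H n (S n)). lia.
    - apply ex_lim_seq_incr. intros n. apply (H n (S n)). lia. }
  destruct Hex as [l Hl].
  assert (E1 := is_LimSup_seq_unique _ _ (is_lim_LimSup_seq _ _ Hl)).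
  assert (E2 := is_LimInf_seq_unique _ _ (is_lim_LimInf_seq _ _ Hl)).
  change (Rbar_lt 0 (LimSup_seq u)) in H1. change (LimInf_seq u = 0) in H2.
  rewrite E1, <- E2, H2 in H1. simpl in H1. lra.
Qed.

Lemma ray_norm c : 0 <= c -> norm (RtoC c *: basis 0)%L = c.
Proof. intros Hc. rewrite l2_norm_scal, basis_norm, Cmod_R, Rabs_pos_eq; lra. Qed.

Lemma monotone_not_hypercyclic : ~ hypercyclic A.
Proof.
  intros [x Hx].
  assert (Hd : forall (y : l2) e, 0 < e -> exists n, norm (Nat.iter n A x - y)%L < e).
  { intros y e He. destruct (Hx y (mkposreal e He)) as (z & (n & ->) & Hn). exists n. exact Hn. }
  assert (Hx0 : 0 <= norm x) by apply norm_ge_0.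
  destruct (orbit_monotone x) as [H | H].
  - destruct (Hd (RtoC (norm x + 2) *: basis 0)%L 1 Rlt_0_1) as [n Hn].
    rewrite l2_dist_sym in Hn.
    assert (H1 := l2_norm_minus_ge (RtoC (norm x + 2) *: basis 0)%L (Nat.iter n A x)).
    rewrite ray_norm in H1 by lra. specialize (H 0%nat n ltac:(lia)). simpl in H. lra.
  - destruct (Req_dec (norm x) 0) as [E | E].
    + assert (Ex : x = l2_zero) by exact (norm_eq_zero (V := l2_NormedModule) x E).
      destruct (Hd (basis 0) (/ 2) ltac:(lra)) as [n Hn].
      rewrite Ex, (iter_zero f A HA), l2_dist_sym in Hn.
      assert (H1 := l2_norm_minus_ge (basis 0) l2_zero). rewrite basis_norm, l2_norm_zero in H1. lra.
    + destruct (Hd l2_zero (norm x) ltac:(lra)) as [n Hn].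
      assert (H1 := l2_norm_minus_ge (Nat.iter n A x) l2_zero). rewrite l2_norm_zero in H1.
      specialize (H 0%nat n ltac:(lia)). simpl in H. lra.
Qed.

(** One of the two passages between the open unit ball and the exterior of radius 2 is
    impossible. *)
Lemma monotone_not_transitive : ~ topologically_transitive A.
Proof.
  intros HT.
  set (U := fun x : l2 => norm x < 1). set (W := fun x : l2 => 2 < norm x).
  assert (HU : open (T := l2_UniformSpace) U).
  { intros x Hx. unfold U in Hx. assert (He : 0 < 1 - norm x) by lra. exists (mkposreal _ He). intros y Hy.
    assert (Hy' : norm (y - x)%L < 1 - norm x) by exact Hy.
    assert (H := l2_norm_minus_ge y x). unfold U. lra. }
  assert (HW : open (T := l2_UniformSpace) W).
  { intros x Hx. unfold W in Hx. assert (He : 0 < norm x - 2) by lra. exists (mkposreal _ He). intros y Hy.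
    assert (Hy' : norm (y - x)%L < norm x - 2) by exact Hy.
    rewrite l2_dist_sym in Hy'. assert (H := l2_norm_minus_ge x y). unfold W. lra. }
  assert (Ue : exists x, U x) by (exists l2_zero; unfold U; rewrite l2_norm_zero; lra).
  assert (We : exists x, W x) by (exists (RtoC 3 *: basis 0)%L; unfold W; rewrite ray_norm; lra).
  destruct Hmono as [H | H].
  - destruct (HT U W HU HW Ue We) as (n & _ & x & Hx & Hn). unfold U, W in *.
    assert (Hle : norm (Nat.iter n A x) <= norm x).
    { clear Hn. induction n as [| n IH]; [apply Rle_refl |]. simpl. eapply Rle_trans; [apply H | exact IH]. }
    assert (Hn' : 2 < norm (Nat.iter n A x)) by exact Hn. assert (Hx' : norm (x : l2) < 1) by exact Hx.
    apply (Rlt_irrefl 1). eapply Rlt_trans; [| exact Hx']. eapply Rlt_le_trans; [| exact Hle]. lra.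
  - destruct (HT W U HW HU We Ue) as (n & _ & x & Hx & Hn). unfold U, W in *.
    assert (Hle : norm x <= norm (Nat.iter n A x)).
    { clear Hn. induction n as [| n IH]; [apply Rle_refl |]. simpl. eapply Rle_trans; [exact IH | apply H]. }
    assert (Hn' : norm (Nat.iter n A x) < 1) by exact Hn. assert (Hx' : 2 < norm (x : l2)) by exact Hx.
    apply (Rlt_irrefl 1). eapply Rlt_trans; [| exact Hn']. eapply Rlt_le_trans; [| exact Hle]. lra.
Qed.

Lemma monotone_not_distributional : ~ distributionally_chaotic A.
Proof.
  intros (S & HS & Hch).
  assert (Hxy : exists x y, S x /\ S y /\ x <> y).
  { apply NNPP. intros Hno. apply HS. exists (fun _ => 0%nat). intros x y Hx Hy _.
    apply NNPP. intros Hne. apply Hno. now exists x, y. }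
  destruct Hxy as (x & y & Hx & Hy & Hne).
  destruct (Hch x y Hx Hy Hne) as [Hsup (e & He & Hinf)].
  assert (Hgap : forall i, norm (Nat.iter i A x - Nat.iter i A y)%L = norm (Nat.iter i A (x - y)%L))
    by (intros i; now rewrite (iter_minus f A HA)).
  destruct (orbit_monotone (x - y)%L) as [H | H].
  - assert (Hi : exists i, norm (Nat.iter i A (x - y)%L) < e).
    { apply NNPP. intros Hno.
      destruct (limsup_1_freq A x y e (Hsup e He) 1) as (n & Hn & Hf).
      assert (H1 := freq_upper A x y e 0 n ltac:(lia) ltac:(lia)).
      assert (H2 : forall i, (0 <= i < n)%nat -> e <= norm (Nat.iter i A x - Nat.iter i A y)%L).
      { intros i _. rewrite Hgap. apply Rnot_lt_le. intros Hlt. apply Hno. now exists i. }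
      specialize (H1 H2). simpl in H1. unfold Rdiv in H1. rewrite Rmult_0_l in H1. lra. }
    destruct Hi as [i Hi].
    destruct (liminf_0_freq A x y e Hinf (2 * i + 1)) as (n & Hn & Hf).
    assert (H1 := freq_lower A x y e i n ltac:(lia) ltac:(lia)).
    assert (H2 : forall k, (i <= k < n)%nat -> norm (Nat.iter k A x - Nat.iter k A y)%L < e).
    { intros k Hk. rewrite Hgap. specialize (H i k ltac:(lia)). lra. }
    specialize (H1 H2).
    assert (Hn0 : 0 < INR n) by (apply lt_0_INR; lia).
    assert (INR i / INR n <= / 2).
    { apply Rle_div_l; [exact Hn0 |]. apply le_INR in Hn. rewrite plus_INR, mult_INR in Hn. simpl in Hn. lra. }
    lra.
  - set (d := norm (x - y)%L).
    assert (Hd : 0 < d).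
    { assert (H0 : 0 <= d) by apply norm_ge_0. destruct (Req_dec d 0) as [E | E]; [| lra].
      exfalso. apply Hne. apply l2_eq. intros k. apply Cmod_minus_eq_0.
      assert (Hk := l2_coord_le (x - y)%L k). fold d in Hk. rewrite l2_minus_coord in Hk.
      assert (H1 := Cmod_ge_0 (x k - y k)). lra. }
    destruct (limsup_1_freq A x y d (Hsup d Hd) 1) as (n & Hn & Hf).
    assert (H1 := freq_upper A x y d 0 n ltac:(lia) ltac:(lia)).
    assert (H2 : forall i, (0 <= i < n)%nat -> d <= norm (Nat.iter i A x - Nat.iter i A y)%L).
    { intros i _. rewrite Hgap. apply (H 0%nat i). lia. }
    specialize (H1 H2). simpl in H1. unfold Rdiv in H1. rewrite Rmult_0_l in H1. lra.
Qed.

End Monotone.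

(** * Values of a function near the unit circle *)

Lemma continuous_Cmod {U : UniformSpace} (h : U -> C) (u : U) e : continuous h u -> 0 < e ->
  locally u (fun v => Cmod (h v - h u) < e).
Proof.
  intros H He.
  exact (proj1 (filterlim_locally_ball_norm (K := C_AbsRing) (U := C_NormedModule) (F := locally u) h (h u)) H (mkposreal e He)).
Qed.

Lemma locally_C_Cmod (z : C) (P : C -> Prop) : locally z P ->
  exists d, 0 < d /\ forall w, Cmod (w - z) < d -> P w.
Proof.
  intros H. destruct (locally_norm_le_locally (K := C_AbsRing) (V := C_NormedModule) z P H) as [d Hd].
  exists d. split; [apply cond_pos |]. exact Hd.
Qed.

Lemma Cmod_open (z : C) (P : C -> Prop) d : 0 < d -> (forall w, Cmod (w - z) < d -> P w) -> locally z P.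
Proof.
  intros Hd H. apply (locally_le_locally_norm (K := C_AbsRing) (V := C_NormedModule)).
  exists (mkposreal d Hd). exact H.
Qed.

(** Compactness of the rectangle of polar coordinates. *)
Lemma closed_disk_image g r (w : C) : analytic_on_disk g -> 0 <= r < 1 ->
  (forall z, Cmod z <= r -> g z <> w) -> exists d, 0 < d /\ forall z, Cmod z <= r -> d <= Cmod (g z - w).
Proof.
  intros Hg Hr Hw.
  set (F := fun uv : R * R => (g (circle (fst uv) (snd uv)) - w)%C).
  assert (Hpos : forall u v, 0 <= u <= r -> 0 < Cmod (F (u, v))).
  { intros u v Hu. apply Cmod_gt_0. intros E.
    apply (Hw (circle u v)); [rewrite Cmod_circle; lra |].
    apply Cmod_minus_eq_0. unfold F in E. simpl in E. rewrite E. apply Cmod_0. }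
  assert (Hloc : forall u v, exists d : posreal, 0 <= u <= r ->
     d <= Cmod (F (u, v)) / 2 /\
     forall x y, Rabs (x - u) < d -> Rabs (y - v) < d -> Cmod (F (u, v)) / 2 <= Cmod (F (x, y))).
  { intros u v. destruct (Rle_dec 0 u) as [Hu0 | Hu0]; [| exists (mkposreal 1 Rlt_0_1); intros; lra].
    destruct (Rle_dec u r) as [Hur | Hur]; [| exists (mkposreal 1 Rlt_0_1); intros; lra].
    assert (Hp := Hpos u v (conj Hu0 Hur)).
    assert (Hc : continuous F (u, v)).
    { apply Ccont_at_continuous.
      apply (Ccont_at_ext (fun uv : R * R => (g (circle (fst uv) (snd uv)) + - w)%C)); [reflexivity |].
      apply Ccont_at_plus; [| apply Ccont_at_const].
      apply (Ccont_at_comp g (fun uv : R * R => circle (fst uv) (snd uv))).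
      - split; simpl; (apply (continuous_mult (K := R_AbsRing)); [apply continuous_fst |]);
          [apply (continuous_comp snd cos) | apply (continuous_comp snd sin)];
          try apply continuous_snd;
          smooth.
      - simpl. apply analytic_continuous; [exact Hg |]. unfold disk. rewrite Cmod_circle; lra. }
    assert (Hp2 : 0 < Cmod (F (u, v)) / 2) by lra.
    destruct (continuous_Cmod F (u, v) _ Hc Hp2) as [e He].
    assert (Hm : 0 < Rmin e (Cmod (F (u, v)) / 2)) by (apply Rmin_pos; [apply cond_pos | lra]).
    exists (mkposreal _ Hm). intros _. simpl. split; [apply Rmin_r |].
    intros x y Hx Hy.
    assert (m1 := Rmin_l e (Cmod (F (u, v)) / 2)).
    assert (Hb : ball (u, v) e (x, y)).
    { split; simpl; [change (Rabs (x - u) < e) | change (Rabs (y - v) < e)]; lra. }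
    specialize (He _ Hb).
    assert (T := Cmod_triangle (- (F (x, y) - F (u, v))) (F (x, y))). rewrite Cmod_opp in T.
    replace (- (F (x, y) - F (u, v)) + F (x, y))%C with (F (u, v)) in T by ring. lra. }
  set (delta := fun u v => epsilon (inhabits (mkposreal 1 Rlt_0_1)) (fun d : posreal => 0 <= u <= r ->
     d <= Cmod (F (u, v)) / 2 /\
     forall x y, Rabs (x - u) < d -> Rabs (y - v) < d -> Cmod (F (u, v)) / 2 <= Cmod (F (x, y)))).
  assert (Hdelta : forall u v, 0 <= u <= r -> delta u v <= Cmod (F (u, v)) / 2 /\
     forall x y, Rabs (x - u) < delta u v -> Rabs (y - v) < delta u v -> Cmod (F (u, v)) / 2 <= Cmod (F (x, y))).
  { intros u v. exact (epsilon_spec (inhabits (mkposreal 1 Rlt_0_1)) _ (Hloc u v)). }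
  destruct (compactness_value_2d 0 r (- PI) PI delta) as [d Hd].
  exists d. split; [apply cond_pos |]. intros z Hz.
  destruct (circle_polar z) as (t & Ht & E).
  assert (Hz0 : 0 <= Cmod z <= r) by (split; [apply Cmod_ge_0 | exact Hz]).
  destruct (NNPP _ (Hd (Cmod z) t Hz0 Ht)) as (u & v & Hu & Hv & H1 & H2 & H3).
  destruct (Hdelta u v Hu) as [H4 H5]. specialize (H5 _ _ H1 H2).
  rewrite E. change (d <= Cmod (F (Cmod z, t))). lra.
Qed.


Lemma cis_pow t m : Cp (cis t) m = cis (INR m * t).
Proof.
  induction m as [| m IH].
  - rewrite Rmult_0_l, cis_0. reflexivity.
  - change (@eq C (cis t * Cp (cis t) m)%C (cis (INR (S m) * t))).
    rewrite IH, <- cis_plus, S_INR. f_equal. ring.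
Qed.

Lemma cis_2kPI (k : Z) : cis (2 * (IZR k * PI)) = 1%C.
Proof.
  assert (Es : sin (IZR k * PI) = 0) by (apply sin_eq_0_1; now exists k).
  unfold cis. rewrite cos_2a_sin, sin_2a, Es.
  unfold RtoC. f_equal; ring.
Qed.

Lemma cis_inj s t : Rabs (s - t) < PI -> cis s = cis t -> s = t.
Proof.
  intros Hst E. injection E. intros E2 E1.
  assert (H : sin (s - t) = 0) by (rewrite sin_minus, E1, E2; ring).
  apply Rabs_def2 in Hst.
  destruct (Rtotal_order (s - t) 0) as [Hlt | [Heq | Hgt]]; [| lra |].
  - assert (H1 : 0 < sin (t - s)) by (apply sin_gt_0; lra).
    replace (t - s) with (- (s - t)) in H1 by ring. rewrite sin_neg in H1. lra.
  - assert (0 < sin (s - t)) by (apply sin_gt_0; lra). lra.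
Qed.

(** With [s = 2 PI / N] small, the angles are [s * (k + 1 / (i + 2))], rational
    multiples of [2 * PI] within one step [s] after the first multiple of [s] beyond
    [x]. *)
Lemma roots_on_arc x e : 0 < e -> exists theta : nat -> R, (forall i, x < theta i < x + e) /\
  (forall i, exists m, (0 < m)%nat /\ Cp (cis (theta i)) m = RtoC 1) /\
  (forall i j, cis (theta i) = cis (theta j) -> i = j).
Proof.
  intros He. assert (HPI := PI_RGT_0).
  destruct (archimed_cor1 (Rmin (e / (4 * PI)) (/ 2))) as (N & HN & HN0).
  { apply Rmin_pos; [apply Rdiv_lt_0_compat; lra | lra]. }
  min_bounds (e / (4 * PI)) (/ 2).
  assert (HNp : 0 < INR N) by now apply lt_0_INR.
  assert (HN1 : 2 * PI / INR N < e / 2).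
  { assert (H : / INR N < e / (4 * PI)) by lra. apply (Rmult_lt_compat_l (2 * PI)) in H; [| lra].
    replace (2 * PI * (e / (4 * PI))) with (e / 2) in H by (field; lra). exact H. }
  assert (HN2 : 2 * PI / INR N < PI).
  { assert (H : / INR N < / 2) by lra. apply (Rmult_lt_compat_l (2 * PI)) in H; [| lra].
    replace (2 * PI * / 2) with PI in H by field. exact H. }
  set (s := 2 * PI / INR N) in *.
  assert (Hs : 0 < s) by (apply Rdiv_lt_0_compat; lra).
  (* [k s] is the first multiple of [s] beyond [x]. *)
  set (k := up (x / s)). destruct (archimed (x / s)) as [K1 K2]. fold k in K1, K2.
  assert (K1' : x < IZR k * s).
  { apply Rgt_lt in K1. apply Rlt_div_l in K1; lra. }
  assert (K2' : IZR k * s <= x + s).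
  { assert (IZR k <= x / s + 1) by lra. apply (Rmult_le_compat_r s) in H; [| lra].
    replace ((x / s + 1) * s) with (x + s) in H by (field; lra). exact H. }
  assert (Hi : forall i, 0 < / (INR i + 2) <= / 2).
  { intros i. assert (H := pos_INR i). split; [apply Rinv_0_lt_compat; lra | apply Rinv_le_contravar; lra]. }
  exists (fun i => s * (IZR k + / (INR i + 2))). split; [| split].
  - intros i. specialize (Hi i). split; nra.
  - intros i. exists (N * (i + 2))%nat. split; [lia |].
    rewrite cis_pow.
    replace (INR (N * (i + 2)) * (s * (IZR k + / (INR i + 2)))) with (2 * (IZR (k * Z.of_nat (i + 2) + 1) * PI)).
    + apply cis_2kPI.
    + rewrite mult_INR, plus_IZR, mult_IZR, <- INR_IZR_INZ, plus_INR. simpl INR. unfold s.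
      assert (H := pos_INR i). field. lra.
  - intros i j E. apply cis_inj in E.
    + assert (E' : / (INR i + 2) = / (INR j + 2)) by nra.
      apply Rinv_eq_reg in E'. apply INR_eq. lra.
    + assert (H1 := Hi i). assert (H2 := Hi j).
      replace (s * (IZR k + / (INR i + 2)) - s * (IZR k + / (INR j + 2))) with (s * (/ (INR i + 2) - / (INR j + 2))) by ring.
      apply Rabs_def1; nra.
Qed.

Section Values.

Variable f : C -> C.
Hypothesis Hf : analytic_on_disk f.

(** The arc is covered by the values on an increasing sequence of compact subdisks.
    These sets of values are closed, so by Baire one of them contains an arc. This
    stands in for the open mapping theorem: openness of the set of all values alone does
    not locate the preimages away from the boundary. *)
Lemma arc_from_subdisk t0 del : 0 < del ->
  (forall t, Rabs (t - t0) <= del -> exists z, disk z /\ f z = cis t) ->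
  exists r x e, 0 <= r < 1 /\ 0 < e /\ forall t, Rabs (t - x) < e -> exists z, Cmod z <= r /\ f z = cis t.
Proof.
  intros Hdel Harc.
  set (rad := fun n : nat => 1 - / (INR n + 1)).
  assert (Hrad : forall n, 0 <= rad n < 1).
  { intros n. unfold rad. assert (H := pos_INR n).
    assert (0 < / (INR n + 1)) by (apply Rinv_0_lt_compat; lra).
    assert (/ (INR n + 1) <= / 1) by (apply Rinv_le_contravar; lra). rewrite Rinv_1 in *. lra. }
  set (G := fun n t => ~ exists z, Cmod z <= rad n /\ f z = cis t).
  assert (Gopen : forall n t, G n t -> exists d, 0 < d /\ forall s, Rabs (s - t) <= d -> G n s).
  { intros n t Ht.
    destruct (closed_disk_image f (rad n) (cis t) Hf (Hrad n)) as (d & Hd & Hdist).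
    { intros z Hz E. apply Ht. now exists z. }
    assert (Hc : continuous cis t).
    { apply Ccont_at_continuous. apply Ccont_at_ext with (2 := Ccont_cis 1 t). intros; now rewrite Rmult_1_l. }
    destruct (continuous_Cmod cis t d Hc Hd) as [e He].
    exists (e / 2). assert (He0 := cond_pos e). split; [lra |].
    intros s Hs (z & Hz & E). specialize (Hdist z Hz). rewrite E in Hdist.
    assert (Hb : ball t e s) by (change (Rabs (s - t) < e); lra).
    specialize (He s Hb). lra. }
  apply NNPP. intros Hno.
  destruct (baire (V := R_NormedModule) (complete_seq_complete R_CompleteNormedModule) G t0 del Hdel) as (t & Ht & HG).
  - intros n x e He Hin.
    assert (Hex : exists y, Rabs (y - x) < e /\ G n y).
    { apply NNPP. intros Hno2. apply Hno. exists (rad n), x, e. split; [apply Hrad | split; [exact He |]].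
      intros t Ht. apply NNPP. intros Hg. apply Hno2. now exists t. }
    destruct Hex as (y & Hy & Gy). destruct (Gopen n y Gy) as (d & Hd & Hd').
    min_bounds d (e - Rabs (y - x)).
    exists y, (Rmin d (e - Rabs (y - x))). split; [apply Rmin_pos; lra |].
    intros z Hz. change (Rabs (z - y) <= Rmin d (e - Rabs (y - x))) in Hz. split; [| apply Hd'; lra].
    change (Rabs (z - x) <= e). replace (z - x) with ((z - y) + (y - x)) by ring.
    eapply Rle_trans; [apply Rabs_triang | lra].
  - destruct (Harc t Ht) as (z & Hz & E).
    unfold disk in Hz. destruct (archimed_cor1 (1 - Cmod z) ltac:(lra)) as (n & Hn & Hn0).
    apply (HG n). exists z. split; [| exact E]. unfold rad.
    assert (0 < INR n) by now apply lt_0_INR.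
    assert (/ (INR n + 1) <= / INR n) by (apply Rinv_le_contravar; lra). lra.
Qed.

(** A sequence of distinct points tending to [z0] stays in a compact subdisk, so
    [eigvecs_total] applies. *)
Lemma eigvecs_open_total (P : C -> Prop) z0 : disk z0 -> locally z0 P -> forall x, in_closure (eigvecs P) x.
Proof.
  intros Hz0 HP. unfold disk in Hz0. destruct (locally_C_Cmod z0 P HP) as (d & Hd & HPd).
  set (c := Rmin d ((1 - Cmod z0) / 2)).
  assert (m1 : c <= d) by apply Rmin_l. assert (m2 : c <= (1 - Cmod z0) / 2) by apply Rmin_r.
  assert (Hc : 0 < c) by (apply Rmin_pos; lra).
  assert (Hi : forall i, 0 < c * / (INR i + 2) < c).
  { intros i. assert (H := pos_INR i).
    assert (0 < / (INR i + 2)) by (apply Rinv_0_lt_compat; lra).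
    assert (/ (INR i + 2) <= / 2) by (apply Rinv_le_contravar; lra). nra. }
  apply (eigvecs_total P (fun i => z0 + RtoC (c * / (INR i + 2)))%C ((1 + Cmod z0) / 2)).
  - intros i j E.
    assert (E' : RtoC (c * / (INR i + 2)) = RtoC (c * / (INR j + 2))).
    { replace (RtoC (c * / (INR i + 2))) with (z0 + RtoC (c * / (INR i + 2)) - z0)%C by ring. rewrite E. ring. }
    injection E'. intros E2. apply Rmult_eq_reg_l in E2; [| lra]. apply Rinv_eq_reg in E2. apply INR_eq. lra.
  - intros i. eapply Rle_trans; [apply Cmod_triangle |]. specialize (Hi i).
    rewrite Cmod_R, Rabs_pos_eq by lra. lra.
  - lra.
  - intros i. apply HPd. specialize (Hi i).
    replace (z0 + RtoC (c * / (INR i + 2)) - z0)%C with (RtoC (c * / (INR i + 2))) by ring.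
    rewrite Cmod_R, Rabs_pos_eq; lra.
Qed.

Hypothesis Hopen : open (fun w : C => exists z, disk z /\ w = Cconj (f z)).
Variable z0 : C.
Hypothesis Hz0 : disk z0.
Hypothesis Hmod : Cmod (f z0) = 1.

(** Openness is assumed for the conjugate values; conjugation is an isometry. *)
Lemma nearby_value : exists d, 0 < d /\ forall w, Cmod (w - f z0) < d -> exists z, disk z /\ f z = w.
Proof.
  destruct (locally_C_Cmod _ _ (Hopen (Cconj (f z0)) (ex_intro _ z0 (conj Hz0 eq_refl)))) as (d & Hd & H).
  exists d. split; [exact Hd |]. intros w Hw.
  destruct (H (Cconj w)) as (z & Hz & E).
  - rewrite <- Cminus_conj, Cmod_conj. exact Hw.
  - exists z. split; [exact Hz |]. rewrite <- (Cconj_conj w), E. symmetry. apply Cconj_conj.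
Qed.

Lemma Cmod_f_locally (P : R -> Prop) z : disk z -> (exists e, 0 < e /\ forall s, Rabs (s - Cmod (f z)) < e -> P s) ->
  locally z (fun w => P (Cmod (f w))).
Proof.
  intros Hz (e & He & H).
  apply filter_imp with (2 := continuous_Cmod f z e (analytic_continuous f z Hf Hz) He).
  intros w Hw. apply H.
  assert (T1 := Cmod_triangle (f w - f z) (f z)). assert (T2 := Cmod_triangle (- (f w - f z)) (f w)).
  rewrite Cmod_opp in T2. replace (f w - f z + f z)%C with (f w) in T1 by ring.
  replace (- (f w - f z) + f w)%C with (f z) in T2 by ring.
  apply Rabs_def1; lra.
Qed.

Lemma small_values : exists z, disk z /\ Cmod (f z) < 1.
Proof.
  destruct nearby_value as (d & Hd & H). set (c := Rmin (d / 2) (/ 2)).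
  assert (m1 : c <= d / 2) by apply Rmin_l. assert (m2 : c <= / 2) by apply Rmin_r.
  assert (Hc : 0 < c) by (apply Rmin_pos; lra).
  destruct (H (RtoC (1 - c) * f z0)%C) as (z & Hz & E).
  - replace (RtoC (1 - c) * f z0 - f z0)%C with (RtoC (- c) * f z0)%C by (rewrite RtoC_minus, RtoC_opp; ring).
    rewrite Cmod_mult, Hmod, Cmod_R, Rabs_Ropp, Rabs_pos_eq; lra.
  - exists z. split; [exact Hz |]. rewrite E, Cmod_mult, Hmod, Cmod_R, Rabs_pos_eq; lra.
Qed.

Lemma large_values : exists z, disk z /\ 1 < Cmod (f z).
Proof.
  destruct nearby_value as (d & Hd & H).
  destruct (H (RtoC (1 + d / 2) * f z0)%C) as (z & Hz & E).
  - replace (RtoC (1 + d / 2) * f z0 - f z0)%C with (RtoC (d / 2) * f z0)%C by (rewrite RtoC_plus; ring).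
    rewrite Cmod_mult, Hmod, Cmod_R, Rabs_pos_eq; lra.
  - exists z. split; [exact Hz |]. rewrite E, Cmod_mult, Hmod, Cmod_R, Rabs_pos_eq; lra.
Qed.

Lemma small_total : forall x, in_closure (eigvecs (fun l => Cmod (f l) < 1)) x.
Proof.
  destruct small_values as (z & Hz & Hlt). apply eigvecs_open_total with z; [exact Hz |].
  apply (Cmod_f_locally (fun s => s < 1)); [exact Hz |].
  exists (1 - Cmod (f z)). split; [lra |]. intros s Hs. apply Rabs_def2 in Hs. lra.
Qed.

Lemma large_total : forall x, in_closure (eigvecs (fun l => 1 < Cmod (f l))) x.
Proof.
  destruct large_values as (z & Hz & Hlt). apply eigvecs_open_total with z; [exact Hz |].
  apply (Cmod_f_locally (fun s => 1 < s)); [exact Hz |].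
  exists (Cmod (f z) - 1). split; [lra |]. intros s Hs. apply Rabs_def2 in Hs. lra.
Qed.

(** Distinct roots of unity have distinct preimages, and these can all be taken in one
    compact subdisk. *)
Lemma roots_total : forall x, in_closure (eigvecs (fun l => exists m, (0 < m)%nat /\ Cp (f l) m = RtoC 1)) x.
Proof.
  destruct nearby_value as (d & Hd & Hnear).
  destruct (circle_polar (f z0)) as (t0 & _ & E0). rewrite Hmod in E0.
  assert (E0' : f z0 = cis t0) by (rewrite E0; unfold circle, cis; f_equal; ring).
  assert (Hc : continuous cis t0).
  { apply Ccont_at_continuous. apply Ccont_at_ext with (2 := Ccont_cis 1 t0). intros; now rewrite Rmult_1_l. }
  destruct (continuous_Cmod cis t0 d Hc Hd) as [e He]. assert (He0 := cond_pos e).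
  destruct (arc_from_subdisk t0 (e / 2) ltac:(lra)) as (r & x & e' & Hr & He' & Harc).
  { intros t Ht. apply Hnear. rewrite E0'. apply He. change (Rabs (t - t0) < e). lra. }
  destruct (roots_on_arc x e' He') as (theta & Hth & Hroot & Hinj).
  assert (Hlam : forall i, exists z, Cmod z <= r /\ f z = cis (theta i)).
  { intros i. apply Harc. specialize (Hth i). apply Rabs_def1; lra. }
  set (lam := fun i => epsilon (inhabits (RtoC 0)) (fun z => Cmod z <= r /\ f z = cis (theta i))).
  assert (Hl : forall i, Cmod (lam i) <= r /\ f (lam i) = cis (theta i))
    by (intros i; exact (epsilon_spec (inhabits (RtoC 0)) _ (Hlam i))).
  apply (eigvecs_total _ lam r).
  - intros i j E. apply Hinj. destruct (Hl i) as [_ <-]. destruct (Hl j) as [_ <-]. now rewrite E.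
  - intros i. apply Hl.
  - apply Hr.
  - intros i. destruct (Hl i) as [_ ->]. apply Hroot.
Qed.

End Values.

(** * The dichotomy *)

Lemma analytic_ext (f g : C -> C) : (forall z, disk z -> f z = g z) -> analytic_on_disk f -> analytic_on_disk g.
Proof.
  intros E Hf z0 Hz0. unfold disk in *. destruct (Hf z0 Hz0) as (a & rho & Ha).
  assert (Hr : 0 < Rmin rho (1 - Cmod z0)) by (apply Rmin_pos; [apply cond_pos | lra]).
  exists a, (mkposreal _ Hr). intros z Hz. simpl in Hz.
  min_bounds rho (1 - Cmod z0).
  rewrite <- E; [apply Ha; lra |].
  assert (H := Cmod_triangle (z - z0) z0). replace (z - z0 + z0)%C with z in H by ring. lra.
Qed.

(** The two operators invert each other on eigenvectors, hence on a dense subspace,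
    hence everywhere. *)
Lemma calc_inverse (f g : C -> C) (A B : l2 -> l2) : eigen_operator f A -> eigen_operator g B ->
  (forall z, disk z -> (f z * g z)%C = 1%C) -> forall x, A (B x) = x.
Proof.
  intros HA HB Hfg x.
  destruct (op_bounded f A HA) as (M & HM1 & HM). destruct (op_bounded g B HB) as (N & HN1 & HN).
  assert (Hspan : forall w : l2, lin_span (eigvecs (fun _ => True)) w -> A (B w) = w).
  { intros w Hw. induction Hw as [| c u v (l & _ & Hl & ->) _ IH].
    - change (A (B l2_zero) = l2_zero).
      assert (EB : B l2_zero = l2_zero) by exact (iter_zero g B HB 1).
      rewrite EB. exact (iter_zero f A HA 1).
    - change (A (B (c *: eigvec l + v)%L) = (c *: eigvec l + v)%L).
      rewrite (op_plus g B HB), (op_plus f A HA), IH. f_equal.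
      rewrite (op_scal g B HB), (op_scal f A HA). f_equal.
      rewrite (op_eigvec g B HB), (op_scal f A HA), (op_eigvec f A HA) by exact Hl.
      rewrite l2_scal_assoc, Cmult_comm, Hfg by exact Hl. apply l2_scal_one. }
  assert (H0 : norm (A (B x) - x)%L <= 0).
  { apply Rnot_lt_le. intros Hlt. set (d := norm (A (B x) - x)%L) in *.
    assert (HMN : 1 <= M * N) by nra.
    destruct (eigvecs_open_total (fun _ => True) (RtoC 0)) with (x := x) (e := d / (2 * (M * N + 1))) as (w & Hw & Hwx).
    - unfold disk. rewrite Cmod_0. lra.
    - apply filter_true.
    - apply Rdiv_lt_0_compat; lra.
    - assert (Ew : (A (B x) - x)%L = (A (B (x - w)%L) + (w - x))%L).
      { assert (EB : B (x - w)%L = (B x - B w)%L) by exact (iter_minus g B HB 1 x w).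
        assert (EA : A (B x - B w)%L = (A (B x) - A (B w))%L) by exact (iter_minus f A HA 1 (B x) (B w)).
        rewrite EB, EA, (Hspan w Hw). l2_ext; ring. }
      assert (H1 : d <= M * (N * norm (x - w)%L) + norm (w - x)%L).
      { unfold d. rewrite Ew. eapply Rle_trans; [apply l2_triangle |]. apply Rplus_le_compat_r.
        eapply Rle_trans; [apply HM |]. apply Rmult_le_compat_l; [lra | apply HN]. }
      rewrite (l2_dist_sym x w) in H1. apply Rlt_div_r in Hwx; [| lra].
      assert (Hn : 0 <= norm (w - x)%L) by apply norm_ge_0. nra. }
  apply l2_eq. intros k. apply Cmod_minus_eq_0.
  assert (Hk := l2_coord_le (A (B x) - x)%L k). rewrite l2_minus_coord in Hk.
  assert (H1 := Cmod_ge_0 (A (B x) k - x k)). lra.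
Qed.

Definition fully_chaotic (A : l2 -> l2) : Prop :=
  Devaney_chaotic A /\ distributionally_chaotic A /\
  strong_mixing A /\ Li_Yorke_chaotic A /\
  hypercyclic A.

Definition not_chaotic (A : l2 -> l2) : Prop :=
  ~ Devaney_chaotic A /\ ~ distributionally_chaotic A /\
  ~ strong_mixing A /\ ~ Li_Yorke_chaotic A /\
  ~ hypercyclic A.

Lemma total_nonempty (P : C -> Prop) : (forall x, in_closure (eigvecs P) x) -> exists l, disk l /\ P l.
Proof.
  intros H. apply NNPP. intros Hno.
  destruct (H (basis 0) 1 Rlt_0_1) as (y & Hy & Hd).
  assert (E : y = l2_zero).
  { destruct Hy as [| c u v (l & Hl & Hd' & _) _]; [reflexivity |]. exfalso. apply Hno. now exists l. }
  rewrite E, l2_dist_sym in Hd. assert (H1 := l2_norm_minus_ge (basis 0) l2_zero).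
  rewrite basis_norm, l2_norm_zero in H1. lra.
Qed.

Lemma fully_chaotic_of_eigvecs (f : C -> C) (A : l2 -> l2) : eigen_operator f A ->
  (forall x, in_closure (eigvecs (fun l => Cmod (f l) < 1)) x) ->
  (forall x, in_closure (eigvecs (fun l => 1 < Cmod (f l))) x) ->
  (forall x, in_closure (eigvecs (fun l => exists m, (0 < m)%nat /\ Cp (f l) m = RtoC 1)) x) ->
  fully_chaotic A.
Proof.
  intros HA Hs Hl Hr. assert (He := total_nonempty _ Hl).
  split; [| split; [| split; [| split]]].
  - exact (chaos_Devaney f A HA Hs Hl He Hr).
  - destruct (irregular_vector f A HA Hs He) as [x Hx]. exact (chaos_distributional f A x HA Hx).
  - exact (chaos_mixing f A HA Hs Hl).
  - exact (chaos_Li_Yorke f A HA Hs He).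
  - exact (chaos_hypercyclic f A HA Hs Hl).
Qed.

Lemma not_chaotic_of_monotone (f : C -> C) (A : l2 -> l2) : eigen_operator f A ->
  ((forall x, norm (A x) <= norm x) \/ (forall x, norm x <= norm (A x))) -> not_chaotic A.
Proof.
  intros HA Hm. assert (HT := monotone_not_transitive A Hm).
  split; [| split; [| split; [| split]]].
  - intros [H _]. exact (HT H).
  - exact (monotone_not_distributional f A HA Hm).
  - intros H. exact (HT (mixing_transitive A H)).
  - exact (monotone_not_Li_Yorke A Hm).
  - exact (monotone_not_hypercyclic f A HA Hm).
Qed.

(** If no value has modulus 1, the inside and the outside of the circle separate the
    values. *)
Lemma dichotomy (phi : C -> C) (Om : C -> Prop) : connected Om ->
  (forall w, Om w <-> exists z, disk z /\ w = Cconj (phi z)) ->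
  (exists z, disk z /\ Cmod (phi z) = 1) \/ (forall z, disk z -> Cmod (phi z) <= 1) \/
  (forall z, disk z -> 1 <= Cmod (phi z)).
Proof.
  intros Hconn HOm.
  destruct (classic (exists z, disk z /\ Cmod (phi z) = 1)) as [H | Hno]; [now left | right].
  assert (Hne : forall z, disk z -> Cmod (phi z) <> 1) by (intros z Hz E; apply Hno; now exists z).
  apply NNPP. intros H2. apply not_or_and in H2. destruct H2 as [Ha Hb].
  apply not_all_ex_not in Ha. destruct Ha as [z1 H1]. apply imply_to_and in H1. destruct H1 as [Hz1 H1].
  apply not_all_ex_not in Hb. destruct Hb as [z2 H2]. apply imply_to_and in H2. destruct H2 as [Hz2 H2].
  assert (Hopen1 : open (fun w : C => Cmod w < 1)).
  { intros w Hw. change C in w. apply (Cmod_open w _ (1 - Cmod w)); [lra |]. intros v Hv.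
    assert (T := Cmod_triangle (v - w) w). replace (v - w + w)%C with v in T by ring. lra. }
  assert (Hopen2 : open (fun w : C => 1 < Cmod w)).
  { intros w Hw. change C in w. apply (Cmod_open w _ (Cmod w - 1)); [lra |]. intros v Hv.
    assert (T := Cmod_triangle (- (v - w)) v). rewrite Cmod_opp in T.
    replace (- (v - w) + v)%C with w in T by ring. lra. }
  destruct (Hconn _ _ Hopen1 Hopen2) as (w & _ & Hw1 & Hw2); [| | | lra].
  - intros w Hw. apply HOm in Hw. destruct Hw as (z & Hz & ->). rewrite Cmod_conj.
    specialize (Hne z Hz). lra.
  - exists (Cconj (phi z2)). rewrite Cmod_conj. split; [apply HOm; now exists z2 | lra].
  - exists (Cconj (phi z1)). rewrite Cmod_conj. split; [apply HOm; now exists z1 | lra].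
Qed.

Theorem corollary4p5 (phi : C -> C)
    (phi_Hinf : Hinf phi)
    (phi_CD : Cowen_Douglas_function phi)
    (phi_inv : Hinf_invertible phi) :
  let A : l2 -> l2 := Hinf_calc phi backward_shift in
  let B : l2 -> l2 := Hinf_calc (fun z => (/ phi z)%C) backward_shift in
  (Devaney_chaotic A <-> Devaney_chaotic B) /\
  (distributionally_chaotic A <-> distributionally_chaotic B) /\
  (strong_mixing A <-> strong_mixing B) /\
  (Li_Yorke_chaotic A <-> Li_Yorke_chaotic B) /\
  (hypercyclic A <-> hypercyclic B).
Proof.
  intros A B.
  assert (Main : (fully_chaotic A /\ fully_chaotic B) \/ (not_chaotic A /\ not_chaotic B)).
  { destruct phi_Hinf as [phi_an [M HM]].
    destruct phi_CD as (Mphi & Mstar & _ & _ & n & _ & Hopen & Hconn & _).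
    destruct phi_inv as (psi & [psi_an [N HN]] & Hinv).
    assert (Hnz : forall z, disk z -> phi z <> 0%C).
    { intros z Hz E. specialize (Hinv z Hz). rewrite E, Cmult_0_l in Hinv. injection Hinv. lra. }
    assert (Epsi : forall z, disk z -> psi z = (/ phi z)%C).
    { intros z Hz. replace (psi z) with (/ phi z * (phi z * psi z))%C by (field; now apply Hnz).
      rewrite Hinv by exact Hz. ring. }
    set (rho := fun z => (/ phi z)%C) in *.
    assert (rho_an : analytic_on_disk rho) by exact (analytic_ext psi rho Epsi psi_an).
    assert (HN' : forall z, disk z -> Cmod (rho z) <= N) by (intros z Hz; unfold rho; rewrite <- Epsi by exact Hz; auto).
    assert (Hinv1 : forall z, disk z -> (phi z * rho z)%C = 1%C) by (intros z Hz; apply Cinv_r; auto).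
    assert (Hinv2 : forall z, disk z -> (rho z * phi z)%C = 1%C) by (intros z Hz; rewrite Cmult_comm; auto).
    assert (Hmod : forall z, disk z -> Cmod (phi z) * Cmod (rho z) = 1)
      by (intros z Hz; rewrite <- Cmod_mult, Hinv1 by exact Hz; apply Cmod_1).
    assert (HA := proj1 (calc_eigen_operator phi M phi_an HM)). fold A in HA.
    assert (HB := proj1 (calc_eigen_operator rho N rho_an HN')). fold B in HB.
    assert (AB := calc_inverse phi rho A B HA HB Hinv1).
    assert (BA := calc_inverse rho phi B A HB HA Hinv2).
    assert (Hpos : forall z, 0 <= Cmod (phi z)) by (intros; apply Cmod_ge_0).
    assert (Hpos' : forall z, 0 <= Cmod (rho z)) by (intros; apply Cmod_ge_0).
    destruct (dichotomy phi _ Hconn (fun w => iff_refl _)) as [(z0 & Hz0 & H1) | [Hle | Hge]].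
    - left.
      assert (Ts := small_total phi phi_an Hopen z0 Hz0 H1).
      assert (Tl := large_total phi phi_an Hopen z0 Hz0 H1).
      assert (Tr := roots_total phi phi_an Hopen z0 Hz0 H1).
      split; [exact (fully_chaotic_of_eigvecs phi A HA Ts Tl Tr) |].
      apply (fully_chaotic_of_eigvecs rho B HB); intros x.
      + apply closure_mono with (2 := Tl x). intros y (l & Hl & Hd & ->). exists l. split; [| now split].
        specialize (Hmod l Hd). specialize (Hpos' l). nra.
      + apply closure_mono with (2 := Ts x). intros y (l & Hl & Hd & ->). exists l. split; [| now split].
        specialize (Hmod l Hd). specialize (Hpos l). nra.
      + apply closure_mono with (2 := Tr x). intros y (l & (m & Hm & Em) & Hd & ->). exists l. split; [| now split].
        exists m. split; [exact Hm |].
        assert (E : (Cp (phi l) m * Cp (rho l) m)%C = RtoC 1).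
        { clear Hm Em. induction m as [| m IH]; [apply Cmult_1_l |].
          change ((phi l * Cp (phi l) m) * (rho l * Cp (rho l) m) = RtoC 1)%C.
          transitivity ((phi l * rho l) * (Cp (phi l) m * Cp (rho l) m))%C; [ring |].
          rewrite IH, Hinv1 by exact Hd. ring. }
        rewrite Em in E. rewrite <- E. symmetry. apply Cmult_1_l.
    - right.
      assert (HC : forall x, norm (A x) <= norm x).
      { intros x. rewrite <- (Rmult_1_l (norm x)). apply (proj2 (calc_eigen_operator phi 1 phi_an Hle)). }
      split; [apply (not_chaotic_of_monotone phi A HA); now left |].
      apply (not_chaotic_of_monotone rho B HB). right. intros x. rewrite <- (AB x) at 1. apply HC.
    - right.
      assert (Hle : forall z, disk z -> Cmod (rho z) <= 1).
      { intros z Hz. specialize (Hmod z Hz). specialize (Hge z Hz). specialize (Hpos' z). nra. }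
      assert (HC : forall x, norm (B x) <= norm x).
      { intros x. rewrite <- (Rmult_1_l (norm x)). apply (proj2 (calc_eigen_operator rho 1 rho_an Hle)). }
      split; [| apply (not_chaotic_of_monotone rho B HB); now left].
      apply (not_chaotic_of_monotone phi A HA). right. intros x. rewrite <- (BA x) at 1. apply HC. }
  unfold fully_chaotic, not_chaotic in Main. clearbody A B. tauto.
Qed.
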